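(* Let $d\ge 3$ and let $A=(a^{ij})_{1\le i,j\le d}$ be a real orthogonal $d\times d$ matrix. Let $u_0\in H^k(\mathbb{T}^d;\mathbb{R}^d)$ with $k>\frac d2+3$, and let $u$ be the corresponding local solution of the periodic Euler-Poincaré equations on $\mathbb{T}^d$ with initial velocity $u_0$. Put $\overline{\partial_i}=\sum_{j=1}^d a^{ij}\partial_j$ and $\overline{u}_0^i=\sum_{j=1}^d a^{ij}u_0^j$ for $i=1,\dots,d$. Suppose that $\overline{\partial_i}u_0=0$ on $\mathbb{T}^d$ for $i=2,3,\dots,d$. If there exists $x_0\in\mathbb{T}^d$ such that $$\left(\overline{\partial_1}\,\overline{u}_0^1\right)(x_0)<-\sqrt{2}\,\|u_0\|_{H^1},$$ then the solution $u$ blows up in finite time.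
   Context: $\mathbb{T}^d=\mathbb{R}^d/\mathbb{Z}^d$ (functions of period $1$ in each coordinate). The periodic Euler-Poincaré equations in dimension $d$ for the velocity $u=(u^1,\dots,u^d)$ with momentum $m=(1-\Delta)u$ are $$\partial_t m^i+\sum_{j=1}^d u^j\partial_j m^i+\sum_{j=1}^d m^j\partial_i u^j+m^i\sum_{j=1}^d\partial_j u^j=0,\quad i=1,\dots,d,\qquad m|_{t=0}=m_0=(1-\Delta)u_0.$$ For $u_0\in H^k(\mathbb{T}^d)$ with $k>\frac d2+3$ there is a time $T>0$ and a unique solution $u\in C([0,T];H^k(\mathbb{T}^d))$; this is the ''corresponding local solution'', extended to its maximal existence time (lifespan) $T^*\in(0,\infty]$ in $H^k$. ''Blows up in finite time'' means $T^*<\infty$ (in which case $\limsup_{t\to T^*}\|u(t)\|_{H^k}=\infty$). The $H^1$ norm is $\|u\|_{H^1}^2=\int_{\mathbb{T}^d}\left(|u|^2+|\nabla u|^2\right)dx$. *)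

(* Defs.v *)
(* Periodic Euler-Poincare equations, over a MathComp-Analysis realType.
   A function on the torus T^d = R^d / Z^d is a function on R^d = 'rV[R]_d that
   has period 1 in each coordinate. *)
From mathcomp Require Import all_boot all_order all_algebra.
From mathcomp Require Import all_classical all_reals all_analysis.

Set Implicit Arguments.
Unset Strict Implicit.
Unset Printing Implicit Defensive.

Import Order.TTheory GRing.Theory Num.Theory.
Import numFieldNormedType.Exports.

Local Open Scope classical_set_scope.
Local Open Scope ring_scope.

Section Torus.
Context {R : realType}.

Definition torus_periodic {d} (f : 'rV[R]_d -> 'rV[R]_d) : Prop :=
  forall j : 'I_d, periodic f (delta_mx 0 j).

(* The integral over the fundamental domain [0,1]^d, as an iterated Lebesgue
   integral, one coordinate at a time.  It is only applied to continuous
   functions, for which it is the integral for the d-dimensional Lebesgue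
   measure by Fubini's theorem. *)
Fixpoint torus_integral (d : nat) : ('rV[R]_d -> R) -> R :=
  match d with
  | 0 => fun f => f 0
  | n.+1 => fun f : 'rV[R]_(1 + n) -> R =>
      Rintegral (@lebesgue_measure R) `[0, 1]
        (fun s : R => torus_integral (fun y : 'rV[R]_n => f (row_mx s%:M y)))
  end.

Definition partial {d} (j : 'I_d) (f : 'rV[R]_d -> R) (x : 'rV[R]_d) : R :=
  'D_(delta_mx 0 j) f x.

Definition laplacian {d} (f : 'rV[R]_d -> R) (x : 'rV[R]_d) : R :=
  \sum_(j < d) partial j (partial j f) x.

Definition component {d} (u : 'rV[R]_d -> 'rV[R]_d) (i : 'I_d)
  (x : 'rV[R]_d) : R := u x 0 i.

(* |u|^2 and |grad u|^2 are Euclidean (the norm `|_| of 'rV[R]_d is the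
   sup norm). *)
Definition H1_norm {d} (u : 'rV[R]_d -> 'rV[R]_d) : R :=
  Num.sqrt (torus_integral (fun x =>
    \sum_(i < d) component u i x ^+ 2
    + \sum_(i < d) \sum_(j < d) partial j (component u i) x ^+ 2)).

Definition frequency_dot {d} (xi : 'rV[int]_d) (x : 'rV[R]_d) : R :=
  \sum_(j < d) (xi 0 j)%:~R * x 0 j.

(* |c|^2 for the Fourier coefficient
   c = \int_{T^d} f(x) e^{-2 pi i xi.x} dx of a real-valued f. *)
Definition fourier_sqr {d} (f : 'rV[R]_d -> R) (xi : 'rV[int]_d) : R :=
  (torus_integral (fun x => f x * cos (2 * pi * frequency_dot xi x))) ^+ 2
  + (torus_integral (fun x => f x * sin (2 * pi * frequency_dot xi x))) ^+ 2.

(* 1 + |2 pi xi|^2, the symbol of 1 - Delta *)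
Definition bessel_symbol {d} (xi : 'rV[int]_d) : R :=
  1 + \sum_(j < d) (2 * pi * (xi 0 j)%:~R) ^+ 2.

(* The norm of H^k(T^d; R^d), for a real exponent k; possibly +oo. *)
Definition sobolev_norm {d} (k : R) (u : 'rV[R]_d -> 'rV[R]_d) : \bar R :=
  ((\sum_(i < d) \esum_(xi in [set: 'rV[int]_d])
      (bessel_symbol xi `^ k * fourier_sqr (component u i) xi)%:E) `^ 2^-1)%E.

(* H^k(T^d; R^d).  It is used for k > d/2, where every class of H^k has exactly
   one continuous representative: H^k is taken to consist of these. *)
Definition sobolev {d} (k : R) (u : 'rV[R]_d -> 'rV[R]_d) : Prop :=
  [/\ continuous u, torus_periodic u & (sobolev_norm k u < +oo)%E].

(* u \in C([0,T]; H^k(T^d; R^d)) *)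
Definition continuous_sobolev {d} (k T : R)
    (u : R -> 'rV[R]_d -> 'rV[R]_d) : Prop :=
  forall t, t \in `[0, T] ->
    sobolev k (u t) /\
    sobolev_norm k (u s \- u t) @[s --> within `[0, T] (nbhs t)] --> 0%E.

Definition momentum {d} (u : 'rV[R]_d -> 'rV[R]_d) (i : 'I_d)
  (x : 'rV[R]_d) : R := component u i x - laplacian (component u i) x.

Definition EP_nonlinearity {d} (u : 'rV[R]_d -> 'rV[R]_d) (i : 'I_d)
    (x : 'rV[R]_d) : R :=
  \sum_(j < d) component u j x * partial j (momentum u i) x
  + \sum_(j < d) momentum u j x * partial i (component u j) x
  + momentum u i x * \sum_(j < d) partial j (component u j) x.

(* Solution in C([0,T]; H^k) of the Euler-Poincare equations with initial
   velocity u0.  For k > d/2 + 3 the equation, a priori an identity in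
   C([0,T]; H^(k-3)), holds pointwise because H^(k-3) embeds in C^0. *)
Definition EP_solution {d} (k : R) (u0 : 'rV[R]_d -> 'rV[R]_d) (T : R)
    (u : R -> 'rV[R]_d -> 'rV[R]_d) : Prop :=
  [/\ continuous_sobolev k T u,
      u 0 =1 u0 &
      forall t, t \in `]0, T[ -> forall (i : 'I_d) (x : 'rV[R]_d),
        is_derive t 1 (fun s => momentum (u s) i x)
          (- EP_nonlinearity (u t) i x)].

(* u, of which only the restriction to [0, Tstar) matters, is the solution
   extended to its maximal existence time Tstar in (0, +oo]. *)
Definition EP_maximal_solution {d} (k : R) (u0 : 'rV[R]_d -> 'rV[R]_d)
    (Tstar : \bar R) (u : R -> 'rV[R]_d -> 'rV[R]_d) : Prop :=
  [/\ (0 < Tstar)%E,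
      forall T, 0 < T -> (T%:E < Tstar)%E -> EP_solution k u0 T u &
      forall T v, 0 < T -> EP_solution k u0 T v ->
        (forall t, 0 <= t <= T -> (t%:E < Tstar)%E -> v t =1 u t) ->
        (T%:E <= Tstar)%E].

Definition blows_up_in_finite_time (Tstar : \bar R) : Prop :=
  (Tstar < +oo)%E.

Definition rotated_partial {d} (A : 'M[R]_d) (i : 'I_d)
    (f : 'rV[R]_d -> R) (x : 'rV[R]_d) : R :=
  \sum_(j < d) A i j * partial j f x.

Definition rotated_component {d} (A : 'M[R]_d) (u : 'rV[R]_d -> 'rV[R]_d)
    (i : 'I_d) (x : 'rV[R]_d) : R :=
  \sum_(j < d) A i j * component u j x.

End Torus.

(* Main.v *)
(* By uniqueness, invariance of u0 under the hyperplane orthogonal to theta, the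
   first row of A, is inherited by u, so u depends on theta.x only. Lines in
   the direction theta close up with the period L = |theta_j| <= 1, for any j
   with theta_j <> 0. With U = theta.u and ' the derivative along theta, the
   equations give
     d/dt U' = H - G * H,   H = U (U - U'') + (|u|^2 - |u'|^2) / 2,
   where G is the L-periodic Green function of 1 - d^2/ds^2. At a minimum of U'
   one has U'' = 0, and an estimate of G * H from below yields
     d/dt min U' <= - (min U')^2 / 2 + 19/20 ||u||_{H^1}^2.
   As the H^1 norm is conserved, min U' < - sqrt 2 ||u0||_{H^1} at t = 0 forces
   min U' to - oo in finite time, whereas a solution in H^k, k > d/2 + 3, is
   bounded in C^3 on bounded time intervals. The embedding of H^k in C^3 comes
   from Fourier inversion, and uniqueness from an L^2 estimate of the difference
   of two momenta. *)

(* The equations give a time derivative for the momentum, not for the velocity. Hence [U'] is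
   rebuilt at each time from [U - U''] by convolution with [G'], and the time derivative passes
   under that integral; the energy is differentiated through the product of a sum of velocities,
   merely continuous in time, with a difference of momenta. Both rest on time derivatives that are
   uniform in space ([udiff]).

   The number 19/20 is [(1 + 14/5) / 4], where 14/5 bounds [L coth (L/2)] for [L <= 1], which is
   [2 L] times the largest value of [G]. A bound below 3 on that quantity is what makes the final
   constant smaller than 1, and so makes the barrier argument strict.

   The minimum of [U'] over the torus is never differentiated as a function of time. It is compared
   with the barrier at a moment of contact, where the time derivative at one fixed minimum point
   decides.

   The index [j] that fixes the period is the one on which the evaluation of the iterated integral
   ends, so that the torus mean of the energy is at once its mean over this period of the line. *)
Require Import Defs.
From mathcomp Require Import all_boot all_order all_algebra.
From mathcomp Require Import all_classical all_reals all_analysis.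
From mathcomp Require Import ring lra zify.
Import Order.TTheory GRing.Theory Num.Theory.
Import numFieldNormedType.Exports.

Local Open Scope classical_set_scope.
Local Open Scope ring_scope.

(** * Integrals and derivatives in one variable *)

Section OneVariable.
Context {R : realType}.
Implicit Types (f g F df : R -> R) (L A a b c e s t x : R).

Definition intL L f : R := Rintegral (@lebesgue_measure R) `[0, L] f.

Lemma continuous_integrable L f : continuous f ->
  (@lebesgue_measure R).-integrable `[0, L] (EFin \o f).
Proof.
move=> cf; apply: continuous_compact_integrable; first exact: segment_compact.
exact: continuous_subspaceT.
Qed.

Lemma intLD L f g : continuous f -> continuous g ->
  intL L (fun s => f s + g s) = intL L f + intL L g.
Proof. by move=> cf cg; apply: RintegralD => //; exact: continuous_integrable. Qed.

Lemma intLZ L f c : continuous f -> intL L (fun s => c * f s) = c * intL L f.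
Proof. by move=> cf; apply: RintegralZl => //; exact: continuous_integrable. Qed.

Lemma intL_cst L c : 0 <= L -> intL L (fun=> c) = c * L.
Proof.
move=> L0; rewrite /intL Rintegral_cst//= lebesgue_measure_itv/= lte_fin.
by case: ltgtP L0 => //= [_|<-] _; rewrite ?subr0 ?mulr0.
Qed.

Lemma le_intL L f g : continuous f -> continuous g ->
  (forall s, 0 <= s <= L -> f s <= g s) -> intL L f <= intL L g.
Proof.
by move=> cf cg fg; apply: le_Rintegral => //; exact: continuous_integrable.
Qed.

Lemma eq_intL L f g : (forall s, 0 <= s <= L -> f s = g s) -> intL L f = intL L g.
Proof.
by move=> fg; apply: eq_Rintegral => x; rewrite inE/= in_itv/=; apply: fg.
Qed.

Lemma is_derive_continuous f x a : is_derive x 1 f a -> {for x, continuous f}.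
Proof.
by move=> fa; apply/differentiable_continuous/derivable1_diffP; exact: ex_derive.
Qed.

Lemma intL_FTC L f F : 0 <= L -> continuous f ->
  (forall x, 0 <= x <= L -> is_derive x 1 F (f x)) -> intL L f = F L - F 0.
Proof.
rewrite le_eqVlt => /predU1P[<- _ _|L0 cf FE].
  by rewrite subrr /intL set_itv1 Rintegral_set1.
rewrite /intL /Rintegral (@continuous_FTC2 _ f F)//.
- exact: continuous_subspaceT.
- split.
  + by move=> x; rewrite in_itv/= => /andP[/ltW ? /ltW ?]; have [] := FE x; [lra|].
  + by apply: cvg_at_right_filter; apply: is_derive_continuous (FE _ _); lra.
  + by apply: cvg_at_left_filter; apply: is_derive_continuous (FE _ _); lra.
- move=> x; rewrite in_itv/= => /andP[/ltW ? /ltW ?]; have [] := FE x; first lra.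
  by rewrite derive1E.
Qed.

(** The primitive is an integral from the fixed endpoint [- A - 1], hence the restriction to a
    bounded range. Each use takes [A] beyond all arguments in play; substitutions in integrals are
    later carried out on such primitives. *)
Lemma antiderivative A f : continuous f ->
  exists F, forall x, `|x| < A -> is_derive x 1 F (f x).
Proof.
move=> cf; exists (fun x => \int[@lebesgue_measure R]_(t in `[- A - 1, x]) f t)%R.
move=> x; rewrite ltr_norml => /andP[Ax xA].
have [] := @continuous_FTC1_closed R f (- A - 1) x A xA _ _ (cf x).
- apply: continuous_compact_integrable; first exact: segment_compact.
  exact: continuous_subspaceT.
- lra.
- by move=> d <-; rewrite derive1E; exact: derivableP.
Qed.

(** In effect the mean value theorem for [f - c * id]. With [c] the derivative at one end, [e]
    measures the oscillation of the derivative, and the remainder is uniform over a family of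
    functions as soon as [e] is. *)
Lemma mean_value_bound f df s t c e :
  (forall x, Num.min s t <= x <= Num.max s t -> is_derive x 1 f (df x)) ->
  (forall x, Num.min s t <= x <= Num.max s t -> `|df x - c| <= e) ->
  `|f s - f t - (s - t) * c| <= e * `|s - t|.
Proof.
wlog st : s t / s <= t.
  move=> h; have /orP[|ts] := le_total s t; first exact: h.
  rewrite minC maxC => H1 H2; have := h _ _ ts H1 H2.
  by rewrite -normrN (distrC t s); congr (`|_| <= _); ring.
rewrite min_l// max_r// => fdf dfe.
have [||x xst E] := @MVT_segment R f df s t st.
- by move=> x; rewrite in_itv/= => /andP[/ltW ? /ltW ?]; apply: fdf; lra.
- apply: derivable_within_continuous => x; rewrite in_itv/= => xst.
  by have [] := fdf x xst.
- have -> : f s - f t - (s - t) * c = (df x - c) * (s - t).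
    by rewrite -(opprB (f t)) E; ring.
  by rewrite normrM ler_wpM2r//; apply: dfe; move: xst; rewrite in_itv.
Qed.

(** A form of differentiability without division: it covers [s = t], and its radius can be made
    uniform in a parameter. [udiff] below is the uniform version. *)
Lemma is_derive_epsP f t c :
  (forall e : R, 0 < e -> exists2 d : R, 0 < d & forall s : R, `|s - t| < d ->
     `|f s - f t - (s - t) * c| <= e * `|s - t|) <->
  is_derive t 1 f c.
Proof.
have E (h : R) : h != 0 -> `|h^-1 *: ((f \o shift t) (h *: 1) - f t) - c| =
    `|h|^-1 * `|f (h + t) - f t - h * c|.
  move=> h0; rewrite /= /GRing.scale/= mulr1 -normfV -normrM; congr `|_|.
  by rewrite [RHS]mulrBr mulKf.
split=> [H|[fd fc]].
- have cv : (fun h : R => h^-1 *: ((f \o shift t) (h *: 1) - f t)) @ 0^' --> c.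
    apply/cvgrPdist_le => /= e e0; have [d d0 Hd] := H e e0.
    near=> h.
    have h0 : h != 0 by near: h; exact: nbhs_dnbhs_neq.
    rewrite distrC E// ler_pdivrMl ?normr_gt0// [leRHS]mulrC.
    have := Hd (h + t); rewrite addrK; apply.
    by near: h; exact: dnbhs0_lt.
  split; first by apply/cvg_ex; exists c.
  exact: cvg_lim cv.
- move=> e e0.
  have : (fun h : R => h^-1 *: ((f \o shift t) (h *: 1) - f t)) @ 0^' --> c.
    by rewrite -fc; exact: fd.
  move=> /cvgrPdist_le /(_ e e0); rewrite near_withinE => -[d /= d0 Hd].
  exists d => // s sd; have [->|st] := eqVneq s t.
    by rewrite !subrr mul0r subr0 normr0 mulr0.
  have h0 : s - t != 0 by rewrite subr_eq0.
  have := Hd (s - t); rewrite /= sub0r normrN => /(_ sd h0).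
  by rewrite distrC E// ler_pdivrMl ?normr_gt0// [leRHS]mulrC subrK.
Unshelve. all: by end_near. Qed.

Lemma is_derive_cst_eq f a b : a <= b ->
  (forall x, a <= x <= b -> {for x, continuous f}) ->
  (forall x, a < x < b -> is_derive x 1 f 0) -> f a = f b.
Proof.
move=> ab cf df.
have dfi x : x \in `]a, b[ -> is_derive x 1 f 0 by rewrite in_itv/=; exact: df.
have cw : {within `[a, b], continuous f}.
  apply: continuous_in_subspaceT => x; rewrite inE/= in_itv/=; exact: cf.
have [x _] := MVT_segment ab dfi cw.
by rewrite mul0r => /eqP; rewrite subr_eq0 => /eqP.
Qed.

Lemma nonincreasing_is_derive f df a b : a <= b ->
  (forall x, a <= x <= b -> {for x, continuous f}) ->
  (forall x, a < x < b -> is_derive x 1 f (df x)) ->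
  (forall x, a < x < b -> df x <= 0) -> f b <= f a.
Proof.
move=> ab cf fdf df0; move: ab; rewrite le_eqVlt => /predU1P[->//|ab].
have dfi x : x \in `]a, b[ -> is_derive x 1 f (df x).
  by rewrite in_itv/=; exact: fdf.
have cw : {within `[a, b], continuous f}.
  apply: continuous_in_subspaceT => x; rewrite inE/= in_itv/=; exact: cf.
have [x xab E] := MVT ab dfi cw.
rewrite -subr_le0 E mulr_le0_ge0//; last by rewrite subr_ge0 ltW.
by apply: df0; move: xab; rewrite in_itv.
Qed.

(** A primitive is nondecreasing while its end values differ by at most 0, so it is constant and its
    derivative vanishes. Interior points only, because the derivative of the constant is taken in a
    two-sided neighbourhood inside the interval. *)
Lemma intL_eq0 L f : 0 <= L -> continuous f ->
  (forall s, 0 <= s <= L -> 0 <= f s) -> intL L f <= 0 ->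
  forall s, 0 < s < L -> f s = 0.
Proof.
move=> L0 cf f0 I0 s sL.
have [F FE] := antiderivative (L + 1) f cf.
have FE' x : 0 <= x <= L -> is_derive x 1 F (f x).
  by move=> xL; apply: FE; rewrite ltr_norml; lra.
rewrite (intL_FTC _ _ _ L0 cf FE') in I0.
have mono x y : 0 <= x -> x <= y -> y <= L -> F x <= F y.
  move=> x0 xy yL; rewrite -lerN2.
  apply: (@nonincreasing_is_derive (fun x => - F x) (fun x => - f x)) => //.
  - move=> z zxy; apply: is_derive_continuous; apply: is_deriveN; apply: FE'; lra.
  - by move=> z zxy; apply: is_deriveN; apply: FE'; lra.
  - by move=> z zxy; rewrite oppr_le0; apply: f0; lra.
have cst x : 0 <= x <= L -> F x = F 0.
  move=> /andP[x0 xL]; apply/eqP; rewrite eq_le; apply/andP; split.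
    by have := mono x L x0 xL (lexx L); lra.
  exact: mono.
have d1 : is_derive s 1 F (f s) by apply: FE'; lra.
have d2 : is_derive s 1 F 0.
  apply/is_derive_epsP => e e0; exists (Num.min s (L - s)).
    by rewrite lt_min; lra.
  move=> t; rewrite lt_min !ltr_norml => ?; rewrite !cst; try lra.
  by rewrite subrr mulr0 subrr normr0 mulr_ge0// ltW.
by rewrite -(@derive_val _ _ _ _ _ _ _ d1) (@derive_val _ _ _ _ _ _ _ d2).
Qed.

End OneVariable.

(** * Integration on the torus *)

Section NormNeighbourhoods.
Context {R : realType} {V : normedModType R}.

Lemma nbhs_dist_lt (x : V) (r : R) : 0 < r -> nbhs x (fun y => `|x - y| < r).
Proof. by move=> r0; rewrite -nbhs_nbhs_norm; exists r. Qed.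

Lemma nbhs_distP (x : V) (P : set V) : nbhs x P ->
  exists2 r : R, 0 < r & forall y, `|x - y| < r -> P y.
Proof. by rewrite -nbhs_nbhs_norm => -[r r0 H]; exists r. Qed.

End NormNeighbourhoods.

(** * A class of integrands stable under slicing and partial integration *)

Section UniformlyContinuousBounded.
Context {R : realType} {V : normedModType R}.
Implicit Types (f g : V -> R) (c C e M : R) (z v : V).

(** An iterated integral is linear and monotone only if the inner integrals depend continuously on
    the outer variable. Boundedness with uniform continuity passes from a function to its slices and
    to its partial integrals, which lets inductions on the dimension go through; continuous periodic
    functions belong to the class. *)
Definition ucb f : Prop :=
  (exists M : R, forall x, `|f x| <= M) /\
  (forall e : R, 0 < e -> exists2 r : R, 0 < r &
     forall x y, `|x - y| < r -> `|f x - f y| <= e).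

Lemma ucb_cst (c : R) : ucb (fun=> c).
Proof.
split; first by exists `|c|.
by move=> e e0; exists 1 => // x y _; rewrite subrr normr0 ltW.
Qed.

Lemma ucbD f g : ucb f -> ucb g -> ucb (fun x => f x + g x).
Proof.
move=> [[M fM] fu] [[N gN] gu]; split.
  by exists (M + N) => x; rewrite (le_trans (ler_normD _ _))// lerD.
move=> e e0; have e20 : 0 < e / 2 by lra.
have [r r0 fr] := fu _ e20; have [s s0 gs] := gu _ e20.
exists (Num.min r s); first by rewrite lt_min r0.
move=> x y; rewrite lt_min => /andP[/fr + /gs].
by rewrite !ler_norml; lra.
Qed.

Lemma ucbM f g : ucb f -> ucb g -> ucb (fun x => f x * g x).
Proof.
move=> [[M fM] fu] [[N gN] gu].
have M0 : 0 <= M := le_trans (normr_ge0 _) (fM 0).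
have N0 : 0 <= N := le_trans (normr_ge0 _) (gN 0).
split; first by exists (M * N) => x; rewrite normrM ler_pM.
move=> e e0; set K := M + N + 1.
have K0 : 0 < K by rewrite /K; lra.
have eK : 0 < e / K by rewrite divr_gt0.
have [r r0 fr] := fu _ eK; have [s s0 gs] := gu _ eK.
exists (Num.min r s); first by rewrite lt_min r0.
move=> x y; rewrite lt_min => /andP[/fr F /gs G].
have -> : f x * g x - f y * g y = (f x - f y) * g x + f y * (g x - g y) by ring.
apply: (le_trans (ler_normD _ _)); rewrite !normrM.
apply: (@le_trans _ _ (e / K * N + M * (e / K))).
  by apply: lerD; apply: ler_pM.
have -> : e / K * N + M * (e / K) = e * ((M + N) / K) by field; lra.
by rewrite ger_pMr// ler_pdivrMr// /K; lra.
Qed.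

Lemma ucbZ c f : ucb f -> ucb (fun x => c * f x).
Proof. by move=> uf; apply: ucbM => //; exact: ucb_cst. Qed.

Lemma ucbN f : ucb f -> ucb (fun x => - f x).
Proof.
move=> [[M fM] fu]; split; first by exists M => x; rewrite normrN.
move=> e /fu[r r0 fr]; exists r => // x y /fr.
by rewrite -normrN opprB opprK addrC.
Qed.

Lemma ucbB f g : ucb f -> ucb g -> ucb (fun x => f x - g x).
Proof. by move=> uf ug; apply: ucbD => //; exact: ucbN. Qed.

Lemma ucbX f n : ucb f -> ucb (fun x => f x ^+ n).
Proof.
move=> uf; elim: n => [|n IH].
  by under eq_fun do rewrite expr0; exact: ucb_cst.
by under eq_fun do rewrite exprS; exact: ucbM.
Qed.

Lemma ucb_sum (I : Type) (r : seq I) (F : I -> V -> R) :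
  (forall i, ucb (F i)) -> ucb (fun x => \sum_(i <- r) F i x).
Proof.
move=> uF; elim: r => [|i r IH].
  by under eq_fun do rewrite big_nil; exact: ucb_cst.
by under eq_fun do rewrite big_cons; exact: ucbD.
Qed.

Lemma ucb_norm f : ucb f -> ucb (fun x => `|f x|).
Proof.
move=> [[M fM] fu]; split; first by exists M => x; rewrite normr_id.
move=> e /fu[r r0 fr]; exists r => // x y /fr; apply: le_trans.
exact: ler_dist_dist.
Qed.

Lemma ucb_continuous f : ucb f -> continuous f.
Proof.
move=> [_ fu] x; apply/cvgrPdist_le => e /fu[r r0 fr].
by near=> y; apply: fr; near: y; apply/nbhs_normP; exists r.
Unshelve. all: by end_near. Qed.

Lemma eq_ucb f g : f =1 g -> ucb f -> ucb g.
Proof. by move=> /funext ->. Qed.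

End UniformlyContinuousBounded.

Section UcbComp.
Context {R : realType}.

Lemma ucb_comp {V W : normedModType R} (h : W -> V) (C : R) (f : V -> R) :
  (forall x y : W, `|h x - h y| <= C * `|x - y|) -> ucb f -> ucb (fun x => f (h x)).
Proof.
move=> hC [[M fM] fu]; split; first by exists M.
move=> e /fu[r r0 fr]; exists (r / (`|C| + 1)); first by rewrite divr_gt0.
move=> x y xy; apply: fr; apply: (le_lt_trans (hC x y)).
move: xy; rewrite ltr_pdivlMr//; apply: le_lt_trans.
rewrite mulrC ler_wpM2l//; have := ler_norm C; lra.
Qed.

Lemma ucb_shift {V : normedModType R} (f : V -> R) z : ucb f -> ucb (fun x => f (x + z)).
Proof.
apply: (@ucb_comp _ _ (fun x => x + z) 1) => x y.
by rewrite mul1r opprD addrACA subrr addr0.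
Qed.

Lemma ucb_line {V : normedModType R} (f : V -> R) x v : ucb f -> ucb (fun s : R => f (x + s *: v)).
Proof.
apply: (@ucb_comp _ _ (fun s : R => x + s *: v) `|v|) => s t.
by rewrite opprD addrACA subrr add0r -scalerBl normrZ mulrC.
Qed.

End UcbComp.

Section RowVectors.
Context {R : realType}.

Lemma rV_norm_le d (x : 'rV[R]_d) e : 0 <= e -> (forall j, `|x 0 j| <= e) -> `|x| <= e.
Proof.
move=> e0 xe; rewrite [leLHS]/Num.Def.normr/= mx_normrE; apply/bigmax_leP; split => // -[i j] _ /=.
by rewrite (ord1 i).
Qed.

Lemma coord_le_norm d (x : 'rV[R]_d) j : `|x 0 j| <= `|x|.
Proof.
by rewrite [leRHS]/Num.Def.normr /= mx_normrE; apply/bigmax_geP; right => /=; exists (ord0, j).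
Qed.

Lemma row_mx_norm_le n (s : R) (y : 'rV[R]_n) :
  `|row_mx s%:M y : 'rV[R]_(1 + n)| <= Num.max `|s| `|y|.
Proof.
apply: rV_norm_le => [|j]; first by rewrite le_max normr_ge0.
case: (split_ordP j) => k ->; rewrite ?row_mxEl ?row_mxEr le_max.
  by rewrite !ord1 mxE eqxx lexx.
by rewrite coord_le_norm orbT.
Qed.

Lemma row_mx_slice n (s : R) (y : 'rV[R]_n) :
  row_mx s%:M y = row_mx 0 y + s *: delta_mx 0 (lshift n ord0).
Proof.
apply/rowP => j; rewrite !mxE; case: split_ordP => k -> /=.
  by rewrite !ord1 !mxE !eqxx add0r mulr1.
  by rewrite mulr0 addr0.
Qed.

Lemma row_mx_add_delta n (s t : R) (y : 'rV[R]_n) (k : 'I_n) :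
  row_mx s%:M y + t *: delta_mx 0 (rshift 1 k)
  = row_mx s%:M (y + t *: delta_mx 0 k).
Proof.
apply/rowP => j; rewrite !mxE; case: split_ordP => l -> /=.
  by rewrite eq_lrshift/= mulr0 addr0.
by rewrite eq_rshift !mxE.
Qed.

Lemma row_mx_distl n (s t : R) (y : 'rV[R]_n) :
  `|row_mx s%:M y - row_mx t%:M y : 'rV[R]_(1 + n)| <= `|s - t|.
Proof.
rewrite opp_row_mx add_row_mx subrr -raddfB/=.
have := row_mx_norm_le n (s - t) 0; rewrite normr0 => /le_trans; apply.
by rewrite ge_max normr_ge0 lexx.
Qed.

Lemma ucb_slice n (f : 'rV[R]_(1 + n) -> R) s : ucb f ->
  ucb (fun y : 'rV[R]_n => f (row_mx s%:M y)).
Proof.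
apply: (@ucb_comp _ _ _ (fun y : 'rV[R]_n => row_mx s%:M y) 1) => x y.
rewrite mul1r opp_row_mx add_row_mx subrr.
have -> : 0 = 0%:M :> 'M[R]_1 by rewrite raddf0.
have := row_mx_norm_le n 0 (x - y); rewrite normr0 => /le_trans; apply.
by rewrite ge_max normr_ge0 lexx.
Qed.

End RowVectors.

Section TorusIntegral.
Context {R : realType}.

(** The four facts are proved together: in dimension [n], linearity, monotonicity and the value on
    constants show that the inner integral is a uniformly continuous function of the first
    coordinate, and this is what linearity and monotonicity of the outer integral require. *)
Lemma torus_integral_basic n :
  [/\ forall f g : 'rV[R]_n -> R, ucb f -> ucb g ->
        torus_integral (fun x => f x + g x) = torus_integral f + torus_integral g,
      forall (c : R) (f : 'rV[R]_n -> R), ucb f ->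
        torus_integral (fun x => c * f x) = c * torus_integral f,
      forall f g : 'rV[R]_n -> R, ucb f -> ucb g -> (forall x, f x <= g x) ->
        torus_integral f <= torus_integral g &
      forall c : R, torus_integral (fun _ : 'rV[R]_n => c) = c].
Proof.
elim: n => [|n [ID IZ Ile Ic]]; first by split=> // f g _ _ fg; exact: fg.
have sl (f : 'rV[R]_(1 + n) -> R) : ucb f ->
    ucb (fun s : R => torus_integral (fun y : 'rV[R]_n => f (row_mx s%:M y))).
  move=> uf; have [[M fM] fu] := uf.
  have bd (g : 'rV[R]_n -> R) (e : R) : ucb g -> (forall x, `|g x| <= e) ->
      `|torus_integral g| <= e.
    move=> ug ge; rewrite ler_norml; apply/andP; split.
    - rewrite -(Ic (- e)); apply: Ile => //; first exact: ucb_cst.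
      by move=> x; have := ge x; rewrite ler_norml => /andP[].
    - rewrite -(Ic e); apply: Ile => //; first exact: ucb_cst.
      by move=> x; have := ge x; rewrite ler_norml => /andP[].
  split; first by exists M => s; apply: bd => //; exact: ucb_slice.
  move=> e /fu[r r0 fr]; exists r => // s t st.
  have -> : torus_integral (fun y : 'rV[R]_n => f (row_mx s%:M y)) -
            torus_integral (fun y : 'rV[R]_n => f (row_mx t%:M y)) =
      torus_integral (fun y => f (row_mx s%:M y) + - 1 * f (row_mx t%:M y)).
    rewrite ID ?IZ ?mulN1r//; [exact: ucb_slice|exact: ucb_slice|].
    by apply: ucbZ; exact: ucb_slice.
  apply: bd.
    by apply: ucbD; [|apply: ucbZ]; exact: ucb_slice.
  move=> y; rewrite mulN1r; apply: fr.
  exact: le_lt_trans (row_mx_distl _ _ _ _) st.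
have slc f : ucb f -> continuous (fun s : R =>
    torus_integral (fun y : 'rV[R]_n => f (row_mx s%:M y))).
  by move=> uf; apply: ucb_continuous; exact: sl.
split => /=.
- move=> f g uf ug; rewrite -[RHS](intLD 1)//; try exact: slc.
  by apply: eq_intL => s _; rewrite ID//; exact: ucb_slice.
- move=> c f uf; rewrite -[RHS](intLZ 1)//; try exact: slc.
  by apply: eq_intL => s _; rewrite IZ//; exact: ucb_slice.
- move=> f g uf ug fg; apply: (le_intL 1); try exact: slc.
  by move=> s _; apply: Ile => //; exact: ucb_slice.
- move=> c; rewrite -[RHS]mulr1 -(intL_cst 1)//.
  by apply: eq_intL => s _; rewrite Ic.
Qed.

Section Linear.
Context {n : nat}.
Implicit Types f g : 'rV[R]_n -> R.

Lemma torus_integralD f g : ucb f -> ucb g ->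
  torus_integral (fun x => f x + g x) = torus_integral f + torus_integral g.
Proof. by have [+ _ _ _] := torus_integral_basic n; apply. Qed.

Lemma torus_integralZ c f : ucb f ->
  torus_integral (fun x => c * f x) = c * torus_integral f.
Proof. by have [_ + _ _] := torus_integral_basic n; apply. Qed.

Lemma le_torus_integral f g : ucb f -> ucb g -> (forall x, f x <= g x) ->
  torus_integral f <= torus_integral g.
Proof. by have [_ _ + _] := torus_integral_basic n; apply. Qed.

Lemma torus_integral_cst c : torus_integral (fun _ : 'rV[R]_n => c) = c.
Proof. by have [_ _ _ +] := torus_integral_basic n; apply. Qed.

Lemma torus_integralN f : ucb f ->
  torus_integral (fun x => - f x) = - torus_integral f.
Proof.
move=> uf; rewrite -mulN1r -torus_integralZ//; congr torus_integral.
by apply/funext => x; rewrite mulN1r.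
Qed.

Lemma torus_integralB f g : ucb f -> ucb g ->
  torus_integral (fun x => f x - g x) = torus_integral f - torus_integral g.
Proof.
by move=> uf ug; rewrite torus_integralD ?torus_integralN//; exact: ucbN.
Qed.

Lemma torus_integral_norm_le f e : ucb f -> (forall x, `|f x| <= e) ->
  `|torus_integral f| <= e.
Proof.
move=> uf fe; rewrite ler_norml; apply/andP; split.
- rewrite -(torus_integral_cst (- e)); apply: le_torus_integral => //.
    exact: ucb_cst.
  by move=> x; have := fe x; rewrite ler_norml => /andP[].
- rewrite -[leRHS]torus_integral_cst; apply: le_torus_integral => //.
    exact: ucb_cst.
  by move=> x; have := fe x; rewrite ler_norml => /andP[].
Qed.

Lemma torus_integral_sum (I : Type) (r : seq I) (F : I -> 'rV[R]_n -> R) :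
  (forall i, ucb (F i)) ->
  torus_integral (fun x => \sum_(i <- r) F i x)
  = \sum_(i <- r) torus_integral (F i).
Proof.
move=> uF; elim: r => [|i r IH].
  rewrite big_nil -[RHS]torus_integral_cst; congr torus_integral.
  by apply/funext => x; rewrite big_nil.
rewrite big_cons -IH -torus_integralD//; last exact: ucb_sum.
by congr torus_integral; apply/funext => x; rewrite big_cons.
Qed.

End Linear.

Lemma ucb_torus_integral_slice n (f : 'rV[R]_(1 + n) -> R) : ucb f ->
  ucb (fun s : R => torus_integral (fun y : 'rV[R]_n => f (row_mx s%:M y))).
Proof.
move=> uf; have [[M fM] fu] := uf; split.
  by exists M => s; apply: torus_integral_norm_le => //; exact: ucb_slice.
move=> e /fu[r r0 fr]; exists r => // s t st.
rewrite -torus_integralB; try exact: ucb_slice.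
apply: torus_integral_norm_le; first by apply: ucbB; exact: ucb_slice.
by move=> y; apply: fr; exact: le_lt_trans (row_mx_distl _ _ _ _) st.
Qed.

(** Induction on the dimension: the partial integral over the last coordinates is nonnegative with
    nonpositive integral, so [intL_eq0] kills it on the open interval. The faces of the cube are
    reached later, by continuity. *)
Lemma torus_integral_le0_eq0 n (f : 'rV[R]_n -> R) : ucb f ->
  (forall x, 0 <= f x) -> torus_integral f <= 0 ->
  forall x : 'rV[R]_n, (forall j, 0 < x 0 j < 1) -> f x = 0.
Proof.
elim: n f => [|n IH] f uf f0 I0 x x01.
  by apply/eqP; rewrite eq_le f0 andbT (le_trans _ I0)//= (thinmx0 x).
pose xr : 'rV[R]_(1 + n) := x.
have E : lsubmx xr = (x 0 ord0)%:M.
  apply/rowP => i; rewrite !ord1 !mxE eqxx mulr1n; congr (x _ _); exact: val_inj.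
have -> : x = row_mx (x 0 ord0)%:M (rsubmx xr) by rewrite -E hsubmxK.
apply: (IH (fun y => f (row_mx (x 0 ord0)%:M y))) => //.
- exact: ucb_slice.
- have -> // := intL_eq0 1 _ ler01 (ucb_continuous _ (ucb_torus_integral_slice _ _ uf))
    _ I0 (x 0 ord0) (x01 ord0).
  move=> s _; rewrite -(@torus_integral_cst n 0); apply: le_torus_integral => //.
    exact: ucb_cst.
  exact: ucb_slice.
- by move=> j; rewrite mxE; exact: x01.
Qed.

End TorusIntegral.

(** * Derivatives in time that are uniform in space *)

Section UniformDerivative.
Context {R : realType}.

(** Differentiability at [t] of a curve in the functions on [X] with the supremum distance.
    Uniformity over [X] is what allows differentiation under an integral. *)
Definition udiff {X : Type} (f : R -> X -> R) (t : R) (g : X -> R) : Prop :=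
  forall e : R, 0 < e -> exists2 r : R, 0 < r & forall s : R, `|s - t| < r ->
    forall x, `|f s x - f t x - (s - t) * g x| <= e * `|s - t|.

Lemma is_derive_udiff {X : Type} (f g : R -> X -> R) (t r : R) : 0 < r ->
  (forall s x, `|s - t| < r -> is_derive s 1 (f ^~ x) (g s x)) ->
  (forall e : R, 0 < e -> exists2 r : R, 0 < r & forall s : R, `|s - t| < r ->
    forall x, `|g s x - g t x| <= e) ->
  udiff f t (g t).
Proof.
move=> r0 fg gc e e0; have [r1 r10 ge] := gc e e0.
exists (Num.min r r1); first by rewrite lt_min r0.
move=> s; rewrite lt_min => /andP[sr s1] x.
have near_t y : Num.min s t <= y <= Num.max s t -> `|y - t| <= `|s - t|.
  rewrite minEle maxEle; have [st|/ltW ts] := lerP s t => yst.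
    by rewrite distrC ger0_norm; lra.
  by rewrite ger0_norm; lra.
apply: (mean_value_bound (f ^~ x) (g ^~ x)) => y /near_t yt.
- by apply: fg; exact: le_lt_trans yt sr.
- by apply: ge; exact: le_lt_trans yt s1.
Qed.

Lemma udiffM {X : Type} (f1 f2 : R -> X -> R) (t M : R) (g1 g2 : X -> R) :
  (forall x, `|f1 t x| <= M) -> (forall x, `|f2 t x| <= M) ->
  (forall x, `|g1 x| <= M) -> (forall x, `|g2 x| <= M) ->
  udiff f1 t g1 -> udiff f2 t g2 ->
  udiff (fun s x => f1 s x * f2 s x) t (fun x => f1 t x * g2 x + g1 x * f2 t x).
Proof.
move=> f1M f2M g1M g2M d1 d2 e e0.
(* With remainders [p] and [q] of size [a |k|], the error of the product is at most
   [(2 M a + (M + 1)^2 |k|) |k|]. Taking [a] and [|k|] below [e / (2 K)] brings it under [e |k|];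
   the 1 in [K] keeps [K] positive. *)
pose K := 2 * M + 1 + (M + 1) ^+ 2.
(* A negative bound on an absolute value leaves [X] without points. *)
have [M0|M0] := leP 0 M; last first.
  by exists 1 => // s _ x; have := le_trans (normr_ge0 _) (f1M x); lra.
have K0 : 0 < K by rewrite /K; nra.
have eK : 0 < Num.min 1 (e / (2 * K)).
  by rewrite lt_min ltr01 divr_gt0// mulr_gt0.
have [r1 r10 H1] := d1 _ eK; have [r2 r20 H2] := d2 _ eK.
exists (Num.min (Num.min r1 r2) (Num.min 1 (e / (2 * K)))).
  by rewrite !lt_min r10 r20 ltr01 divr_gt0// mulr_gt0.
move=> s; rewrite !lt_min => /andP[/andP[s1 s2] /andP[s11 se]] x.
have {H1}h1 := H1 s s1 x; have {H2}h2 := H2 s s2 x.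
set a := Num.min _ _ in eK h1 h2.
have a1 : a <= 1 by rewrite ge_min lexx.
have ae : a <= e / (2 * K) by rewrite ge_min lexx orbT.
set k := s - t in s1 s2 s11 se h1 h2 *.
set p := f1 s x - f1 t x - k * g1 x in h1.
set q := f2 s x - f2 t x - k * g2 x in h2.
have -> : f1 s x * f2 s x - f1 t x * f2 t x -
    k * (f1 t x * g2 x + g1 x * f2 t x) =
    f1 t x * q + p * f2 t x + (k * g1 x + p) * (k * g2 x + q).
  by rewrite /p /q; ring.
have k0 := normr_ge0 k.
have le1 : `|f1 t x * q| <= M * (a * `|k|) by rewrite normrM ler_pM.
have le2 : `|p * f2 t x| <= (a * `|k|) * M by rewrite normrM ler_pM.
have le3 : `|k * g1 x + p| <= `|k| * (M + 1).
  rewrite (le_trans (ler_normD _ _))// normrM mulrDr lerD//.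
    by rewrite ler_wpM2l.
  by rewrite (le_trans h1)// mulrC ler_wpM2l.
have le4 : `|k * g2 x + q| <= `|k| * (M + 1).
  rewrite (le_trans (ler_normD _ _))// normrM mulrDr lerD//.
    by rewrite ler_wpM2l.
  by rewrite (le_trans h2)// mulrC ler_wpM2l.
have le5 : `|(k * g1 x + p) * (k * g2 x + q)| <=
    (`|k| * (M + 1)) * (`|k| * (M + 1)) by rewrite normrM ler_pM.
apply: (le_trans (ler_normD _ _)); apply: (le_trans (lerD (ler_normD _ _) (lexx _))).
apply: (le_trans (lerD (lerD le1 le2) le5)).
set b := e / (2 * K) in ae se.
have -> : e = 2 * K * b by rewrite /b; field; apply: lt0r_neq0.
have b0 : 0 <= b by exact: le_trans (ltW eK) ae.
have -> : M * (a * `|k|) + a * `|k| * M + `|k| * (M + 1) * (`|k| * (M + 1)) =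
  (2 * M * a + (M + 1) ^+ 2 * `|k|) * `|k| by ring.
apply: ler_wpM2r => //.
apply: (@le_trans _ _ (2 * M * b + (M + 1) ^+ 2 * b)).
  apply: lerD; first by rewrite ler_wpM2l// mulr_ge0.
  by rewrite ler_wpM2l ?sqr_ge0 ?ltW.
by rewrite -mulrDl ler_wpM2r// /K; nra.
Qed.

Lemma udiff_sum {X I : Type} (r : seq I) (f : I -> R -> X -> R) t (g : I -> X -> R) :
  (forall i, udiff (f i) t (g i)) ->
  udiff (fun s x => \sum_(i <- r) f i s x) t (fun x => \sum_(i <- r) g i x).
Proof.
move=> fg; elim: r => [|i r IH] e e0.
  by exists 1 => // s _ x; rewrite !big_nil mulr0 !subr0 normr0 mulr_ge0// ltW.
have e20 : 0 < e / 2 by lra.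
have [r1 r10 H1] := fg i _ e20; have [r2 r20 H2] := IH _ e20.
exists (Num.min r1 r2); first by rewrite lt_min r10.
move=> s; rewrite lt_min => /andP[/H1 h1 /H2 h2] x; rewrite !big_cons.
have {}h1 := h1 x; have {}h2 := h2 x.
rewrite mulrDr (_ : _ - _ = (f i s x - f i t x - (s - t) * g i x) +
  (\sum_(j <- r) f j s x - \sum_(j <- r) f j t x -
     (s - t) * \sum_(j <- r) g j x)); last by ring.
by apply: (le_trans (ler_normD _ _)); lra.
Qed.

Lemma is_derive_torus_integral n (f : R -> 'rV[R]_n -> R) t (g : 'rV[R]_n -> R) :
  (forall s, ucb (f s)) -> ucb g -> udiff f t g ->
  is_derive t 1 (fun s => torus_integral (f s)) (torus_integral g).
Proof.
move=> uf ug fg; apply/is_derive_epsP => e /fg[r r0 fr]; exists r => // s /fr sr.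
rewrite -torus_integralB// -torus_integralZ// -torus_integralB//; last 2 first.
- exact: ucbB.
- exact: ucbZ.
apply: torus_integral_norm_le => //.
by apply: ucbB; [exact: ucbB|exact: ucbZ].
Qed.

Lemma intL_norm_le L (f : R -> R) e : 0 <= L -> continuous f ->
  (forall s, 0 <= s <= L -> `|f s| <= e) -> `|intL L f| <= e * L.
Proof.
move=> L0 cf fe; rewrite ler_norml -mulNr -!intL_cst//.
have cc (c : R) : continuous (fun _ : R => c) by move=> x; exact: cvg_cst.
by apply/andP; split; apply: le_intL => // s /fe; rewrite ler_norml => /andP[].
Qed.

Lemma intLB L (f g : R -> R) : continuous f -> continuous g ->
  intL L (fun s => f s - g s) = intL L f - intL L g.
Proof.
move=> cf cg; rewrite -mulN1r -intLZ// -intLD//.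
  by apply: eq_intL => s _; rewrite mulN1r.
by move=> x; apply: cvgM; [exact: cvg_cst|exact: cg].
Qed.

Lemma is_derive_line {V : normedModType R} (f : V -> R) x v s :
  derivable f (x + s *: v) v ->
  is_derive s 1 (fun t : R => f (x + t *: v)) ('D_v f (x + s *: v)).
Proof.
have E : (fun h : R => h^-1 *: ((f \o shift (x + s *: v)) (h *: v) - f (x + s *: v)))
  = (fun h : R => h^-1 *: (((fun t : R => f (x + t *: v)) \o shift s) (h *: 1) -
      f (x + s *: v))).
  apply/funext => h /=; congr (_ *: (f _ - _)).
  by rewrite [h *: 1]mulr1 scalerDl addrCA addrA.
move=> fd; split; first by rewrite /derivable -E.
by rewrite /derive -E.
Qed.

Lemma is_derive_translate {V : normedModType R} (f : V -> R) (x z v : V) (a : R) :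
  is_derive (x + z) v f a -> is_derive x v (fun y => f (y + z)) a.
Proof.
have E : (fun h : R => h^-1 *: ((f \o shift (x + z)) (h *: v) - f (x + z))) =
  (fun h : R => h^-1 *: (((fun y => f (y + z)) \o shift x) (h *: v) - f (x + z))).
  by apply/funext => h /=; rewrite addrA.
by move=> [fd fa]; split; [rewrite /derivable -E|rewrite /derive -E].
Qed.

Lemma derive_translate {V : normedModType R} (f : V -> R) (x z v : V) :
  'D_v (fun y => f (y + z)) x = 'D_v f (x + z).
Proof.
have E : (fun h : R => h^-1 *: ((f \o shift (x + z)) (h *: v) - f (x + z))) =
  (fun h : R => h^-1 *: (((fun y => f (y + z)) \o shift x) (h *: v) - f (x + z))).
  by apply/funext => h /=; rewrite addrA.
by rewrite /derive E.
Qed.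

End UniformDerivative.

(** * Periodic functions and compactness *)

Section Periodic.
Context {R : realType} {d : nat}.
Implicit Types (f g : 'rV[R]_d -> R) (x y z : 'rV[R]_d) (j : 'I_d).

Definition per f : Prop := forall j x, f (x + delta_mx 0 j) = f x.

Lemma per_comp2 (op : R -> R -> R) f g : per f -> per g ->
  per (fun x => op (f x) (g x)).
Proof. by move=> pf pg j x; rewrite pf pg. Qed.

Lemma per_shift f z : per f -> per (fun x => f (x + z)).
Proof. by move=> pf j x; rewrite addrAC pf. Qed.

Lemma per_int f : per f -> forall (z : 'I_d -> int) x,
  f (x + \row_j (z j)%:~R) = f x.
Proof.
move=> pf z x.
have perZ j (n : int) y : f (y + n%:~R *: delta_mx 0 j) = f y.
  have perN (m : nat) w : f (w + m%:R *: delta_mx 0 j) = f w.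
    elim: m w => [|m IH] w; first by rewrite scale0r addr0.
    by rewrite -natr1 scalerDl scale1r addrA pf IH.
  case: n => m; first exact: perN.
  by rewrite NegzE mulrNz scaleNr -(perN m.+1 (y - _)) subrK.
rewrite (row_sum_delta (\row_j _)).
elim/big_rec : _ => [|j w _ IH]; first by rewrite addr0.
by rewrite mxE addrCA [X in f X]addrC perZ.
Qed.

Lemma per_reduce f : per f -> forall x, exists2 y : 'rV[R]_d,
  (forall j, 0 <= y 0 j < 1) & f x = f y.
Proof.
move=> pf x; exists (x + \row_j (- Num.floor (x 0 j))%:~R); last by rewrite per_int.
move=> j; rewrite !mxE mulrNz; have := floor_itv (x 0 j).
by rewrite intrD1; lra.
Qed.

Lemma box_compact (a b : R) :
  compact [set x : 'rV[R]_d | forall i, `[a, b]%classic (x ord0 i)].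
Proof. by apply: (@rV_compact _ _ (fun=> `[a, b]%classic)) => _; exact: segment_compact. Qed.

(** Two close points need not reduce to close points of the cube, since they may lie on different
    sides of a face. So compactness is applied to [|f (x + h) - f x| <= e] with [x] in the cube and
    [h] small but otherwise free; periodicity then moves [x] alone. *)
Lemma per_ucb f : continuous f -> per f -> ucb f.
Proof.
move=> cf pf; pose K := [set x : 'rV[R]_d | forall i, `[0, 1]%classic (x ord0 i)].
have cK : compact K by exact: box_compact.
have inK (y : 'rV[R]_d) : (forall j, 0 <= y 0 j < 1) -> K y.
  by move=> y01 i /=; rewrite in_itv/=; have := y01 i; lra.
split.
- have [|||c _ cmax] := @compact_EVT_max _ R (fun x => `|f x|) K.
  + by exists 0 => i /=; rewrite in_itv/= mxE lexx ler01.
  + exact: cK.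
  + apply: continuous_subspaceT => x; apply: cvg_comp (cf x) _.
    exact: norm_continuous.
  + exists `|f c| => x; have [y y01 ->] := per_reduce f pf x.
    by apply: cmax; rewrite inE; exact: inK.
- move=> e e0.
  have /compact_near_coveringP/(_ _ (nbhs (0 : 'rV[R]_d))
      (fun h x => `|f (x + h) - f x| <= e) _) := cK.
  have P x : K x -> \forall x' \near x & h \near (0 : 'rV[R]_d),
      `|f (x' + h) - f x'| <= e.
    move=> _; have e20 : 0 < e / 2 by lra.
    have /cvgrPdist_le /(_ _ e20) /nbhs_distP[r r0 fr] := cf x.
    have r20 : 0 < r / 2 by lra.
    exists ([set y : 'rV[R]_d | `|x - y| < r / 2], [set y : 'rV[R]_d | `|0 - y| < r / 2]).
      by split; exact: nbhs_dist_lt.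
    move=> [x' h] /= [xx']; rewrite sub0r normrN => hr.
    have H1 : `|f x - f (x' + h)| <= e / 2.
      apply: fr => /=; rewrite opprD addrA (splitr r).
      by rewrite (le_lt_trans (ler_normB _ _))// ltrD.
    have H2 : `|f x - f x'| <= e / 2 by apply: fr => /=; lra.
    by move: H1 H2; rewrite !ler_norml; lra.
  move=> /(_ P) /nbhs_distP[r r0 Hr]; exists r => // x y xy.
  have pg : per (fun w => `|f (w + (x - y)) - f w|).
    by move=> j w; rewrite pf addrAC pf.
  have [w w01 E] := per_reduce _ pg y.
  have -> : f x - f y = f (y + (x - y)) - f y by rewrite (addrC y) subrK.
  rewrite E; apply: (Hr (x - y)); last exact: inK.
  by rewrite sub0r normrN.
Qed.

Lemma per_ge0_torus_integral_le0 f : ucb f -> per f -> (forall x, 0 <= f x) ->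
  torus_integral f <= 0 -> forall x, f x = 0.
Proof.
move=> uf pf f0 I0 x; have [y y01 ->] := per_reduce _ pf x.
apply/eqP; rewrite eq_le f0 andbT leNgt; apply/negP => fy.
have fy2 : 0 < f y / 2 by lra.
have [r r0 fr] := uf.2 _ fy2.
pose c := Num.min r 1 / 2.
have c0 : 0 < c by rewrite divr_gt0// lt_min r0 ltr01.
have mr : Num.min r 1 <= r by rewrite ge_min lexx.
have m1 : Num.min r 1 <= 1 by rewrite ge_min lexx orbT.
have cr : c < r by rewrite /c in c0 *; lra.
have c1 : c < 1 by rewrite /c in c0 *; lra.
(* The vanishing coordinates are pushed to [c], which moves [y] into the open cube by less than the
   modulus [r]. *)
pose w : 'rV[R]_d := \row_j (if y 0 j == 0 then c else y 0 j).
have fw : f w = 0.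
  apply: torus_integral_le0_eq0 => // j; rewrite mxE.
  have := y01 j; case: eqP => [_ _|/eqP yj /andP[yj0 ->]]; first by rewrite c0.
  by rewrite andbT lt_neqAle eq_sym yj.
have : `|f y - f w| <= f y / 2.
  apply: fr; apply: le_lt_trans cr; apply: rV_norm_le; first exact: ltW.
  move=> j; rewrite !mxE; case: eqP => [->|_]; last by rewrite subrr normr0 ltW.
  by rewrite sub0r normrN ger0_norm// ltW.
by rewrite fw subr0 ger0_norm ?f0//; lra.
Qed.

End Periodic.

Section IntegrationByParts.
Context {R : realType}.

(** Induction on the dimension. A derivative in a later coordinate commutes with slicing. A
    derivative in the first coordinate is the derivative of the partial integral, to which the
    fundamental theorem and periodicity apply. *)
Lemma torus_integral_partial d (f : 'rV[R]_d -> R) (j : 'I_d) : per f ->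
  (forall x, derivable f x (delta_mx 0 j)) -> ucb f -> ucb (partial j f) ->
  torus_integral (partial j f) = 0.
Proof.
elim: d f j => [|n IH] f j; first by case: j.
change 'I_n.+1 with 'I_(1 + n) in j.
change ('rV[R]_(1 + n) -> R) in f.
move=> pf fd uf ufj.
case: (split_ordP j) => k jE; rewrite {}jE {j} in fd ufj *; last first.
  rewrite -[RHS](mul0r 1) -(intL_cst 1)//; apply: eq_intL => s _.
  have E (y : 'rV[R]_n) :
    (fun h : R => h^-1 *: (((fun y => f (row_mx s%:M y)) \o shift y) (h *: delta_mx 0 k) -
      f (row_mx s%:M y))) =
    (fun h : R => h^-1 *: ((f \o shift (row_mx s%:M y)) (h *: delta_mx 0 (rshift 1 k)) -
      f (row_mx s%:M y))).
    by apply/funext => h /=; rewrite (addrC _ y) (addrC _ (row_mx _ _)) row_mx_add_delta.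
  have EE : partial k (fun y => f (row_mx s%:M y)) =
      (fun y => partial (rshift 1 k) f (row_mx s%:M y)).
    by apply/funext => y; rewrite /partial /derive E.
  rewrite -EE; apply: IH.
  - move=> i x; rewrite -[RHS](pf (rshift 1 i)).
    by rewrite -[delta_mx 0 (rshift 1 i)]scale1r row_mx_add_delta scale1r.
  - by move=> x; rewrite /derivable E; exact: fd.
  - exact: ucb_slice.
  - by rewrite EE; exact: (ucb_slice _ (partial (rshift 1 k) f)).
rewrite (ord1 k) in fd ufj * => {k}.
pose F (s : R) := torus_integral (fun y : 'rV[R]_n => f (row_mx s%:M y)).
have dF (s : R) : is_derive s 1 F (torus_integral (fun y : 'rV[R]_n =>
    partial (lshift n ord0) f (row_mx s%:M y))).
  apply: is_derive_torus_integral => [t||]; [exact: ucb_slice|exact: ucb_slice|].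
  apply: (@is_derive_udiff _ _ (fun t (y : 'rV[R]_n) => f (row_mx t%:M y))
    (fun s y => partial (lshift n ord0) f (row_mx s%:M y)) s 1) => //.
  - move=> t y _; rewrite (row_mx_slice n t).
    have -> : (fun t0 : R => f (row_mx t0%:M y)) =
      (fun t0 : R => f (row_mx 0 y + t0 *: delta_mx 0 (lshift n ord0))).
      by apply/funext => t0; rewrite row_mx_slice.
    by apply: is_derive_line; exact: fd.
  - move=> e /ufj.2[r r0 Hr]; exists r => // t ts y; apply: Hr.
    exact: le_lt_trans (row_mx_distl _ _ _ _) ts.
rewrite [LHS](@intL_FTC _ 1 _ F)//.
- apply/eqP; rewrite subr_eq0; apply/eqP; rewrite /F; congr torus_integral.
  apply/funext => y; rewrite -[RHS](pf (lshift n (ord0 : 'I_1))) row_mx_slice.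
  by rewrite [in RHS]row_mx_slice scale0r addr0 scale1r.
- by apply: ucb_continuous; exact: (ucb_torus_integral_slice _ (partial (lshift n ord0) f)).
Qed.

Lemma torus_integral_by_parts d (f g : 'rV[R]_d -> R) (j : 'I_d) : per f -> per g ->
  (forall x, derivable f x (delta_mx 0 j)) ->
  (forall x, derivable g x (delta_mx 0 j)) ->
  ucb f -> ucb g -> ucb (partial j f) -> ucb (partial j g) ->
  torus_integral (fun x => f x * partial j g x) =
  - torus_integral (fun x => partial j f x * g x).
Proof.
move=> pf pg fd gd uf ug ufj ugj.
have E : partial j (fun x => f x * g x) =
    (fun x => f x * partial j g x + partial j f x * g x).
  apply/funext => x; rewrite /partial deriveM//.
  by rewrite [g x *: _]mulrC.
have u1 : ucb (fun x => f x * partial j g x) by exact: ucbM.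
have u2 : ucb (fun x => partial j f x * g x) by exact: ucbM.
have : torus_integral (partial j (fun x => f x * g x)) = 0.
  apply: torus_integral_partial.
  - exact: (per_comp2 *%R).
  - by move=> x; apply: derivableM.
  - exact: ucbM.
  - by rewrite E; exact: ucbD.
rewrite E torus_integralD// => /eqP.
by rewrite addr_eq0 => /eqP.
Qed.

End IntegrationByParts.

(** * Fourier series and the Sobolev embedding *)

Section Trigonometric.
Context {R : realType}.

Lemma cos_dist_le (a b : R) : `|cos a - cos b| <= `|a - b|.
Proof.
have := @mean_value_bound R cos (fun x => - sin x) a b 0 1.
rewrite mulr0 subr0 mul1r; apply=> x _.
by rewrite subr0 normrN ler_norml sin_geN1 sin_le1.
Qed.

Lemma sin_dist_le (a b : R) : `|sin a - sin b| <= `|a - b|.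
Proof.
have := @mean_value_bound R sin cos a b 0 1.
rewrite mulr0 subr0 mul1r; apply=> x _.
by rewrite subr0 ler_norml cos_geN1 cos_le1.
Qed.

Lemma ucb_cos : ucb (@cos R).
Proof.
split; first by exists 1 => x; rewrite ler_norml cos_geN1 cos_le1.
move=> e e0; exists e => // x y /ltW; exact: le_trans (cos_dist_le x y).
Qed.

Lemma ucb_sin : ucb (@sin R).
Proof.
split; first by exists 1 => x; rewrite ler_norml sin_geN1 sin_le1.
move=> e e0; exists e => // x y /ltW; exact: le_trans (sin_dist_le x y).
Qed.

Lemma ucb_mulr_comp (f : R -> R) c : ucb f -> ucb (fun s : R => f (c * s)).
Proof.
apply: (@ucb_comp _ _ _ ( *%R c) `|c|) => x y.
by rewrite -mulrBr normrM.
Qed.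

(** Modulo 1, [x] stays at distance at least [y] from 0, where the cosine peaks. Evenness and the
    symmetry [x -> 1 - x] reduce this to monotonicity on [[0, 1/2]]. *)
Lemma cos_le_cos2piN (x y : R) : 0 <= y -> y <= `|x| <= 1 - y ->
  cos (2 * pi * x) <= cos (2 * pi * y).
Proof.
move=> y0 /andP[yx xy].
have p0 := @pi_gt0 R.
have -> : cos (2 * pi * x) = cos (2 * pi * `|x|).
  by case: (ger0P x) => // _; rewrite mulrN cosN.
have dec (a b : R) : 0 <= a -> a <= b -> b <= 2^-1 ->
    cos (2 * pi * b) <= cos (2 * pi * a).
  move=> a0; rewrite le_eqVlt => /predU1P[->//|ab] b2.
  by rewrite ltW// ltr_cos ?ltr_pM2l ?mulr_gt0// in_itv/=; nra.
have [x2|/ltW x2] := leP `|x| (2^-1); first exact: dec.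
have -> : cos (2 * pi * `|x|) = cos (2 * pi * (1 - `|x|)).
  rewrite -[RHS]cosN -[RHS]cosD2pi; congr cos; ring.
by apply: dec => //; lra.
Qed.

Lemma bernoulli_le (x : R) n : -1 <= x -> 1 + n%:R * x <= (1 + x) ^+ n.
Proof.
move=> x1; elim: n => [|n IH]; first by rewrite mul0r addr0 expr0.
rewrite exprS; apply: (@le_trans _ _ ((1 + x) * (1 + n%:R * x))).
  rewrite -natr1; have := mulr_ge0 (ler0n R n) (sqr_ge0 x); nra.
by rewrite ler_wpM2l//; lra.
Qed.

End Trigonometric.

(** * A continuous periodic function with zero Fourier coefficients vanishes *)

Section FourierUniqueness.
Context {R : realType}.

Let c_ (n : int) (s : R) : R := cos (2 * pi * (n%:~R * s)).
Let s_ (n : int) (s : R) : R := sin (2 * pi * (n%:~R * s)).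

Let ucb_c n : ucb (c_ n).
Proof.
rewrite /c_; under eq_fun do rewrite mulrA.
by apply: (ucb_mulr_comp cos); exact: ucb_cos.
Qed.

Let ucb_s n : ucb (s_ n).
Proof.
rewrite /s_; under eq_fun do rewrite mulrA.
by apply: (ucb_mulr_comp sin); exact: ucb_sin.
Qed.

(** Vanishing of all Fourier coefficients. By the addition formulas this survives multiplication by
    [c_ 1] and [s_ 1], hence by any polynomial in them, and coefficient 0 then says that such a
    product has integral zero. *)
Let trigM (w : R -> R) : Prop := ucb w /\ forall n,
  intL 1 (fun s => w s * c_ n s) = 0 /\ intL 1 (fun s => w s * s_ n s) = 0.

Let trigM_lin w1 w2 (a b : R) : trigM w1 -> trigM w2 ->
  trigM (fun s => a * w1 s + b * w2 s).
Proof.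
move=> [u1 H1] [u2 H2]; split; first by apply: ucbD; exact: ucbZ.
have H (g : R -> R) : ucb g -> intL 1 (fun s => w1 s * g s) = 0 ->
    intL 1 (fun s => w2 s * g s) = 0 ->
    intL 1 (fun s => (a * w1 s + b * w2 s) * g s) = 0.
  move=> ug E1 E2.
  have c1 : continuous (fun s => w1 s * g s) by apply: ucb_continuous; exact: ucbM.
  have c2 : continuous (fun s => w2 s * g s) by apply: ucb_continuous; exact: ucbM.
  transitivity (intL 1 (fun s => a * (w1 s * g s) + b * (w2 s * g s))).
    by apply: eq_intL => s _; ring.
  rewrite intLD ?intLZ ?E1 ?E2 ?mulr0 ?addr0//.
    by apply: ucb_continuous; apply: ucbZ; exact: ucbM.
  by apply: ucb_continuous; apply: ucbZ; exact: ucbM.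
by move=> n; have [? ?] := H1 n; have [? ?] := H2 n; split; exact: H.
Qed.

Let trigM_zero_comb w (g : R -> R) n1 n2 (a b : R) (k : int -> R -> R) :
  ucb w -> (forall n, ucb (k n)) ->
  (forall n, intL 1 (fun s => w s * k n s) = 0) ->
  (forall s, g s = a * k n1 s + b * k n2 s) ->
  intL 1 (fun s => w s * g s) = 0.
Proof.
move=> uw uk kw gE.
transitivity (intL 1 (fun s => a * (w s * k n1 s) + b * (w s * k n2 s))).
  by apply: eq_intL => s _; rewrite gE; ring.
have cc n : continuous (fun s => w s * k n s) by apply: ucb_continuous; exact: ucbM.
rewrite intLD ?intLZ ?kw ?mulr0 ?addr0//.
  by apply: ucb_continuous; apply: ucbZ; exact: ucbM.
by apply: ucb_continuous; apply: ucbZ; exact: ucbM.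
Qed.

Let addn1E (n : int) (s : R) :
  2 * pi * ((n + 1)%:~R * s) = 2 * pi * (n%:~R * s) + 2 * pi * (1%:~R * s).
Proof. by rewrite intrD; ring. Qed.

Let subn1E (n : int) (s : R) :
  2 * pi * ((n - 1)%:~R * s) = 2 * pi * (n%:~R * s) - 2 * pi * (1%:~R * s).
Proof. by rewrite intrB; ring. Qed.

Let trigM_cos w : trigM w -> trigM (fun s => w s * c_ 1 s).
Proof.
move=> [uw H]; split; first exact: ucbM.
move=> n; split; under eq_fun do rewrite -mulrA.
- apply: (@trigM_zero_comb w _ (n + 1) (n - 1) (2^-1) (2^-1) c_) => //.
    by move=> m; have [] := H m.
  by move=> s; rewrite /c_ addn1E subn1E cosD cosB; lra.
- apply: (@trigM_zero_comb w _ (n + 1) (n - 1) (2^-1) (2^-1) s_) => //.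
    by move=> m; have [] := H m.
  by move=> s; rewrite /c_ /s_ addn1E subn1E sinD sinB; lra.
Qed.

Let trigM_sin w : trigM w -> trigM (fun s => w s * s_ 1 s).
Proof.
move=> [uw H]; split; first exact: ucbM.
move=> n; split; under eq_fun do rewrite -mulrA.
- apply: (@trigM_zero_comb w _ (n + 1) (n - 1) (2^-1) (- 2^-1) s_) => //.
    by move=> m; have [] := H m.
  by move=> s; rewrite /c_ /s_ addn1E subn1E sinD sinB; lra.
- apply: (@trigM_zero_comb w _ (n + 1) (n - 1) (- 2^-1) (2^-1) c_) => //.
    by move=> m; have [] := H m.
  by move=> s; rewrite /c_ /s_ addn1E subn1E cosD cosB; lra.
Qed.

(* The trigonometric polynomials p^N, with p = 1 + cos 2pi(s - s0) - cos 2pi r,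
   concentrate around s0, where h > 0. *)
Let fourier_le0 (h : R -> R) : trigM h -> forall s0, 0 < s0 < 1 -> h s0 <= 0.
Proof.
move=> th s0 s01; have [uh _] := th; rewrite leNgt; apply/negP => h0.
have h02 : 0 < h s0 / 2 by lra.
have [r1 r10 Hr1] := uh.2 _ h02.
(* The window of radius [r] around [s0] lies inside []0, 1[] and inside the range where [h] is at
   least [h s0 / 2]. *)
pose r := Num.min (Num.min s0 (1 - s0)) (r1 / 2) / 2.
have rb : [/\ 0 < r, r < s0, r < 1 - s0 & r < r1].
  have m0 : 0 < Num.min (Num.min s0 (1 - s0)) (r1 / 2) by rewrite !lt_min; lra.
  have m1 : Num.min (Num.min s0 (1 - s0)) (r1 / 2) <= r1 / 2.
    by rewrite ge_min lexx orbT.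
  have m2 : Num.min (Num.min s0 (1 - s0)) (r1 / 2) <= s0.
    by rewrite !ge_min lexx.
  have m3 : Num.min (Num.min s0 (1 - s0)) (r1 / 2) <= 1 - s0.
    by rewrite !ge_min lexx orbT.
  by rewrite /r; split; lra.
have [r0 rs0 rs1 rr1] := rb.
pose q (s : R) := cos (2 * pi * (s - s0)) - cos (2 * pi * r).
have qE s : q s = cos (2 * pi * s0) * c_ 1 s + sin (2 * pi * s0) * s_ 1 s
    - cos (2 * pi * r).
  by rewrite /q mulrBr cosB /c_ /s_ mul1r mulrC [sin _ * _]mulrC.
have uq : ucb q.
  apply: (@eq_ucb _ _ (fun s => cos (2 * pi * s0) * c_ 1 s +
    sin (2 * pi * s0) * s_ 1 s - cos (2 * pi * r))) => [s|]; first by rewrite qE.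
  by apply: ucbB; [apply: ucbD; exact: ucbZ|exact: ucb_cst].
have tN N : trigM (fun s => h s * (1 + q s) ^+ N).
  elim: N => [|N IH]; first by under eq_fun do rewrite expr0 mulr1.
  have -> : (fun s => h s * (1 + q s) ^+ N.+1) =
    (fun s => 1 * (cos (2 * pi * s0) * (h s * (1 + q s) ^+ N * c_ 1 s) +
      sin (2 * pi * s0) * (h s * (1 + q s) ^+ N * s_ 1 s)) +
      (1 - cos (2 * pi * r)) * (h s * (1 + q s) ^+ N)).
    by apply/funext => s; rewrite exprS {1}qE; ring.
  apply: trigM_lin => //; apply: trigM_lin; [exact: trigM_cos|exact: trigM_sin].
have z N : intL 1 (fun s => h s * (1 + q s) ^+ N) = 0.
  have [_ /(_ 0)[+ _]] := tN N; rewrite /c_.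
  by under eq_fun do rewrite mul0r mulr0 cos0 mulr1.
have [M hM] := uh.1.
have M0 : 0 <= M := le_trans (normr_ge0 _) (hM 0).
(* [chi] is the positive part of [q]. Where [q > 0], the point is within [r] of [s0] and Bernoulli's
   inequality makes the integrand grow linearly in [N]; elsewhere [|1 + q| <= 1] keeps it above
   [- M]. As the integrals are zero for every [N], the integral of [chi] cannot be positive,
   although [chi s0 > 0]. *)
pose chi (s : R) := (q s + `|q s|) / 2.
have cchi : ucb chi.
  apply: (@eq_ucb _ _ (fun s => 2^-1 * (q s + `|q s|))).
    by move=> s; rewrite mulrC.
  by apply: ucbZ; apply: ucbD => //; exact: ucb_norm.
have chi0 s : 0 <= chi s.
  by rewrite /chi; have := ler_norm (- q s); rewrite normrN; lra.
have lb N s : 0 <= s <= 1 ->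
    N%:R * (h s0 / 2) * chi s - M <= h s * (1 + q s) ^+ N.
  move=> s01'; have [q0|q0] := leP (q s) 0.
    have -> : chi s = 0 by rewrite /chi ler0_norm//; lra.
    rewrite mulr0 sub0r; have : `|h s * (1 + q s) ^+ N| <= M.
      rewrite normrM normrX -[leRHS]mulr1 ler_pM// exprn_ile1//.
      rewrite ler_norml; have := cos_geN1 (2 * pi * (s - s0)).
      by have := cos_le1 (2 * pi * r); rewrite /q in q0 *; lra.
    by rewrite ler_norml => /andP[].
  have -> : chi s = q s by rewrite /chi gtr0_norm//; lra.
  have sr : `|s0 - s| < r.
    rewrite ltNge; apply/negP => rs.
    have := @cos_le_cos2piN R (s - s0) r (ltW r0).
    rewrite distrC rs/= => /(_ _); rewrite /q in q0.
    suff -> : `|s0 - s| <= 1 - r by move=> /(_ isT); lra.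
    by rewrite ler_norml; lra.
  have hs : h s0 / 2 <= h s.
    have := Hr1 s0 s (lt_trans sr rr1); rewrite ler_norml; lra.
  have := @bernoulli_le R (q s) N; move=> /(_ _) B.
  have {}B : 1 + N%:R * q s <= (1 + q s) ^+ N by apply: B; lra.
  have Nq : 0 <= N%:R * q s by rewrite mulr_ge0// ltW.
  apply: (@le_trans _ _ (h s0 / 2 * (1 + N%:R * q s))); last first.
    by apply: ler_pM => //; lra.
  nra.
have chiI : intL 1 chi <= 0.
  rewrite leNgt; apply/negP => I0.
  have cchi' := ucb_continuous _ cchi.
  have cN N : N%:R * (h s0 / 2) * intL 1 chi <= M.
    have cst1 := @intL_cst R 1 M ler01.
    have e1 : continuous (fun s => N%:R * (h s0 / 2) * chi s).
      by apply: ucb_continuous; exact: ucbZ.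
    rewrite -subr_le0 -(z N) -[X in _ - X]mulr1 -(@intL_cst R 1 M ler01) -intLZ//.
    rewrite -intLB//; last by move=> x; exact: cvg_cst.
    apply: le_intL; [| |exact: lb].
    - by apply: ucb_continuous; apply: ucbB; [exact: ucbZ|exact: ucb_cst].
    - by apply: ucb_continuous; have [] := tN N.
  have K0 : 0 < h s0 / 2 * intL 1 chi by rewrite mulr_gt0.
  have := archi_boundP (divr_ge0 M0 (ltW K0)); set N := Num.bound _.
  rewrite ltr_pdivrMr// mulrA => /lt_le_trans /(_ (cN N)).
  by rewrite ltxx.
have := @intL_eq0 R 1 chi ler01 (ucb_continuous _ cchi) (fun s _ => chi0 s) chiI s0 s01.
have q0 : 0 < q s0.
  rewrite /q subrr mulr0 subr_gt0 ltr_cos ?in_itv/=.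
  - by rewrite mulr_gt0// mulr_gt0// pi_gt0.
  - by rewrite lexx pi_ge0.
  - have p0 := @pi_gt0 R; nra.
by rewrite /chi gtr0_norm//; lra.
Qed.

Lemma fourier_unique1 (h : R -> R) : ucb h -> (forall s, h (s + 1) = h s) ->
  (forall n : int, intL 1 (fun s => h s * cos (2 * pi * (n%:~R * s))) = 0 /\
    intL 1 (fun s => h s * sin (2 * pi * (n%:~R * s))) = 0) ->
  forall s, h s = 0.
Proof.
move=> uh hp H.
have th : trigM h by [].
(* This is [- h], in the shape that [trigM_lin] offers; the sign bound for both gives zero inside
   the interval, continuity gives the endpoint. *)
have tNh : trigM (fun s => -1 * h s + 0 * h s) by exact: trigM_lin.
have in01 s : 0 < s < 1 -> h s = 0.
  move=> s01; have := fourier_le0 _ th _ s01; have := fourier_le0 _ tNh _ s01; lra.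
have h0 : h 0 = 0.
  apply/eqP; rewrite -normr_le0 leNgt; apply/negP => h0.
  have [r r0 /(_ 0 (Num.min r 1 / 2))] := uh.2 _ (divr_gt0 h0 (ltr0n R 2)).
  have m0 : 0 < Num.min r 1 by rewrite lt_min r0 ltr01.
  have mr : Num.min r 1 <= r by rewrite ge_min lexx.
  have m1 : Num.min r 1 <= 1 by rewrite ge_min lexx orbT.
  have -> : h (Num.min r 1 / 2) = 0 by apply: in01; lra.
  have -> : `|0 - Num.min r 1 / 2| = Num.min r 1 / 2.
    by rewrite sub0r normrN ger0_norm; lra.
  have mr2 : Num.min r 1 / 2 < r by lra.
  by rewrite subr0 => /(_ mr2); lra.
move=> s; have pZ (n : int) t : h (t + n%:~R) = h t.
  have pN (m : nat) w : h (w + m%:R) = h w.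
    by elim: m w => [|m IH] w; rewrite ?addr0// -natr1 addrA hp IH.
  case: n => m; first exact: pN.
  by rewrite NegzE mulrNz -(pN m.+1 (t - _)) subrK.
rewrite -(pZ (- Num.floor s)) mulrNz.
have := floor_itv s; rewrite intrD1 => /andP[].
rewrite -subr_ge0 le_eqVlt => /predU1P[<- //|f0 f1].
by apply: in01; rewrite f0; lra.
Qed.

End FourierUniqueness.

Section Frequencies.
Context {R : realType}.

Definition fcos {d} (xi : 'rV[int]_d) (x : 'rV[R]_d) : R :=
  cos (2 * pi * frequency_dot xi x).
Definition fsin {d} (xi : 'rV[int]_d) (x : 'rV[R]_d) : R :=
  sin (2 * pi * frequency_dot xi x).

Lemma frequency_dotB d (xi : 'rV[int]_d) (x y : 'rV[R]_d) :
  frequency_dot xi x - frequency_dot xi y = frequency_dot xi (x - y).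
Proof.
by rewrite /frequency_dot -sumrB; apply: eq_bigr => j _; rewrite !mxE -mulrBr.
Qed.

Lemma frequency_dot_dist d (xi : 'rV[int]_d) (x y : 'rV[R]_d) :
  `|2 * pi * frequency_dot xi x - 2 * pi * frequency_dot xi y|
  <= (2 * pi * \sum_(j < d) `|(xi 0 j)%:~R|) * `|x - y|.
Proof.
rewrite -mulrBr frequency_dotB normrM ger0_norm ?mulr_ge0 ?pi_ge0// -mulrA.
rewrite ler_wpM2l ?mulr_ge0 ?pi_ge0// mulr_suml.
rewrite (le_trans (ler_norm_sum _ _ _))//; apply: ler_sum => j _.
by rewrite normrM ler_wpM2l// coord_le_norm.
Qed.

Lemma ucb_fcos d (xi : 'rV[int]_d) : ucb (fcos xi).
Proof.
apply: (@ucb_comp _ _ _ (fun x : 'rV[R]_d => 2 * pi * frequency_dot xi x)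
  (2 * pi * \sum_(j < d) `|(xi 0 j)%:~R|) cos); last exact: ucb_cos.
exact: frequency_dot_dist.
Qed.

Lemma ucb_fsin d (xi : 'rV[int]_d) : ucb (fsin xi).
Proof.
apply: (@ucb_comp _ _ _ (fun x : 'rV[R]_d => 2 * pi * frequency_dot xi x)
  (2 * pi * \sum_(j < d) `|(xi 0 j)%:~R|) sin); last exact: ucb_sin.
exact: frequency_dot_dist.
Qed.

Lemma frequency_dot_row n (m : int) (xi : 'rV[int]_n) (s : R) (y : 'rV[R]_n) :
  frequency_dot (row_mx m%:M xi : 'rV[int]_(1 + n)) (row_mx s%:M y)
  = m%:~R * s + frequency_dot xi y.
Proof.
rewrite /frequency_dot big_split_ord/= big_ord1 !row_mxEl !mxE !eqxx !mulr1n.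
by congr (_ + _); apply: eq_bigr => j _; rewrite !row_mxEr.
Qed.

(** Separation of variables: integrating [f] against a fixed cosine or sine of the last coordinates
    leaves a function of the first one, all of whose coefficients vanish. By the case of one
    variable it is zero, so each slice of [f] satisfies the induction hypothesis. *)
Lemma fourier_unique d (f : 'rV[R]_d -> R) : ucb f -> per f ->
  (forall xi : 'rV[int]_d, torus_integral (fun x => f x * fcos xi x) = 0 /\
    torus_integral (fun x => f x * fsin xi x) = 0) ->
  forall x, f x = 0.
Proof.
elim: d f => [|n IH] f uf pf H x.
  have [+ _] := H 0; rewrite /= /fcos /frequency_dot big_ord0 mulr0 cos0 mulr1.
  by rewrite (thinmx0 x) => ->.
have -> : x = row_mx (x 0 ord0)%:M (rsubmx (x : 'rV[R]_(1 + n))).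
  have E : lsubmx (x : 'rV[R]_(1 + n)) = (x 0 ord0)%:M.
    apply/rowP => i; rewrite !ord1 !mxE eqxx mulr1n; congr (x _ _); exact: val_inj.
  by rewrite -E hsubmxK.
change ('rV[R]_(1 + n) -> R) in f.
set s := x 0 ord0; set y := rsubmx _.
have ucbJ (g : 'rV[R]_n -> R) : ucb g ->
    ucb (fun s => torus_integral (fun y => f (row_mx s%:M y) * g y)).
  move=> ug.
  have -> : (fun s => torus_integral (fun y => f (row_mx s%:M y) * g y)) =
      (fun s => torus_integral (fun y => (fun x : 'rV[R]_(1 + n) => f x * g (rsubmx x))
        (row_mx s%:M y))).
    apply/funext => t; congr torus_integral; apply/funext => z.
    by rewrite row_mxKr.
  apply: (ucb_torus_integral_slice n (fun x : 'rV[R]_(1 + n) => f x * g (rsubmx x))); apply: ucbM => //.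
  apply: (@ucb_comp _ _ _ (fun x : 'rV[R]_(1 + n) => rsubmx x) 1) => // a b.
  rewrite mul1r -linearB/=; apply: rV_norm_le => // j; rewrite mxE.
  exact: coord_le_norm.
have key (g : 'rV[R]_n -> R) : ucb g ->
    (forall (m : int), intL 1 (fun s => torus_integral (fun y => f (row_mx s%:M y) * g y)
         * cos (2 * pi * (m%:~R * s))) = 0 /\
       intL 1 (fun s => torus_integral (fun y => f (row_mx s%:M y) * g y)
         * sin (2 * pi * (m%:~R * s))) = 0) ->
    forall s, torus_integral (fun y => f (row_mx s%:M y) * g y) = 0.
  move=> ug Hg; apply: fourier_unique1 => //.
  - exact: ucbJ.
  - move=> t; congr torus_integral; apply/funext => z; congr (_ * _).
    rewrite -[RHS](pf (lshift n (ord0 : 'I_1))) row_mx_slice [in RHS]row_mx_slice.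
    by rewrite scalerDl scale1r addrA.
apply: (IH (fun y => f (row_mx s%:M y))) => [||xi].
- exact: ucb_slice.
- move=> i z; rewrite -[RHS](pf (rshift 1 i)).
  by rewrite -[delta_mx 0 (rshift 1 i)]scale1r row_mx_add_delta scale1r.
pose J (a : 'rV[R]_n -> R) (b : R -> R) :=
  intL 1 (fun s => torus_integral (fun y => f (row_mx s%:M y) * a y) * b s).
pose c_ (m : int) (s : R) := cos (2 * pi * (m%:~R * s)).
pose s_ (m : int) (s : R) := sin (2 * pi * (m%:~R * s)).
have ucb_c m : ucb (c_ m).
  rewrite /c_; under eq_fun do rewrite mulrA.
  by apply: (ucb_mulr_comp cos); exact: ucb_cos.
have ucb_s m : ucb (s_ m).
  rewrite /s_; under eq_fun do rewrite mulrA.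
  by apply: (ucb_mulr_comp sin); exact: ucb_sin.
have uc := ucb_fcos n xi; have us := ucb_fsin n xi.
have JN a m : ucb a -> J a (s_ (- m)) = - J a (s_ m).
  move=> ua; rewrite -[RHS]mulN1r -intLZ; last by apply: ucb_continuous; apply: ucbM; [exact: ucbJ|].
  by apply: eq_intL => t _; rewrite /s_ mulrNz mulNr mulrN sinN; ring.
have comb (a1 a2 : 'rV[R]_n -> R) (b1 b2 : R -> R) (g : 'rV[R]_(1 + n) -> R) (c : R) :
    ucb a1 -> ucb a2 -> ucb b1 -> ucb b2 ->
    (forall s y, g (row_mx s%:M y) = b1 s * a1 y + c * (b2 s * a2 y)) ->
    torus_integral (fun x => f x * g x) = J a1 b1 + c * J a2 b2.
  move=> u1 u2 v1 v2 gE; rewrite -[c * _]intLZ; last first.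
    by apply: ucb_continuous; apply: ucbM => //; exact: ucbJ.
  rewrite -intLD; last 2 first.
  - by apply: ucb_continuous; apply: ucbM => //; exact: ucbJ.
  - by apply: ucb_continuous; apply: ucbZ; apply: ucbM => //; exact: ucbJ.
  apply: eq_intL => t _ /=.
  have w1 : ucb (fun z => f (row_mx t%:M z) * a1 z) by apply: ucbM => //; exact: ucb_slice.
  have w2 : ucb (fun z => f (row_mx t%:M z) * a2 z) by apply: ucbM => //; exact: ucb_slice.
  rewrite mulrC (mulrC (torus_integral _)) mulrA -!torus_integralZ// -torus_integralD.
  - by congr torus_integral; apply/funext => z; rewrite gE; ring.
  - exact: ucbZ.
  - exact: ucbZ.
have E1 m : J (fcos xi) (c_ m) + -1 * J (fsin xi) (s_ m) = 0.
  have [<- _] := H (row_mx m%:M xi).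
  apply/esym/comb => // t z; rewrite /fcos frequency_dot_row mulrDr cosD.
  by rewrite mulN1r.
have E2 m : J (fcos xi) (s_ m) + 1 * J (fsin xi) (c_ m) = 0.
  have [_ <-] := H (row_mx m%:M xi).
  apply/esym/comb => // t z; rewrite /fsin frequency_dot_row mulrDr sinD.
  by rewrite mul1r.
have cN m : c_ (- m) = c_ m.
  by apply/funext => t; rewrite /c_ mulrNz mulNr mulrN cosN.
(* The addition formulas only give a difference or a sum of two products. Replacing [m] by [- m]
   flips one sign in each, and the four products come apart. *)
have Z m : [/\ J (fcos xi) (c_ m) = 0, J (fcos xi) (s_ m) = 0,
    J (fsin xi) (c_ m) = 0 & J (fsin xi) (s_ m) = 0].
  have := E1 m; have := E1 (- m); have := E2 m; have := E2 (- m).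
  by rewrite !cN !JN//; split; lra.
by split; apply: key => // m; have [] := Z m.
Qed.

End Frequencies.

Section TrigonometricDerivatives.
Context {R : realType}.

Lemma is_derive_val {V W : normedModType R} {f : V -> W} {x v : V} {c : W} :
  is_derive x v f c -> 'D_v f x = c.
Proof. by case. Qed.

Lemma is_derive_of_line {V : normedModType R} (f : V -> R) (x v : V) (c : R) :
  is_derive (0 : R) 1 (fun t : R => f (x + t *: v)) c -> is_derive x v f c.
Proof.
have E : (fun h : R => h^-1 *: ((f \o shift x) (h *: v) - f x))
  = (fun h : R => h^-1 *: (((fun t : R => f (x + t *: v)) \o shift (0 : R)) (h *: (1 : R)) -
      (fun t : R => f (x + t *: v)) 0)).
  apply/funext => h /=; rewrite scale0r !addr0.
  by rewrite [h *: (1 : R)]mulr1 [_ + x]addrC.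
by move=> [fd fc]; split; [rewrite /derivable E|rewrite /derive E].
Qed.

Lemma frequency_dot_line d (xi : 'rV[int]_d) (x v : 'rV[R]_d) s :
  frequency_dot xi (x + s *: v) = frequency_dot xi x + s * frequency_dot xi v.
Proof.
rewrite /frequency_dot mulr_sumr -big_split/=; apply: eq_bigr => j _.
by rewrite !mxE; ring.
Qed.

Lemma is_derive_affine (a b t : R) : is_derive t 1 (fun s : R => a + s * b) b.
Proof.
apply/is_derive_epsP => e e0; exists 1 => // s _.
have -> : a + s * b - (a + t * b) - (s - t) * b = 0 by ring.
by rewrite normr0 mulr_ge0// ltW.
Qed.

Lemma is_derive_fcos d (xi : 'rV[int]_d) (x v : 'rV[R]_d) :
  is_derive x v (fcos xi) (- (2 * pi * frequency_dot xi v) * fsin xi x).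
Proof.
apply: is_derive_of_line.
have -> : (fun t : R => fcos xi (x + t *: v)) =
    cos \o (fun t : R => 2 * pi * frequency_dot xi x + t * (2 * pi * frequency_dot xi v)).
  by apply/funext => t; rewrite /fcos /= frequency_dot_line; congr cos; ring.
have D := is_derive_affine (2 * pi * frequency_dot xi x) (2 * pi * frequency_dot xi v) 0.
by apply: is_derive_eq; rewrite mul0r addr0 /fsin mulrC mulNr mulrN.
Qed.

Lemma is_derive_fsin d (xi : 'rV[int]_d) (x v : 'rV[R]_d) :
  is_derive x v (fsin xi) ((2 * pi * frequency_dot xi v) * fcos xi x).
Proof.
apply: is_derive_of_line.
have -> : (fun t : R => fsin xi (x + t *: v)) =
    sin \o (fun t : R => 2 * pi * frequency_dot xi x + t * (2 * pi * frequency_dot xi v)).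
  by apply/funext => t; rewrite /fsin /= frequency_dot_line; congr sin; ring.
have D := is_derive_affine (2 * pi * frequency_dot xi x) (2 * pi * frequency_dot xi v) 0.
by apply: is_derive_eq; rewrite mul0r addr0 /fcos mulrC.
Qed.

Lemma frequency_dot_delta d (xi : 'rV[int]_d) (j : 'I_d) :
  frequency_dot xi (delta_mx 0 j) = (xi 0 j)%:~R :> R.
Proof.
rewrite /frequency_dot (bigD1 j)//= mxE !eqxx mulr1 big1 ?addr0// => i ij.
by rewrite mxE (negbTE ij) mulr0.
Qed.

Lemma cos_sin_int (n : int) (a : R) :
  cos (a + 2 * pi * n%:~R) = cos a /\ sin (a + 2 * pi * n%:~R) = sin a.
Proof.
have pN (m : nat) (b : R) : cos (b + 2 * pi * m%:R) = cos b /\ sin (b + 2 * pi * m%:R) = sin b.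
  rewrite mulr_natr mulr_natl.
  by rewrite (periodicn (@cosD2pi R)) (periodicn (@sinD2pi R)).
case: n => m; first exact: pN.
have [] := pN m.+1 (a + 2 * pi * (Negz m)%:~R).
by rewrite NegzE mulrNz mulrN subrK => <- <-.
Qed.

Lemma per_fcos d (xi : 'rV[int]_d) : per (@fcos R d xi).
Proof.
move=> j x; rewrite /fcos -[delta_mx 0 j]scale1r frequency_dot_line mul1r.
by rewrite frequency_dot_delta mulrDr; have [] := cos_sin_int (xi 0 j) (2 * pi * frequency_dot xi x).
Qed.

Lemma per_fsin d (xi : 'rV[int]_d) : per (@fsin R d xi).
Proof.
move=> j x; rewrite /fsin -[delta_mx 0 j]scale1r frequency_dot_line mul1r.
by rewrite frequency_dot_delta mulrDr; have [] := cos_sin_int (xi 0 j) (2 * pi * frequency_dot xi x).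
Qed.

(** At a nonzero frequency each of the two functions is a multiple of a partial derivative of the
    other, and partial derivatives integrate to zero. *)
Lemma torus_integral_fcos_fsin d (xi : 'rV[int]_d) :
  torus_integral (@fcos R d xi) = (xi == 0)%:R /\ torus_integral (@fsin R d xi) = 0.
Proof.
have [->|/eqP xi0] := eqVneq xi 0.
  have E x : frequency_dot (0 : 'rV[int]_d) x = 0 :> R.
    by rewrite /frequency_dot big1// => j _; rewrite mxE mul0r.
  split; rewrite -[RHS](@torus_integral_cst R d); congr torus_integral; apply/funext => x.
    by rewrite /fcos E mulr0 cos0.
  by rewrite /fsin E mulr0 sin0.
have [j xij] : exists j, xi 0 j != 0.
  apply: contrapT => H; apply: xi0; apply/rowP => j; rewrite mxE.
  by apply/eqP; apply: contrapT => /negP K; apply: H; exists j.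
have c0 : 2 * pi * (xi 0 j)%:~R != 0 :> R.
  by rewrite !mulf_neq0 ?intr_eq0// gt_eqF// pi_gt0.
split.
- have E : partial j (fsin xi) = (fun x => 2 * pi * (xi 0 j)%:~R * fcos xi x) :> (_ -> R).
    by apply/funext => x; rewrite /partial (is_derive_val (is_derive_fsin _ _ _ _)) frequency_dot_delta.
  have : torus_integral (partial j (@fsin R d xi)) = 0.
    apply: torus_integral_partial.
    - exact: per_fsin.
    - by move=> x; have [] := is_derive_fsin d xi x (delta_mx 0 j).
    - exact: ucb_fsin.
    - by rewrite E; apply: ucbZ; exact: ucb_fcos.
  rewrite E torus_integralZ; last exact: ucb_fcos.
  by move=> /eqP; rewrite mulf_eq0 (negbTE c0)/= => /eqP.
- have E : partial j (fcos xi) = (fun x => - (2 * pi * (xi 0 j)%:~R) * fsin xi x) :> (_ -> R).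
    by apply/funext => x; rewrite /partial (is_derive_val (is_derive_fcos _ _ _ _)) frequency_dot_delta.
  have : torus_integral (partial j (@fcos R d xi)) = 0.
    apply: torus_integral_partial.
    - exact: per_fcos.
    - by move=> x; have [] := is_derive_fcos d xi x (delta_mx 0 j).
    - exact: ucb_fcos.
    - by rewrite E; apply: ucbZ; exact: ucb_fsin.
  rewrite E torus_integralZ; last exact: ucb_fsin.
  by move=> /eqP; rewrite mulf_eq0 oppr_eq0 (negbTE c0)/= => /eqP.
Qed.

Lemma frequency_dotD d (xi eta : 'rV[int]_d) (x : 'rV[R]_d) :
  frequency_dot (xi + eta) x = frequency_dot xi x + frequency_dot eta x.
Proof.
rewrite /frequency_dot -big_split/=; apply: eq_bigr => j _.
by rewrite mxE intrD mulrDl.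
Qed.

Lemma frequency_dotN d (xi : 'rV[int]_d) (x : 'rV[R]_d) :
  frequency_dot (- xi) x = - frequency_dot xi x.
Proof.
rewrite /frequency_dot -sumrN; apply: eq_bigr => j _.
by rewrite mxE mulrNz mulNr.
Qed.

(** Frequencies are not identified up to sign, so [eta] and [- eta] carry the same cosine and
    opposite sines; this is the origin of the two indicators and of the factor 1/2. *)
Lemma torus_integral_fourier_orthogonality d (xi eta : 'rV[int]_d) :
  [/\ torus_integral (fun x => fcos xi x * fcos eta x)
        = ((xi == eta)%:R + (xi == - eta)%:R) / 2 :> R,
      torus_integral (fun x => fsin xi x * fcos eta x) = 0 :> R,
      torus_integral (fun x => fcos xi x * fsin eta x) = 0 :> R &
      torus_integral (fun x => fsin xi x * fsin eta x)
        = ((xi == eta)%:R - (xi == - eta)%:R) / 2 :> R].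
Proof.
have A (x : 'rV[R]_d) : 2 * pi * frequency_dot (xi + eta) x =
    2 * pi * frequency_dot xi x + 2 * pi * frequency_dot eta x.
  by rewrite frequency_dotD mulrDr.
have B (x : 'rV[R]_d) : 2 * pi * frequency_dot (xi - eta) x =
    2 * pi * frequency_dot xi x - 2 * pi * frequency_dot eta x.
  by rewrite frequency_dotD frequency_dotN mulrBr.
have [c1 s1] := torus_integral_fcos_fsin d (xi + eta).
have [c2 s2] := torus_integral_fcos_fsin d (xi - eta).
have e1 : (xi == - eta) = (xi + eta == 0) by rewrite addr_eq0.
have e2 : (xi == eta) = (xi - eta == 0) by rewrite subr_eq0.
have lin (a b : R) (f g h : 'rV[R]_d -> R) : ucb f -> ucb g ->
    (forall x, h x = a * f x + b * g x) ->
    torus_integral h = a * torus_integral f + b * torus_integral g.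
  move=> uf ug hE; rewrite -!torus_integralZ// -torus_integralD; last 2 first.
  - exact: ucbZ.
  - exact: ucbZ.
  by congr torus_integral; apply/funext.
have uc := @ucb_fcos R d; have us := @ucb_fsin R d.
split.
- rewrite (lin 2^-1 2^-1 (fcos (xi - eta)) (fcos (xi + eta)))// ?c1 ?c2 ?e1 ?e2.
    by rewrite -mulrDr mulrC.
  by move=> x; rewrite /fcos A B cosB cosD; lra.
- rewrite (lin 2^-1 2^-1 (fsin (xi - eta)) (fsin (xi + eta)))// ?s1 ?s2.
    by rewrite !mulr0 addr0.
  by move=> x; rewrite /fcos /fsin A B sinB sinD; lra.
- rewrite (lin (- 2^-1) 2^-1 (fsin (xi - eta)) (fsin (xi + eta)))// ?s1 ?s2.
    by rewrite !mulr0 addr0.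
  by move=> x; rewrite /fcos /fsin A B sinB sinD; lra.
- rewrite (lin 2^-1 (- 2^-1) (fcos (xi - eta)) (fcos (xi + eta)))// ?c1 ?c2 ?e1 ?e2.
    by rewrite mulNr -mulrBr mulrC.
  by move=> x; rewrite /fcos /fsin A B cosB cosD; lra.
Qed.

End TrigonometricDerivatives.

Section BoundedNonnegativeSeries.
Context {R : realType}.

Definition sum_bounded (u : nat -> R) (B : R) : Prop :=
  forall N, \sum_(0 <= n < N) u n <= B.

Lemma sum_bounded_tail (u : nat -> R) B : (forall n, 0 <= u n) -> sum_bounded u B ->
  forall e : R, 0 < e -> exists N, forall M, (N <= M)%N -> \sum_(N <= n < M) u n <= e.
Proof.
move=> u0 uB e e0.
pose S := [set \sum_(0 <= n < N) u n | N in [set: nat]].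
have hS : has_sup S.
  by split; [exists 0; exists 0%N; rewrite ?big_geq|exists B => _ [N _ <-]; exact: uB].
have [_ [N _ <-] SN] := sup_adherent e0 hS.
exists N => M NM.
have : \sum_(0 <= n < M) u n <= sup S.
  by apply: sup_upper_bound => //; exists M.
by rewrite (big_cat_nat (n:=N))//=; lra.
Qed.

Lemma sum_bounded_le (u v : nat -> R) B : (forall n, u n <= v n) ->
  sum_bounded v B -> sum_bounded u B.
Proof. by move=> uv vB N; apply: le_trans (vB N); exact: ler_sum. Qed.

Lemma limn_sum_approx (u v : nat -> R) B : (forall n, `|u n| <= v n) ->
  sum_bounded v B -> forall e : R, 0 < e ->
  exists N, forall M, (N <= M)%N -> `|limn (series u) - \sum_(0 <= n < M) u n| <= e.
Proof.
move=> uv vB e e0.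
have v0 n : 0 <= v n := le_trans (normr_ge0 _) (uv n).
have cu : cvgn (series u).
  apply: normed_cvg; apply: nondecreasing_is_cvgn.
    apply/nondecreasing_seqP => n; rewrite /normed_series_of seriesSr lerDl.
    exact: normr_ge0.
  exists B => _ [N _ <-]; apply: le_trans (vB N).
  by apply: ler_sum => n _; exact: uv.
have /cvgrPdist_le /(_ e e0) [N _ HN] := cu.
by exists N => M NM; exact: HN.
Qed.

End BoundedNonnegativeSeries.

(** * Absolutely convergent trigonometric series and termwise differentiation *)

Section TrigonometricSeries.
Context {R : realType} {d : nat} (xi : nat -> 'rV[int]_d).
Implicit Types (a b : nat -> R) (x v : 'rV[R]_d).

Definition trig_term a b n x : R := a n * fcos (xi n) x + b n * fsin (xi n) x.
Definition trig_series a b x : R := limn (series (fun n => trig_term a b n x)).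
Definition trig_bounded a b B : Prop := sum_bounded (fun n => `|a n| + `|b n|) B.

Lemma trig_term_le a b n x : `|trig_term a b n x| <= `|a n| + `|b n|.
Proof.
rewrite (le_trans (ler_normD _ _))// !normrM lerD// -[leRHS]mulr1 ler_wpM2l//.
  exact: cos_max.
exact: sin_max.
Qed.

(** Weierstrass M-test: the tail of the coefficients bounds the tail of the series, so [N] is chosen
    before [x]. *)
Lemma trig_series_approx a b B : trig_bounded a b B -> forall e : R, 0 < e ->
  exists N, forall M, (N <= M)%N -> forall x,
    `|trig_series a b x - \sum_(0 <= n < M) trig_term a b n x| <= e.
Proof.
move=> aB e e0; have e20 : 0 < e / 2 by lra.
have ab0 n : 0 <= `|a n| + `|b n| by rewrite addr_ge0.
have [N HN] := sum_bounded_tail _ _ ab0 aB _ e20; exists N => M NM x.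
have [P HP] := limn_sum_approx _ _ _ (fun n => trig_term_le a b n x) aB _ e20.
have {HP} := HP _ (leq_maxr M P); rewrite -/(trig_series a b x).
rewrite (big_cat_nat (n:=M))//=; last exact: leq_maxl.
set s := \sum_(0 <= n < M) _; set t := \sum_(M <= n < _) _ => H1.
have H2 : `|t| <= e / 2.
  rewrite (le_trans (ler_norm_sum _ _ _))//.
  apply: le_trans (HN (maxn M P) (leq_trans NM (leq_maxl _ _))).
  rewrite [leRHS](big_cat_nat (n:=M))//=; last exact: leq_maxl.
  rewrite -[leLHS]add0r lerD ?sumr_ge0//.
  by apply: ler_sum => n _; exact: trig_term_le.
by move: H1 H2; rewrite !ler_norml; lra.
Qed.

Lemma trig_series_le a b B : trig_bounded a b B -> forall x, `|trig_series a b x| <= B.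
Proof.
move=> aB x; apply/ler_addgt0Pr => e e0.
have [N /(_ N (leqnn N) x) H] := trig_series_approx _ _ _ aB _ e0.
have : `|\sum_(0 <= n < N) trig_term a b n x| <= B.
  apply: le_trans (aB N); apply: le_trans (ler_norm_sum _ _ _) _.
  by apply: ler_sum => n _; exact: trig_term_le.
by move: H; rewrite !ler_norml; lra.
Qed.

Lemma ucb_trig_term a b n : ucb (trig_term a b n).
Proof.
by apply: ucbD; apply: ucbZ; [exact: ucb_fcos|exact: ucb_fsin].
Qed.

Lemma ucb_trig_series a b B : trig_bounded a b B -> ucb (trig_series a b).
Proof.
move=> aB; split; first by exists B; exact: trig_series_le.
move=> e e0; have e30 : 0 < e / 3 by lra.
have [N /(_ N (leqnn N)) HN] := trig_series_approx _ _ _ aB _ e30.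
have [_ /(_ _ e30) [r r0 Hr]] : ucb (fun x => \sum_(0 <= n < N) trig_term a b n x).
  by apply: ucb_sum => n; exact: ucb_trig_term.
exists r => // x y /Hr; move: (HN x) (HN y); rewrite !ler_norml; lra.
Qed.

Lemma per_trig_series a b : per (trig_series a b).
Proof.
move=> j x; rewrite /trig_series; congr (limn (series _)); apply/funext => n.
by rewrite /trig_term per_fcos per_fsin.
Qed.

(** Differentiation along [v] exchanges cosine and sine coefficients: the pair [(a, b)] becomes
    [(dcoef v 1 b, dcoef v (- 1) a)], the scalar [c] carrying the sign. *)
Definition dcoef v (c : R) b : nat -> R :=
  fun n => c * (2 * pi * frequency_dot (xi n) v) * b n.

Lemma is_derive_trig_term a b n x v :
  is_derive x v (trig_term a b n) (trig_term (dcoef v 1 b) (dcoef v (- 1) a) n x).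
Proof.
have Dc := is_derive_fcos d (xi n) x v; have Ds := is_derive_fsin d (xi n) x v.
have -> : trig_term a b n = (a n \*: fcos (xi n)) + (b n \*: fsin (xi n)) by [].
apply: is_derive_eq; rewrite /trig_term /dcoef /GRing.scale/=; ring.
Qed.

Lemma trig_term_lip a b n x v (s : R) :
  `|trig_term a b n (x + s *: v) - trig_term a b n x|
  <= `|s| * (`|dcoef v 1 b n| + `|dcoef v (- 1) a n|).
Proof.
have E : 2 * pi * frequency_dot (xi n) (x + s *: v) - 2 * pi * frequency_dot (xi n) x
    = s * (2 * pi * frequency_dot (xi n) v) by rewrite frequency_dot_line; ring.
have Hc := cos_dist_le (2 * pi * frequency_dot (xi n) (x + s *: v))
  (2 * pi * frequency_dot (xi n) x).
have Hs := sin_dist_le (2 * pi * frequency_dot (xi n) (x + s *: v))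
  (2 * pi * frequency_dot (xi n) x).
rewrite /trig_term /dcoef; move: Hc Hs; rewrite !E !normrM.
rewrite -/(fcos _ _) -/(fsin _ _) -/(fcos _ x) -/(fsin _ x) => Hc Hs.
have -> : a n * fcos (xi n) (x + s *: v) + b n * fsin (xi n) (x + s *: v) -
    (a n * fcos (xi n) x + b n * fsin (xi n) x) =
    a n * (fcos (xi n) (x + s *: v) - fcos (xi n) x) +
    b n * (fsin (xi n) (x + s *: v) - fsin (xi n) x) by ring.
apply: (le_trans (ler_normD _ _)); rewrite [leRHS]mulrDr [leRHS]addrC.
rewrite !normrM normrN1 normr1 !mul1r.
by apply: lerD; rewrite mulrC [leRHS]mulrA; apply: ler_wpM2r.
Qed.

(** The increment is split at a rank [N]. The finite part is differentiable, and the increment of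
    the tail is at most [|s|] times the tail of the differentiated coefficients, since each term is
    Lipschitz along [v]. *)
Lemma is_derive_trig_series a b B B' x v : trig_bounded a b B ->
  trig_bounded (dcoef v 1 b) (dcoef v (- 1) a) B' ->
  is_derive x v (trig_series a b) (trig_series (dcoef v 1 b) (dcoef v (- 1) a) x).
Proof.
move=> aB aB'; apply: is_derive_of_line; apply/is_derive_epsP => e e0.
have e40 : 0 < e / 4 by lra.
set a' := dcoef v 1 b in aB' *; set b' := dcoef v (- 1) a in aB' *.
have ab0 n : 0 <= `|a' n| + `|b' n| by rewrite addr_ge0.
have [N1 HN1] := sum_bounded_tail _ _ ab0 aB' _ e40.
have [N2 HN2] := trig_series_approx _ _ _ aB' _ e40.
pose N := maxn N1 N2.
have /is_derive_epsP/(_ _ e40) [r r0 Hr] : is_derive (0 : R) 1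
    (fun s : R => \sum_(0 <= n < N) trig_term a b n (x + s *: v))
    (\sum_(0 <= n < N) trig_term a' b' n x).
  elim: N => [|N IH].
    under eq_fun do rewrite big_geq//; rewrite big_geq//.
    exact: is_derive_cst.
  under eq_fun do rewrite big_nat_recr//=; rewrite big_nat_recr//=.
  apply: is_deriveD.
  have := @is_derive_line R _ (trig_term a b N) x v 0.
  have D := is_derive_trig_term a b N x v; rewrite scale0r addr0 (is_derive_val D).
  by apply; have [] := D.
exists r => // s /Hr; rewrite subr0 scale0r addr0 => H1.
have H2 : `|trig_series a' b' x - \sum_(0 <= n < N) trig_term a' b' n x| <= e / 4.
  by apply: HN2; exact: leq_maxr.
have H3 : `|(trig_series a b (x + s *: v) - \sum_(0 <= n < N) trig_term a b n (x + s *: v))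
   - (trig_series a b x - \sum_(0 <= n < N) trig_term a b n x)| <= e / 4 * `|s|.
  apply/ler_addgt0Pr => e' e'0; have e'20 : 0 < e' / 2 by lra.
  have [P HP] := trig_series_approx _ _ _ aB _ e'20.
  have [H4 H5] := (HP _ (leq_maxr N P) x, HP _ (leq_maxr N P) (x + s *: v)).
  have : `|\sum_(N <= n < maxn N P) trig_term a b n (x + s *: v) -
      \sum_(N <= n < maxn N P) trig_term a b n x| <= e / 4 * `|s|.
    rewrite -sumrB; apply: le_trans (ler_norm_sum _ _ _) _.
    apply: (@le_trans _ _ (\sum_(N <= n < maxn N P) `|s| * (`|a' n| + `|b' n|))).
      by apply: ler_sum => n _; exact: trig_term_lip.
    rewrite -mulr_sumr mulrC ler_wpM2r//.
    have N1N : (N1 <= maxn N P)%N by rewrite leq_max leq_maxl.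
    apply: le_trans (HN1 _ N1N).
    rewrite [leRHS](big_cat_nat (n:=N))//=; last 2 first.
    - exact: leq_maxl.
    - exact: leq_maxl.
    by rewrite lerDr sumr_ge0.
  move: H4 H5; rewrite !(big_cat_nat (n:=N) (m:=0) (p:=maxn N P))//=; last 2 first.
  - exact: leq_maxl.
  - exact: leq_maxl.
  by rewrite !ler_norml; lra.
set A := trig_series a b _ in H3 *; set A' := trig_series a b x in H3 *.
set C := \sum_(0 <= n < N) _ in H1 H3; set C' := \sum_(0 <= n < N) _ in H1 H3.
set D := \sum_(0 <= n < N) _ in H1 H2; set T := trig_series a' b' x in H2 *.
have -> : A - A' - s * T = (A - C - (A' - C')) + (C - C' - s * D) - s * (T - D) by ring.
have H5 : `|s * (T - D)| <= e / 4 * `|s| by rewrite normrM mulrC ler_wpM2r.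
apply: (le_trans (ler_normB _ _)); apply: (le_trans (lerD (ler_normD _ _) (lexx _))).
have s0 := normr_ge0 s; have : 0 <= e * `|s| by rewrite mulr_ge0// ltW.
lra.
Qed.

End TrigonometricSeries.

(** * Summability of negative powers of the Bessel symbol over the lattice *)

Section LatticeSum.
Context {R : realType}.

(** A discrete substitute for comparing a sum with the integral of a power. It comes from
    [ln u - ln v >= 1 / u] for [u = v + 1] and from [exp x >= 1 + x]. *)
Lemma powR_telescope (q : R) (c : nat) : 0 < q ->
  q * (c.+2%:R `^ (- (q + 1))) <= c.+1%:R `^ (- q) - c.+2%:R `^ (- q).
Proof.
move=> q0; set u : R := c.+2%:R; set v : R := c.+1%:R.
have u0 : 0 < u by rewrite ltr0n.
have v0 : 0 < v by rewrite ltr0n.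
have vu : u = v + 1 by rewrite /u -natr1.
have -> : u `^ (- (q + 1)) = u `^ (- q) / u.
  rewrite opprD powRD; last by rewrite (gt_eqF u0) implybT.
  by rewrite powR_inv1 ?ltW.
have -> : v `^ (- q) = u `^ (- q) * expR (q * (ln u - ln v)).
  rewrite /powR !gt_eqF// -expRD; congr expR; ring.
rewrite -[X in _ <= _ - X]mulr1 -mulrBr mulrCA ler_pM2l ?powR_gt0//.
have H : u^-1 <= ln u - ln v.
  rewrite -ln_div ?posrE//.
  have -> : u / v = (1 - u^-1)^-1.
    have vE : v / u = 1 - u^-1.
      by rewrite -[v](addrK 1) -vu mulrBl divff ?gt_eqF// mul1r.
    by rewrite -vE invf_div.
  have w0 : 0 < 1 - u^-1 by rewrite subr_gt0 invf_lt1// vu; lra.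
  have : ln (1 - u^-1) <= ln (expR (- u^-1)).
    by rewrite ler_ln ?posrE ?expR_gt0//; exact: expR_ge1Dx.
  by rewrite lnV ?posrE// expRK lerNr.
rewrite lerBrDl; apply: le_trans (expR_ge1Dx _).
by rewrite lerD2l; exact: ler_wpM2l (ltW q0) _ _ H.
Qed.

Lemma sum_powR_le (p : R) : 1 < p ->
  sum_bounded (fun c => c.+1%:R `^ (- p)) (1 + (p - 1)^-1).
Proof.
move=> p1 N; have q0 : 0 < p - 1 by lra.
have q1 : 0 < (p - 1)^-1 by rewrite invr_gt0.
case: N => [|N]; first by rewrite big_geq//; lra.
rewrite big_nat_recl//= powR1.
rewrite lerD2l -[leRHS]mulr1 -ler_pdivrMl// invrK mulr_sumr.
apply: (@le_trans _ _ (\sum_(0 <= i < N) (i.+1%:R `^ (- (p - 1)) - i.+2%:R `^ (- (p - 1))))).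
  by apply: ler_sum => i _; have := powR_telescope (p - 1) i q0; rewrite subrK.
under eq_bigr do rewrite -opprB.
rewrite sumrN (telescope_sumr (fun i => (i.+1%:R : R) `^ (- (p - 1))))//.
by rewrite opprB powR1 lerBlDr lerDl powR_ge0.
Qed.

(** Interleaves the nonnegative and the negative integers ([Negz n] is [- n - 1]). The code is at
    most [2 |z|], so its square is controlled by the symbol, and sums over integers turn into sums
    over natural numbers. *)
Definition int_code (z : int) : nat :=
  match z with Posz n => n.*2 | Negz n => n.*2.+1 end.

Lemma int_code_inj : injective int_code.
Proof.
move=> [m|m] [n|n] /= E; [|exfalso; lia|exfalso; lia|];
  by have -> : m = n by lia.
Qed.

Lemma int_code_le (z : int) : (int_code z).+1%:R ^+ 2 <= 1 + (2 * pi * z%:~R) ^+ 2 :> R.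
Proof.
have p2 := @pi_ge2 R.
have H : 16 * (z%:~R) ^+ 2 <= (2 * pi * z%:~R) ^+ 2 :> R.
  rewrite exprMn ler_wpM2r ?sqr_ge0//.
  by have := mulr_ge0 (_ : 0 <= pi - 2 :> R) (_ : 0 <= pi + 2 :> R); rewrite expr2; nra.
apply: (@le_trans _ _ (1 + 16 * (z%:~R) ^+ 2)); last by rewrite lerD2l.
case: z {H} => n /=.
  have : n%:R <= n%:R ^+ 2 :> R by rewrite -natrX ler_nat; nia.
  by rewrite -natr1 -muln2 natrM; have := ler0n R n; nra.
rewrite NegzE mulrNz sqrrN; have -> : n.*2.+2%:R = 2 * n.+1%:R :> R.
  by rewrite -natrM; congr (_%:R); lia.
by have := sqr_ge0 (n.+1%:R : R); rewrite exprMn; nra.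
Qed.

Lemma bessel_symbol_ge1 d (xi : 'rV[int]_d) : 1 <= bessel_symbol xi :> R.
Proof. by rewrite /bessel_symbol lerDl sumr_ge0// => j _; exact: sqr_ge0. Qed.

(** Each coordinate alone bounds the symbol from below by a square. Sharing the exponent [r] equally
    among the [d] coordinates gives a product of one-variable terms with exponent [2 r / d], which
    exceeds 1 exactly when [r > d / 2]. *)
Lemma lattice_term_le d (xi : 'rV[int]_d) (r : R) : (0 < d)%N -> 0 <= r ->
  bessel_symbol xi `^ (- r)
  <= \prod_(j < d) ((int_code (xi 0 j)).+1%:R `^ (- (2 * r / d%:R))).
Proof.
move=> d0 r0; set s : R := bessel_symbol xi.
have s1 : 1 <= s := bessel_symbol_ge1 _ _.
have s0 : 0 < s by lra.
have dR : d%:R != 0 :> R by rewrite pnatr_eq0 -lt0n.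
have -> : s `^ (- r) = \prod_(j < d) (s `^ (- (r / d%:R))).
  rewrite prodr_const card_ord -powR_mulrn ?powR_ge0// -powRrM; congr (_ `^ _).
  by rewrite mulNr divfK.
apply: ler_prod => j _; rewrite powR_ge0/=.
set c : R := (int_code _).+1%:R.
have c0 : 0 < c by rewrite ltr0n.
have cs : c ^+ 2 <= s.
  apply: le_trans (int_code_le _) _; rewrite lerD2l (bigD1 j)//= lerDl.
  by rewrite sumr_ge0// => i _; exact: sqr_ge0.
have -> : c `^ (- (2 * r / d%:R)) = (c ^+ 2) `^ (- (r / d%:R)).
  by rewrite -powR_mulrn ?ltW// -powRrM; congr (_ `^ _); ring.
rewrite !powRN lef_pV2 ?posrE ?powR_gt0 ?exprn_gt0//.
by rewrite ge0_ler_powR ?nnegrE ?divr_ge0// ?exprn_ge0// ltW.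
Qed.

(** Finitely many frequencies have codes in a common cube, over which the sum of products is a
    product of sums. *)
Lemma sum_prod_uniq_le d (psi : nat -> R) (C : R) (s : seq 'rV[int]_d) :
  (forall c, 0 <= psi c) -> sum_bounded psi C -> uniq s ->
  \sum_(xi <- s) \prod_(j < d) psi (int_code (xi 0 j)) <= C ^+ d.
Proof.
move=> p0 pC us.
pose M := \max_(xi <- s) \max_(j < d) int_code (xi 0%R j).
pose h (xi : 'rV[int]_d) : {ffun 'I_d -> 'I_M.+1} :=
  [ffun j => inord (int_code (xi 0 j))].
have codeM (xi : 'rV[int]_d) (j : 'I_d) : xi \in s -> (int_code (xi 0%R j) < M.+1)%N.
  move=> xis; rewrite ltnS /M (big_rem _ xis)/= leq_max.
  by rewrite (bigD1 j)//= leq_maxl.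
have hinj : {in s &, injective h}.
  move=> x y xs ys /ffunP hxy; apply/rowP => j; apply: int_code_inj.
  have := hxy j; rewrite !ffunE => /(congr1 val) /=.
  by rewrite !inordK ?codeM.
have -> : \sum_(xi <- s) \prod_(j < d) psi (int_code (xi 0 j)) =
    \sum_(f <- map h s) \prod_(j < d) psi (f j).
  rewrite big_map; apply: eq_big_seq => xi xis; apply: eq_bigr => j _.
  by rewrite ffunE inordK ?codeM.
have um : uniq (map h s) by rewrite map_inj_in_uniq.
rewrite big_uniq//=.
apply: (@le_trans _ _ (\sum_(f : {ffun 'I_d -> 'I_M.+1}) \prod_(j < d) psi (f j))).
  rewrite big_mkcond; apply: ler_sum => f _; case: ifP => // _.
  by apply: prodr_ge0.
rewrite -(bigA_distr_bigA (fun _ (c : 'I_M.+1) => psi c)) prodr_const card_ord.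
have := pC M.+1; rewrite big_mkord => le1.
by apply: lerXn2r; rewrite ?nnegrE ?(le_trans _ le1) ?sumr_ge0.
Qed.

Lemma lattice_sum_bounded d (r : R) : (0 < d)%N -> d%:R / 2 < r ->
  exists S : R, forall s : seq 'rV[int]_d, uniq s ->
    \sum_(xi <- s) bessel_symbol xi `^ (- r) <= S.
Proof.
move=> d0 dr; have dR : 0 < d%:R :> R by rewrite ltr0n.
have r0 : 0 <= r by lra.
have p1 : 1 < 2 * r / d%:R by rewrite ltr_pdivlMr//; lra.
exists ((1 + (2 * r / d%:R - 1)^-1) ^+ d) => s us.
apply: le_trans (sum_prod_uniq_le _ _ _ _ (fun c => powR_ge0 _ _) (sum_powR_le _ p1) us).
by apply: ler_sum => xi _; exact: lattice_term_le.
Qed.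

End LatticeSum.

Lemma cvg_sum_seq {R : realType} {I : Type} (r : seq I) (u : I -> nat -> R) (l : I -> R) :
  (forall i, u i @ \oo --> l i) ->
  (fun N => \sum_(i <- r) u i N) @ \oo --> \sum_(i <- r) l i.
Proof.
move=> ul; elim: r => [|i r IH].
  rewrite big_nil (_ : (fun N => _) = cst 0); first exact: cvg_cst.
  by apply/funext => N; rewrite big_nil.
rewrite big_cons (_ : (fun N => _) = (fun N => u i N + \sum_(j <- r) u j N)).
  exact: cvgD.
by apply/funext => N; rewrite big_cons.
Qed.

Section FourierInversion.
Context {R : realType} {d : nat}.

(** Enumeration of the lattice by pickling. At a number that codes no frequency the default is 0,
    and [fourier_cos] and [fourier_sin] are set to 0 there, so frequency 0 is not counted again. *)
Definition freq (n : nat) : 'rV[int]_d := odflt 0 (pickle_inv n).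

Definition fourier_cos (f : 'rV[R]_d -> R) (n : nat) : R :=
  oapp (fun xi : 'rV[int]_d => torus_integral (fun x => f x * fcos xi x)) 0 (pickle_inv n).

Definition fourier_sin (f : 'rV[R]_d -> R) (n : nat) : R :=
  oapp (fun xi : 'rV[int]_d => torus_integral (fun x => f x * fsin xi x)) 0 (pickle_inv n).

Lemma sum_pickle (F : 'rV[int]_d -> R) (eta : 'rV[int]_d) M : (pickle eta < M)%N ->
  \sum_(0 <= n < M) oapp F 0 (pickle_inv n) * (freq n == eta)%:R = F eta.
Proof.
move=> eM; rewrite big_mkord (bigD1 (Ordinal eM))//= /freq pickleK_inv/= eqxx mulr1.
rewrite big1 ?addr0// => n; rewrite -val_eqE/= => ne.
have := pickle_invK (T:='rV[int]_d) n; case: (pickle_inv n) => [z|] /=; last by rewrite mul0r.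
move=> zn; case: eqP => [ze|_]; last by rewrite mulr0.
by move: ne; rewrite -zn ze eqxx.
Qed.

Lemma torus_integral_trig_series_approx (a b : nat -> R) B (g : 'rV[R]_d -> R) :
  trig_bounded a b B -> ucb g -> (forall x, `|g x| <= 1) ->
  forall e : R, 0 < e -> exists N, forall M, (N <= M)%N ->
    `|torus_integral (fun x => trig_series freq a b x * g x) -
      \sum_(0 <= n < M) (a n * torus_integral (fun x => fcos (freq n) x * g x) +
                         b n * torus_integral (fun x => fsin (freq n) x * g x))| <= e.
Proof.
move=> aB ug g1 e e0; have [N HN] := trig_series_approx freq _ _ _ aB _ e0.
exists N => M NM.
have uT : ucb (trig_series freq a b) by exact: ucb_trig_series aB.
have ut n : ucb (fun x => trig_term freq a b n x * g x).
  by apply: ucbM => //; exact: ucb_trig_term.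
have -> : \sum_(0 <= n < M) (a n * torus_integral (fun x => fcos (freq n) x * g x) +
    b n * torus_integral (fun x => fsin (freq n) x * g x)) =
    torus_integral (fun x => \sum_(0 <= n < M) trig_term freq a b n x * g x).
  rewrite torus_integral_sum//; apply: eq_bigr => n _.
  have uc : ucb (fun x => fcos (freq n) x * g x) by apply: ucbM => //; exact: ucb_fcos.
  have us : ucb (fun x => fsin (freq n) x * g x) by apply: ucbM => //; exact: ucb_fsin.
  rewrite -!torus_integralZ// -torus_integralD; [|exact: ucbZ|exact: ucbZ].
  by congr torus_integral; apply/funext => x; rewrite /trig_term; ring.
rewrite -torus_integralB; [|exact: ucbM|exact: ucb_sum].
apply: torus_integral_norm_le.
  by apply: ucbB; [exact: ucbM|exact: ucb_sum].
move=> x; rewrite -mulr_suml -mulrBl normrM -[leRHS]mulr1.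
by apply: ler_pM => //; exact: HN.
Qed.

(** The difference of the two sides has zero Fourier coefficients, by orthogonality. The
    coefficients carry no factor 2 because the series runs over both signs of every frequency. *)
Lemma fourier_inversion (f : 'rV[R]_d -> R) B : ucb f -> per f ->
  trig_bounded (fourier_cos f) (fourier_sin f) B ->
  f = trig_series freq (fourier_cos f) (fourier_sin f).
Proof.
move=> uf pf aB; apply/funext => x; apply/eqP; rewrite -subr_eq0; apply/eqP.
set a := fourier_cos f in aB *; set b := fourier_sin f in aB *.
set T := trig_series freq a b.
have uT : ucb T by exact: ucb_trig_series aB.
apply: (fourier_unique _ (fun x => f x - T x)) => {x} [||eta].
- exact: ucbB.
- by apply: (per_comp2 (fun u v => u - v)) => //; exact: per_trig_series.
have close (u v : R) : (forall e : R, 0 < e -> `|u - v| <= e) -> v = u.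
  move=> H; apply/eqP; rewrite eq_sym -subr_eq0 -normr_le0.
  by apply/ler_addgt0Pr => e /H; rewrite add0r.
have O n := torus_integral_fourier_orthogonality (R:=R) d (freq n) eta.
have uc := @ucb_fcos R d eta; have us := @ucb_fsin R d eta.
have c1 (x : 'rV[R]_d) : `|fcos eta x| <= 1 by exact: cos_max.
have s1 (x : 'rV[R]_d) : `|fsin eta x| <= 1 by exact: sin_max.
split.
- rewrite (_ : (fun x => _) = (fun x => f x * fcos eta x - T x * fcos eta x)); last first.
    by apply/funext => x; rewrite mulrBl.
  rewrite torus_integralB; [|exact: ucbM|exact: ucbM].
  apply/eqP; rewrite subr_eq0; apply/eqP; apply: close => e e0.
  have [N HN] := torus_integral_trig_series_approx _ _ _ _ aB uc c1 _ e0.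
  pose M := maxn N (maxn (pickle eta) (pickle (- eta))).+1.
  have := HN M (leq_maxl _ _).
  suff -> : \sum_(0 <= n < M) (a n * torus_integral (fun x => fcos (freq n) x * fcos eta x) +
      b n * torus_integral (fun x => fsin (freq n) x * fcos eta x)) =
      torus_integral (fun x => f x * fcos eta x) by [].
  have M1 : (pickle eta < M)%N by rewrite /M; lia.
  have M2 : (pickle (- eta) < M)%N by rewrite /M; lia.
  (* Exactly the ranks of [eta] and [- eta] contribute, each one half of the same coefficient; [M]
     exceeds both codes. *)
  transitivity (2^-1 * (\sum_(0 <= n < M) a n * (freq n == eta)%:R +
     \sum_(0 <= n < M) a n * (freq n == - eta)%:R)).
    rewrite -big_split mulr_sumr/=; apply: eq_bigr => n _.
    by have [-> -> _ _] := O n; ring.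
  rewrite !sum_pickle//.
  have -> : (fun x => f x * fcos (- eta) x) = (fun x => f x * fcos eta x).
    by apply/funext => x; rewrite /fcos frequency_dotN mulrN cosN.
  by lra.
- rewrite (_ : (fun x => _) = (fun x => f x * fsin eta x - T x * fsin eta x)); last first.
    by apply/funext => x; rewrite mulrBl.
  rewrite torus_integralB; [|exact: ucbM|exact: ucbM].
  apply/eqP; rewrite subr_eq0; apply/eqP; apply: close => e e0.
  have [N HN] := torus_integral_trig_series_approx _ _ _ _ aB us s1 _ e0.
  pose M := maxn N (maxn (pickle eta) (pickle (- eta))).+1.
  have := HN M (leq_maxl _ _).
  suff -> : \sum_(0 <= n < M) (a n * torus_integral (fun x => fcos (freq n) x * fsin eta x) +
      b n * torus_integral (fun x => fsin (freq n) x * fsin eta x)) =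
      torus_integral (fun x => f x * fsin eta x) by [].
  have M1 : (pickle eta < M)%N by rewrite /M; lia.
  have M2 : (pickle (- eta) < M)%N by rewrite /M; lia.
  transitivity (2^-1 * (\sum_(0 <= n < M) b n * (freq n == eta)%:R -
     \sum_(0 <= n < M) b n * (freq n == - eta)%:R)).
    rewrite -sumrB mulr_sumr/=; apply: eq_bigr => n _.
    by have [_ _ -> ->] := O n; ring.
  rewrite !sum_pickle//.
  have -> : (fun x => f x * fsin (- eta) x) = (fun x => - (f x * fsin eta x)).
    by apply/funext => x; rewrite /fsin frequency_dotN mulrN sinN mulrN.
  rewrite torus_integralN; last exact: ucbM.
  by lra.
Qed.

End FourierInversion.

Section ContinuousDifferentiability.
Context {R : realType} {d : nat}.

(* Functions on the torus all of whose partial derivatives of order at most m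
   exist, are continuous and are bounded by B. *)
Fixpoint Ck (m : nat) (B : R) (f : 'rV[R]_d -> R) : Prop :=
  [/\ ucb f, per f, forall x, `|f x| <= B &
    match m with
    | 0 => True
    | m'.+1 => (forall x v : 'rV[R]_d,
          is_derive x v f (\sum_(j < d) v 0 j * partial j f x)) /\
        forall j, Ck m' B (partial j f)
    end].

Let rho (n : nat) : R := Num.sqrt (bessel_symbol (@freq d n)).

Let rho_ge1 n : 1 <= rho n.
Proof.
rewrite /rho -sqrtr1 ler_sqrt ?bessel_symbol_ge1//; have := bessel_symbol_ge1 (R:=R) _ (@freq d n); lra.
Qed.

Let rho_ge n (j : 'I_d) : `|2 * pi * (freq n 0 j)%:~R| <= rho n.
Proof.
rewrite /rho -sqrtr_sqr ler_sqrt; last first.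
  by have := bessel_symbol_ge1 (R:=R) _ (@freq d n); lra.
rewrite /bessel_symbol (bigD1 j)//= addrCA lerDl addr_ge0// sumr_ge0// => i _.
exact: sqr_ge0.
Qed.

(** Each partial derivative multiplies a coefficient by at most [rho], so the weight [rho ^+ m] pays
    for [m] derivatives and the same [B] bounds them all. *)
Lemma trig_series_Ck m (a b : nat -> R) B :
  sum_bounded (fun n => rho n ^+ m * (`|a n| + `|b n|)) B ->
  Ck m B (trig_series freq a b).
Proof.
have tb (u w : nat -> R) p :
    sum_bounded (fun n => rho n ^+ p * (`|u n| + `|w n|)) B -> trig_bounded u w B.
  apply: sum_bounded_le => n; rewrite -[leLHS]mul1r ler_wpM2r//.
  exact: exprn_ege1.
elim: m a b => [|m IH] a b aB.
  by split => //; [exact: ucb_trig_series (tb _ _ _ aB)|exact: per_trig_series|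
    exact: trig_series_le (tb _ _ _ aB)].
have B1 (j : 'I_d) : sum_bounded (fun n => rho n ^+ m * (`|dcoef freq (delta_mx 0 j) 1 b n| +
     `|dcoef freq (delta_mx 0 j) (- 1) a n|)) B.
  apply: sum_bounded_le aB => n; rewrite exprSr -mulrA.
  apply: ler_wpM2l; first by rewrite exprn_ge0// (le_trans ler01).
  rewrite /dcoef frequency_dot_delta mul1r mulN1r mulNr normrN.
  rewrite (normrM _ (b n)) (normrM _ (a n)) -mulrDr addrC.
  by rewrite ler_wpM2r// addr_ge0.
have Bv (v : 'rV[R]_d) : trig_bounded (dcoef freq v 1 b) (dcoef freq v (- 1) a)
    ((\sum_(j < d) `|v 0 j|) * B).
  move=> N; apply: (@le_trans _ _ (\sum_(0 <= n < N) (\sum_(j < d) `|v 0 j|) *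
     (rho n ^+ m.+1 * (`|a n| + `|b n|)))); last first.
    by rewrite -mulr_sumr ler_wpM2l// sumr_ge0.
  apply: ler_sum => n _.
  have H : `|2 * pi * frequency_dot (freq n) v| <= (\sum_(j < d) `|v 0 j|) * rho n ^+ m.+1.
    rewrite /frequency_dot mulr_sumr mulr_suml.
    apply: le_trans (ler_norm_sum _ _ _) _; apply: ler_sum => j _.
    rewrite mulrA normrM mulrC ler_wpM2l//; apply: le_trans (rho_ge n j) _.
    rewrite -[leLHS]mul1r exprSr ler_wpM2r//; last exact: exprn_ege1.
    exact: le_trans (rho_ge1 n).
  rewrite /dcoef mul1r mulN1r mulNr normrN (normrM _ (b n)) (normrM _ (a n)) -mulrDr addrC.
  by rewrite mulrA ler_wpM2r.
have t := tb _ _ _ aB.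
have D x (v : 'rV[R]_d) := is_derive_trig_series freq a b _ _ x v t (Bv v).
have pE (j : 'I_d) : partial j (trig_series freq a b) =
    trig_series freq (dcoef freq (delta_mx 0 j) 1 b) (dcoef freq (delta_mx 0 j) (- 1) a).
  by apply/funext => x; rewrite /partial (is_derive_val (D x _)).
split.
- exact: ucb_trig_series t.
- exact: per_trig_series.
- exact: trig_series_le t.
- split; last by move=> j; rewrite pE; exact: IH.
  move=> x v; suff -> : \sum_(j < d) v 0 j * partial j (trig_series freq a b) x =
    trig_series freq (dcoef freq v 1 b) (dcoef freq v (- 1) a) x by exact: D.
  have C (u w : nat -> R) B0 : trig_bounded u w B0 ->
      series (fun n => trig_term freq u w n x) @ \oo --> trig_series freq u w x.
    move=> uw; apply/cvgrPdist_le => /= e e0.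
    have [N HN] := @trig_series_approx R d freq u w B0 uw e e0.
    by exists N => // M NM; exact: HN.
  (* Linearity of the derivative in the direction [v] holds for the partial sums; uniqueness of
     limits transfers it to the series. *)
  apply: (@cvg_unique _ _ (series (fun n => trig_term freq (dcoef freq v 1 b)
     (dcoef freq v (- 1) a) n x) @ \oo)) => //; last exact: C (Bv v).
  have -> : series (fun n => trig_term freq (dcoef freq v 1 b) (dcoef freq v (- 1) a) n x)
    = (fun N => \sum_(j < d) v 0 j * series (fun n => trig_term freq
       (dcoef freq (delta_mx 0 j) 1 b) (dcoef freq (delta_mx 0 j) (- 1) a) n x) N).
    apply/funext => N; rewrite /series/=.
    under [in RHS]eq_bigr do rewrite mulr_sumr.
    rewrite exchange_big/=; apply: eq_bigr => n _.
    rewrite /trig_term /dcoef /frequency_dot !mulr_sumr !mulr_suml -big_split/=.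
    apply: eq_bigr => j _; rewrite -/(frequency_dot _ _) frequency_dot_delta; ring.
  have Cj j : v 0 j * series (fun n => trig_term freq
       (dcoef freq (delta_mx 0 j) 1 b) (dcoef freq (delta_mx 0 j) (- 1) a) n x) N
      @[N --> \oo] --> v 0 j * partial j (trig_series freq a b) x.
    rewrite pE; apply: cvgM; first exact: cvg_cst.
    by apply: (C _ _ B); exact: (tb _ _ m (B1 j)).
  exact: cvg_sum_seq Cj.
Qed.

End ContinuousDifferentiability.

Section SobolevEmbedding.
Context {R : realType} {d : nat}.

Definition sobolev_sqr (k : R) (f : 'rV[R]_d -> R) : \bar R :=
  (\esum_(xi in [set: 'rV[int]_d]) (bessel_symbol xi `^ k * fourier_sqr f xi)%:E)%E.

Lemma uniq_sum_le_esum (I : choiceType) (F : I -> R) (B : R) (s : seq I) : uniq s ->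
  (\esum_(i in [set: I]) (F i)%:E <= B%:E)%E -> \sum_(i <- s) F i <= B.
Proof.
move=> us FB; rewrite -lee_fin; apply: le_trans FB; apply: esum_ge.
exists [set` s]; first by split => //; exact: finite_seq.
by rewrite -fsbig_seq// sumEFin.
Qed.

(** The inequality [p q <= p^2 / (2 mu) + mu q^2 / 2] for [p = s^(k/2) |c|] and [q = s^(-(k-3)/2)].
    Summed over the lattice it plays the part of Cauchy-Schwarz, with [mu] left free. *)
Lemma weighted_am_gm (s k c mu : R) : 1 <= s -> 0 < mu ->
  Num.sqrt s ^+ 3 * `|c| <= (s `^ k * c ^+ 2) / (2 * mu) + mu / 2 * s `^ (- (k - 3)).
Proof.
move=> s1 mu0; have s0 : 0 < s by lra.
pose p := s `^ (k / 2) * `|c|; pose q := s `^ (- (k - 3) / 2).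
have sn0 : s != 0 by rewrite gt_eqF.
have pq : Num.sqrt s ^+ 3 * `|c| = p * q.
  rewrite /p /q [RHS]mulrAC -powRD; last by rewrite sn0 implybT.
  rewrite -powR12_sqrt ?ltW//.
  by rewrite -powR_mulrn ?powR_ge0// -powRrM; congr (_ `^ _ * _); field.
have p2 : s `^ k * c ^+ 2 = p ^+ 2.
  rewrite /p exprMn real_normK ?num_real// -(powR_mulrn 2 (powR_ge0 s _)) -powRrM.
  by congr (_ `^ _ * _); field.
have q2 : s `^ (- (k - 3)) = q ^+ 2.
  by rewrite /q -powR_mulrn ?powR_ge0// -powRrM; congr (_ `^ _); field.
rewrite pq p2 q2 -subr_ge0.
have -> : p ^+ 2 / (2 * mu) + mu / 2 * q ^+ 2 - p * q = (p - mu * q) ^+ 2 / (2 * mu).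
  by field; rewrite gt_eqF.
by rewrite divr_ge0 ?sqr_ge0// mulr_ge0// ltW.
Qed.

(** Three derivatives cost [symbol^(3/2)], and [k - 3 > d/2] makes the remaining lattice sum [S]
    finite. Since [mu] is free, a small Sobolev norm gives a small bound in [C^3]: first [mu] is
    chosen small, then [B] small compared with [mu]. *)
Lemma sobolev_Ck (k : R) : (0 < d)%N -> d%:R / 2 + 3 < k ->
  exists2 S : R, 0 <= S & forall (f : 'rV[R]_d -> R) (B mu : R),
    continuous f -> per f -> (sobolev_sqr k f <= B%:E)%E -> 0 < mu ->
    Ck 3 (B / mu + mu * S) f.
Proof.
move=> d0 dk; have dk3 : d%:R / 2 < k - 3 by lra.
have [S HS] := @lattice_sum_bounded R d (k - 3) d0 dk3.
have S0 : 0 <= S by have := HS [::] isT; rewrite big_nil.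
exists S; first exact: S0.
move=> f B mu cf pf fB mu0.
have uf : ucb f by exact: per_ucb.
have bd : sum_bounded (fun n => Num.sqrt (bessel_symbol (@freq d n)) ^+ 3 *
    (`|fourier_cos f n| + `|fourier_sin f n|)) (B / mu + mu * S).
  pose G (xi : 'rV[int]_d) : R := bessel_symbol xi `^ k * fourier_sqr f xi / mu +
    mu * bessel_symbol xi `^ (- (k - 3)).
  apply: (@sum_bounded_le _ _ (fun n => oapp G 0 (pickle_inv n))).
    move=> n; rewrite /freq /fourier_cos /fourier_sin.
    case: (pickle_inv n) => [xi|] /=; last by rewrite normr0 addr0 mulr0.
    set s : R := bessel_symbol xi; set a := torus_integral _; set b := torus_integral _.
    have s1 : 1 <= s by exact: bessel_symbol_ge1.
    have -> : G xi = (s `^ k * a ^+ 2) / (2 * mu) + mu / 2 * s `^ (- (k - 3)) +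
       ((s `^ k * b ^+ 2) / (2 * mu) + mu / 2 * s `^ (- (k - 3))) +
       (s `^ k * (a ^+ 2 + b ^+ 2)) / (2 * mu).
      by rewrite /G /fourier_sqr -/s -/a -/b; field; rewrite gt_eqF.
    rewrite mulrDr -[leLHS]addr0; apply: lerD; last first.
      by rewrite divr_ge0 ?mulr_ge0 ?powR_ge0 ?addr_ge0 ?sqr_ge0// ltW.
    by apply: lerD; exact: weighted_am_gm.
  move=> N; rewrite -(big_pmap pickle_inv) big_split/=.
  have us : uniq (pmap (@pickle_inv 'rV[int]_d) (index_iota 0 N)).
    by apply: pmap_uniq (@pickle_invK _) _ _; exact: iota_uniq.
  apply: lerD; last by rewrite -mulr_sumr ler_pM2l//; exact: HS.
  by rewrite -mulr_suml ler_pM2r ?invr_gt0//; exact: uniq_sum_le_esum.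
have tb : trig_bounded (fourier_cos f) (fourier_sin f) (B / mu + mu * S).
  apply: sum_bounded_le bd => n; rewrite -[leLHS]mul1r ler_wpM2r//.
  apply: exprn_ege1; rewrite -sqrtr1 ler_sqrt ?bessel_symbol_ge1//.
  by have := @bessel_symbol_ge1 R d (freq n); lra.
by rewrite (fourier_inversion _ _ uf pf tb); exact: trig_series_Ck.
Qed.

End SobolevEmbedding.

(** * Regularity and uniqueness of solutions *)

Section TimeDependent.
Context {R : realType} {d : nat}.
Implicit Types (F G : R -> 'rV[R]_d -> R).

(* F is a continuous curve in the space of continuous functions on the torus. *)
Definition tuc F : Prop :=
  [/\ forall t, ucb (F t), forall t, per (F t) &
    forall t e : R, 0 < e -> exists2 r : R, 0 < r & forall s : R, `|s - t| < r ->
      forall x, `|F s x - F t x| <= e].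

Lemma tuc_cst (c : R) : tuc (fun _ _ => c).
Proof.
split => // [t|t e e0]; first exact: ucb_cst.
by exists 1 => // s _ x; rewrite subrr normr0 ltW.
Qed.

Lemma tucD F G : tuc F -> tuc G -> tuc (fun t x => F t x + G t x).
Proof.
move=> [uF pF cF] [uG pG cG]; split.
- by move=> t; exact: ucbD.
- by move=> t; exact: (per_comp2 +%R).
- move=> t e e0; have e20 : 0 < e / 2 by lra.
  have [r r0 Hr] := cF t _ e20; have [q q0 Hq] := cG t _ e20.
  exists (Num.min r q); first by rewrite lt_min r0.
  move=> s; rewrite lt_min => /andP[/Hr sr /Hq sq] x.
  by have := sr x; have := sq x; rewrite !ler_norml; lra.
Qed.

Lemma tucM F G : tuc F -> tuc G -> tuc (fun t x => F t x * G t x).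
Proof.
move=> [uF pF cF] [uG pG cG]; split.
- by move=> t; exact: ucbM.
- by move=> t; exact: (per_comp2 *%R).
- move=> t e e0; have [[M HM] _] := uF t; have [[N HN] _] := uG t.
  have M0 : 0 <= M := le_trans (normr_ge0 _) (HM 0).
  have N0 : 0 <= N := le_trans (normr_ge0 _) (HN 0).
  pose K := M + N + 2.
  have K0 : 0 < K by rewrite /K; lra.
  have eK : 0 < Num.min 1 (e / K) by rewrite lt_min ltr01 divr_gt0.
  have [r r0 Hr] := cF t _ eK; have [q q0 Hq] := cG t _ eK.
  exists (Num.min r q); first by rewrite lt_min r0.
  move=> s; rewrite lt_min => /andP[/Hr sr /Hq sq] x.
  have {}sr := sr x; have {}sq := sq x.
  set a := Num.min _ _ in eK sr sq.
  have a1 : a <= 1 by rewrite ge_min lexx.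
  have aK : a * K <= e by rewrite -ler_pdivlMr// ge_min lexx orbT.
  have -> : F s x * G s x - F t x * G t x = (F s x - F t x) * G t x +
     (F t x + (F s x - F t x)) * (G s x - G t x) by ring.
  apply: (le_trans (ler_normD _ _)); rewrite !normrM.
  have h1 : `|F s x - F t x| * `|G t x| <= a * N by rewrite ler_pM.
  have h2 : `|F t x + (F s x - F t x)| * `|G s x - G t x| <= (M + 1) * a.
    apply: ler_pM => //; apply: (le_trans (ler_normD _ _)).
    by apply: lerD => //; exact: le_trans sr a1.
  by apply: (le_trans (lerD h1 h2)); apply: le_trans aK; rewrite /K; nra.
Qed.

Lemma tucZ (c : R) F : tuc F -> tuc (fun t x => c * F t x).
Proof. by move=> tF; apply: tucM => //; exact: tuc_cst. Qed.

Lemma eq_tuc F G : (forall t x, F t x = G t x) -> tuc F -> tuc G.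
Proof. by move=> FG; have -> // : F = G by apply/funext => t; apply/funext => x. Qed.

Lemma tucN F : tuc F -> tuc (fun t x => - F t x).
Proof.
by move=> tF; apply: (eq_tuc (fun t x => -1 * F t x)) => [t x|]; [rewrite mulN1r|exact: tucZ].
Qed.

Lemma tucX F n : tuc F -> tuc (fun t x => F t x ^+ n).
Proof.
move=> tF; elim: n => [|n IH].
  by apply: (eq_tuc (fun _ _ => 1)) => //; exact: tuc_cst.
by apply: (eq_tuc (fun t x => F t x * F t x ^+ n)) => [t x|]; [rewrite exprS|exact: tucM].
Qed.

Lemma tuc_sum (I : Type) (r : seq I) (F : I -> R -> 'rV[R]_d -> R) :
  (forall i, tuc (F i)) -> tuc (fun t x => \sum_(i <- r) F i t x).
Proof.
move=> tF; elim: r => [|i r IH].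
  by apply: (eq_tuc (fun _ _ => 0)) => [t x|]; [rewrite big_nil|exact: tuc_cst].
by apply: (eq_tuc (fun t x => F i t x + \sum_(j <- r) F j t x)) => [t x|];
  [rewrite big_cons|exact: tucD].
Qed.

Lemma tuc_shift F z : tuc F -> tuc (fun t x => F t (x + z)).
Proof.
move=> [uF pF cF]; split.
- by move=> t; exact: ucb_shift.
- by move=> t; exact: per_shift.
- by move=> t e /(cF t)[r r0 Hr]; exists r => // s /Hr sr x; exact: sr.
Qed.

Lemma tuc_bounded F T : tuc F -> exists2 M : R, 0 <= M &
  forall t, 0 <= t <= T -> forall x, `|F t x| <= M.
Proof.
move=> [uF pF cF].
have [M HM] : exists M : R, forall t, `[0, T]%classic t -> forall x, `|F t x| <= M.
  pose P (t : R) (M : R) := forall x, `|F t x| <= M.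
  have := @segment_compact R 0 T; rewrite compact_near_coveringP.
  move=> /(_ _ +oo (fun M t => P t M) _) H.
  have : \forall M \near +oo, `[0, T]%classic `<=` (fun t => P t M).
    apply: H => t _; have [[N HN] _] := uF t; have [r r0 Hr] := cF t 1 ltr01.
    exists ([set s : R | `|t - s| < r], [set M : R | N + 1 < M]).
      split; first exact: nbhs_dist_lt.
      by apply: nbhs_pinfty_gt; exact: num_real.
    move=> [s M] /= [ts NM] x; rewrite distrC in ts.
    by have := Hr s ts x; have := HN x; rewrite !ler_norml; lra.
  by move=> /filter_ex [M HM]; exists M.
exists (Num.max 0 M); first by rewrite le_max lexx.
by move=> t tT x; rewrite le_max HM ?orbT//= in_itv.
Qed.

(** Continuous curves in the space [C^m] of the torus, parametrised by all real times so that no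
    endpoint intervenes. *)
Fixpoint tC (m : nat) F : Prop :=
  tuc F /\ match m with
  | 0 => True
  | m'.+1 => (forall t (x v : 'rV[R]_d),
        is_derive x v (F t) (\sum_(j < d) v 0 j * partial j (F t) x)) /\
      forall j, tC m' (fun t => partial j (F t))
  end.

Lemma tC_tuc m F : tC m F -> tuc F.
Proof. by case: m => [[]|m []]. Qed.

Lemma partial_tC m F t (x : 'rV[R]_d) j : tC m.+1 F ->
  is_derive x (delta_mx 0 j) (F t) (partial j (F t) x).
Proof.
move=> [_ [/(_ t x (delta_mx 0 j)) H _]]; rewrite /partial.
by have [dF _] := H; exact: derivableP.
Qed.

Lemma tCS m F : tC m.+1 F -> tC m F.
Proof.
elim: m F => [|m IH] F [tF [dF HF]]; first by split.
by split => //; split => // j; exact: IH.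
Qed.

Lemma tC_partial m F j : tC m.+1 F -> tC m (fun t => partial j (F t)).
Proof. by move=> [_ [_ /(_ j)]]. Qed.

Lemma tC_lin m F G (a b : R) : tC m F -> tC m G -> tC m (fun t x => a * F t x + b * G t x).
Proof.
elim: m F G => [|m IH] F G.
  by move=> [tF _] [tG _]; split => //; apply: tucD; exact: tucZ.
move=> tF tG; split.
  by apply: tucD; apply: tucZ; [exact: tC_tuc tF|exact: tC_tuc tG].
have D t (x v : 'rV[R]_d) (p q : R) : is_derive x v (F t) p -> is_derive x v (G t) q ->
    is_derive x v (fun x => a * F t x + b * G t x) (a * p + b * q).
  by move=> Dp Dq; apply: (@is_deriveD _ _ _ (a \*: F t) (b \*: G t)); apply: is_deriveZ.
have pE j t : partial j (fun x => a * F t x + b * G t x) =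
    (fun x => a * partial j (F t) x + b * partial j (G t) x).
  apply/funext => x; apply: is_derive_val; apply: D; [exact: partial_tC tF|exact: partial_tC tG].
split.
- move=> t x v; have [_ [dF _]] := tF; have [_ [dG _]] := tG.
  have := D _ _ _ _ _ (dF t x v) (dG t x v); congr is_derive.
  rewrite !mulr_sumr -big_split/=; apply: eq_bigr => j _; rewrite pE; ring.
- move=> j; under eq_fun do rewrite pE.
  by apply: (IH (fun t => partial j (F t)) (fun t => partial j (G t))); exact: tC_partial.
Qed.

Lemma eq_tC m F G : (forall t x, F t x = G t x) -> tC m F -> tC m G.
Proof. by move=> FG; have -> // : F = G by apply/funext => t; apply/funext => x. Qed.

Lemma tCB m F G : tC m F -> tC m G -> tC m (fun t x => F t x - G t x).
Proof.
move=> tF tG; apply: (eq_tC _ (fun t x => 1 * F t x + (-1) * G t x)) => [t x|].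
  by rewrite mul1r mulN1r.
exact: tC_lin.
Qed.

Lemma tC_cst m (c : R) : tC m (fun _ _ => c).
Proof.
elim: m c => [|m IH] c; split => //; try exact: tuc_cst.
have pE j : partial j (fun _ : 'rV[R]_d => c) = (fun=> 0).
  by apply/funext => x; apply: is_derive_val; exact: is_derive_cst.
split; last by move=> j; under eq_fun do rewrite pE; exact: IH.
move=> t x v; rewrite big1; first exact: is_derive_cst.
by move=> j _; rewrite pE mulr0.
Qed.

Lemma tC_sum m (I : Type) (r : seq I) (F : I -> R -> 'rV[R]_d -> R) :
  (forall i, tC m (F i)) -> tC m (fun t x => \sum_(i <- r) F i t x).
Proof.
move=> tF; elim: r => [|i r IH].
  by apply: (eq_tC _ (fun _ _ => 0)) => [t x|]; [rewrite big_nil|exact: tC_cst].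
apply: (eq_tC _ (fun t x => 1 * F i t x + 1 * \sum_(j <- r) F j t x)) => [t x|].
  by rewrite big_cons !mul1r.
exact: tC_lin.
Qed.

Lemma tC_shift m F z : tC m F -> tC m (fun t x => F t (x + z)).
Proof.
elim: m F => [|m IH] F tF.
  by split => //; apply: tuc_shift; exact: tC_tuc tF.
split; first by apply: tuc_shift; exact: tC_tuc tF.
have pE t j : partial j (fun x => F t (x + z)) = (fun x => partial j (F t) (x + z)).
  by apply/funext => x; exact: derive_translate.
split.
- move=> t x v; under eq_bigr do rewrite pE.
  by apply: is_derive_translate; have [_ [dF _]] := tF; exact: dF.
- move=> j; under eq_fun do rewrite pE.
  by apply: (IH (fun t => partial j (F t))); exact: tC_partial.
Qed.

Lemma tC_Ck m F : (forall t, exists B, Ck m B (F t)) ->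
  (forall t e : R, 0 < e -> exists2 r : R, 0 < r & forall s : R, `|s - t| < r ->
     Ck m e (fun x => F s x - F t x)) -> tC m F.
Proof.
have tucH m' F' : (forall t, exists B, Ck m' B (F' t)) ->
    (forall t e : R, 0 < e -> exists2 r : R, 0 < r & forall s : R, `|s - t| < r ->
       Ck m' e (fun x => F' s x - F' t x)) -> tuc F'.
  move=> H1 H2; split.
  - by move=> t; have [B] := H1 t; case: m' {H1 H2} => [|m'] [].
  - by move=> t; have [B] := H1 t; case: m' {H1 H2} => [|m'] [].
  - move=> t e /(H2 t)[r r0 Hr]; exists r => // s /Hr.
    by case: m' {H1 H2 Hr} => [|m'] [].
elim: m F => [|m IH] F H1 H2; first by split => //; exact: tucH H1 H2.
split; first exact: tucH H1 H2.
have dF t (x v : 'rV[R]_d) :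
    is_derive x v (F t) (\sum_(j < d) v 0 j * partial j (F t) x).
  by have [B [_ _ _ [H _]]] := H1 t; exact: H.
have dP t x j : is_derive x (delta_mx 0 j) (F t) (partial j (F t) x).
  by have [D _] := dF t x (delta_mx 0 j); exact: derivableP.
split => // j; apply: IH.
- by move=> t; have [B [_ _ _ [_ H]]] := H1 t; exists B; exact: H.
- move=> t e /(H2 t)[r r0 Hr]; exists r => // s /Hr [_ _ _ [_ /(_ j)]].
  have -> // : partial j (fun x => F s x - F t x) =
    (fun x => partial j (F s) x - partial j (F t) x).
  by apply/funext => x; apply: is_derive_val; apply: is_deriveB.
Qed.

End TimeDependent.

Section SmoothSolutions.
Context {R : realType} {d : nat}.
Implicit Types (w : R -> 'rV[R]_d -> 'rV[R]_d) (f : 'rV[R]_d -> 'rV[R]_d).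

Lemma Ck_le m (B B' : R) (f : 'rV[R]_d -> R) : B <= B' -> Ck m B f -> Ck m B' f.
Proof.
move=> BB'; elim: m f => [|m IH] f [uf pf fB H].
  by split => // x; exact: le_trans (fB x) BB'.
split => // [x|]; first exact: le_trans (fB x) BB'.
by have [dF HF] := H; split => // j; exact: IH _ (HF j).
Qed.

Lemma sobolev_sqr_ge0 k (f : 'rV[R]_d -> R) : (0 <= sobolev_sqr k f)%E.
Proof.
apply: esum_ge0 => xi _; rewrite lee_fin mulr_ge0 ?powR_ge0//.
by rewrite addr_ge0 ?sqr_ge0.
Qed.

Lemma sobolev_sqr_component_le k f i :
  (sobolev_sqr k (component f i) <= \sum_(j < d) sobolev_sqr k (component f j))%E.
Proof.
rewrite (bigD1 i)//= leeDl// sume_ge0// => j _; exact: sobolev_sqr_ge0.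
Qed.

Lemma sobolev_sqr_lty k f i : (sobolev_norm k f < +oo)%E ->
  exists B : R, (sobolev_sqr k (component f i) <= B%:E)%E.
Proof.
move=> fk; have : (\sum_(j < d) sobolev_sqr k (component f j) < +oo)%E.
  by apply: lty_poweRy fk; rewrite invr_eq0.
move=> /(le_lt_trans (sobolev_sqr_component_le k f i)) lty.
exists (fine (sobolev_sqr k (component f i))); rewrite fineK//.
by rewrite ge0_fin_numE// sobolev_sqr_ge0.
Qed.

Lemma sobolev_sqr_small k f i (e : R) : 0 <= e -> (sobolev_norm k f <= e%:E)%E ->
  (sobolev_sqr k (component f i) <= (e ^+ 2)%:E)%E.
Proof.
move=> e0 fe; apply: le_trans (sobolev_sqr_component_le k f i) _.
set S := (\sum_(j < d) _)%E.
have S0 : (0 <= S)%E by apply: sume_ge0 => j _; exact: sobolev_sqr_ge0.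
have -> : S = ((S `^ 2^-1) `^ 2)%E by rewrite -poweRrM mulVf// poweRe1.
rewrite -powR_mulrn// -poweR_EFin.
by apply: gt0_ler_poweR; rewrite ?in_itv/= ?leey ?andbT ?lee_fin ?poweR_ge0.
Qed.

Lemma continuous_component f i : continuous f -> continuous (component f i).
Proof.
move=> cf x; apply: (@cvg_comp _ _ _ f (fun M : 'rV[R]_d => M 0 i) _ (nbhs (f x))).
  exact: cf.
exact: coord_continuous.
Qed.

Lemma EP_solution_tC k u0 (u : R -> 'rV[R]_d -> 'rV[R]_d) : (0 < d)%N ->
  d%:R / 2 + 3 < k -> (forall T : R, 0 < T -> EP_solution k u0 T u) ->
  forall i, tC 3 (fun t => component (u `|t|) i).
Proof.
move=> d0 dk sol i; have [S S0 HS] := @sobolev_Ck R d k d0 dk.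
have reg t : 0 <= t -> sobolev k (u t) /\
    sobolev_norm k (u s \- u t) @[s --> within `[0, t + 1] (nbhs t)] --> 0%E.
  move=> t0; have [|cs _ _] := sol (t + 1); first lra.
  by apply: cs; rewrite in_itv/=; lra.
have pc f : torus_periodic f -> per (component f i).
  by move=> pf j x; rewrite /component (pf j x).
apply: tC_Ck => [t|t e e0].
  have [[cu pu nu] _] := reg `|t| (normr_ge0 _).
  have [B HB] := sobolev_sqr_lty k _ i nu.
  exists (B / 1 + 1 * S); apply: HS => //; first exact: continuous_component.
  exact: pc.
have [[cu pu nu] cvgt] := reg `|t| (normr_ge0 _).
(* The two halves of the bound of [sobolev_Ck] are to be at most [e / 2]: [mu * S] by this choice,
   [B / mu] by the next. The threshold [del] on the Sobolev norm is capped at 1 so that its square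
   is at most [B]. *)
pose mu := e / (2 * (S + 1)).
have mu0 : 0 < mu by rewrite divr_gt0//; lra.
pose B := e * mu / 2.
have B0 : 0 < B by rewrite /B divr_gt0// mulr_gt0.
pose del := Num.min 1 B.
have del0 : 0 < del by rewrite lt_min ltr01.
have delB : del ^+ 2 <= B.
  have d1 : del <= 1 by rewrite ge_min lexx.
  have dB : del <= B by rewrite ge_min lexx orbT.
  by rewrite expr2 -[leRHS]mul1r ler_pM// ltW.
have : \forall s \near within `[0, `|t| + 1] (nbhs `|t|),
    (sobolev_norm k (u s \- u `|t|)%R < del%:E)%E.
  by apply: (cvgt [set y | (y < del%:E)%E]); apply: open_ereal_lt'; rewrite lte_fin.
rewrite near_withinE => /nbhs_distP[r r0 Hr].
exists (Num.min r 1); first by rewrite lt_min r0 ltr01.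
move=> s; rewrite lt_min => /andP[sr s1].
have st : `| `|t| - `|s| | <= `|s - t|.
  by rewrite distrC; exact: ler_dist_dist.
have sI : `[0, `|t| + 1]%classic `|s|.
  by move: st; rewrite /= in_itv/= normr_ge0/= ler_norml; lra.
have := Hr `|s| (le_lt_trans st sr) sI => small.
have [[cus pus nus] _] := reg `|s| (normr_ge0 _).
apply: (@Ck_le _ (B / mu + mu * S)).
  have -> : B / mu = e / 2 by rewrite /B; field; rewrite gt_eqF.
  have -> : mu * S = e / 2 * (S / (S + 1)) by rewrite /mu; field; lra.
  have : S / (S + 1) <= 1 by rewrite ler_pdivrMr; lra.
  have e2 : 0 <= e / 2 by lra.
  by move=> /(ler_wpM2l e2); lra.
have E : (fun x => component (u `|s|) i x - component (u `|t|) i x) =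
    component (u `|s| \- u `|t|) i.
  by apply/funext => x; rewrite /component !mxE.
rewrite E; apply: HS => //.
- apply: continuous_component => x; exact: (@continuousB _ _ _ (u `|s|) (u `|t|) x (cus x) (cu x)).
- by rewrite -E; apply: (per_comp2 (fun a b => a - b)); exact: pc.
- apply: le_trans (_ : ((del ^+ 2)%:E <= _)%E); last by rewrite lee_fin.
  by apply: sobolev_sqr_small; [exact: ltW|exact: ltW].
Qed.

(** All that is used of a solution from here on: a continuous curve in [C^3] whose momentum
    satisfies the equation at positive times with a derivative uniform in space. Translation in
    space preserves this notion. *)
Definition smooth_EP w : Prop :=
  (forall i, tC 3 (fun t => component (w t) i)) /\
  forall (t : R) i, 0 < t -> udiff (fun s => momentum (w s) i) t
    (fun x => - EP_nonlinearity (w t) i x).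

Lemma tC_laplacian m w i : tC m.+2 (fun t => component (w t) i) ->
  tC m (fun t => laplacian (component (w t) i)).
Proof.
move=> tw; apply: (eq_tC _ (fun t x => \sum_(j < d) partial j (partial j (component (w t) i)) x)) => //.
apply: tC_sum => j.
apply: (tC_partial _ (fun t => partial j (component (w t) i))).
exact: (tC_partial _ (fun t => component (w t) i)).
Qed.

Lemma tC_momentum w i : (forall i, tC 3 (fun t => component (w t) i)) ->
  tC 1 (fun t => momentum (w t) i).
Proof.
move=> tw; apply: tCB; last exact: tC_laplacian.
exact/tCS/tCS.
Qed.

Lemma tuc_EP_nonlinearity w i : (forall i, tC 3 (fun t => component (w t) i)) ->
  tuc (fun t => EP_nonlinearity (w t) i).
Proof.
move=> tw; have tm j := tC_momentum w j tw.
have tuw j := tC_tuc _ _ (tw j); have tum j := tC_tuc _ _ (tm j).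
have tpw j l := tC_tuc _ _ (tC_partial _ _ l (tw j)).
have tpm j l := tC_tuc _ _ (tC_partial _ _ l (tm j)).
apply: tucD; first apply: tucD.
- by apply: tuc_sum => j; exact: tucM (tuw j) (tpm i j).
- by apply: tuc_sum => j; exact: tucM (tum j) (tpw j i).
- by apply: tucM (tum i) _; apply: tuc_sum => j; exact: (tpw j j).
Qed.

(* The even extension to negative times spares one-sided limits at t = 0. *)
Lemma EP_solution_smooth k u0 (u : R -> 'rV[R]_d -> 'rV[R]_d) : (0 < d)%N ->
  d%:R / 2 + 3 < k -> (forall T : R, 0 < T -> EP_solution k u0 T u) ->
  smooth_EP (fun t => u `|t|).
Proof.
move=> d0 dk sol; have tu := EP_solution_tC k u0 u d0 dk sol.
split => // t i t0.
apply: (is_derive_udiff _ (fun s x => - EP_nonlinearity (u `|s|) i x) t t) => //.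
- move=> s x st.
  have s0 : 0 < s by move: st; rewrite ltr_norml; lra.
  have s2 : s < 2 * t by move: st; rewrite ltr_norml; lra.
  have [|_ _ H] := sol (2 * t); first lra.
  have := H s _ i x; rewrite in_itv/= s0 s2 => /(_ isT) D.
  rewrite (gtr0_norm s0); apply: near_eq_is_derive D.
  near=> r; rewrite gtr0_norm//; near: r; exact: lt_nbhsr.
- have [_ _ H] := tucN _ (tuc_EP_nonlinearity _ i tu); exact: H.
Unshelve. all: by end_near. Qed.

Definition translate {T : Type} (z : 'rV[R]_d) (f : 'rV[R]_d -> T) : 'rV[R]_d -> T :=
  fun x => f (x + z).

Lemma partial_translate z j (f : 'rV[R]_d -> R) :
  partial j (translate z f) = translate z (partial j f).
Proof. by apply/funext => x; exact: derive_translate. Qed.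

Lemma component_translate z f i : component (translate z f) i = translate z (component f i).
Proof. by []. Qed.

Lemma laplacian_translate z (f : 'rV[R]_d -> R) :
  laplacian (translate z f) = translate z (laplacian f).
Proof.
apply/funext => x; rewrite {1}/laplacian.
by under eq_bigr do rewrite !partial_translate.
Qed.

Lemma momentum_translate z f i : momentum (translate z f) i = translate z (momentum f i).
Proof.
by apply/funext => x; rewrite {1}/momentum component_translate laplacian_translate.
Qed.

Lemma EP_nonlinearity_translate z f i :
  EP_nonlinearity (translate z f) i = translate z (EP_nonlinearity f i).
Proof.
apply/funext => x; rewrite {1}/EP_nonlinearity.
under eq_bigr do rewrite momentum_translate partial_translate component_translate.
under [X in _ + X + _]eq_bigr do rewrite momentum_translate component_translate partial_translate.
under [X in _ + _ * X]eq_bigr do rewrite component_translate partial_translate.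
by rewrite momentum_translate.
Qed.

Lemma smooth_EP_translate w z : smooth_EP w -> smooth_EP (fun t => translate z (w t)).
Proof.
move=> [tw dw].
split => [i|t i t0]; first exact: (tC_shift _ (fun t => component (w t) i)).
move=> e /(dw t i t0)[r r0 Hr]; exists r => // s /Hr sr x.
rewrite !momentum_translate EP_nonlinearity_translate; exact: sr.
Qed.

End SmoothSolutions.

Section Gronwall.
Context {R : realType}.

Lemma norm_sum_le (d : nat) (a : 'I_d -> R) (K : R) : (forall j, `|a j| <= K) ->
  `|\sum_(j < d) a j| <= d%:R * K.
Proof.
move=> aK; apply: le_trans (ler_norm_sum _ _ _) _.
by rewrite mulr_natl -[in leRHS](card_ord d) -sumr_const; apply: ler_sum.
Qed.

Lemma gronwall_le0 (N dN : R -> R) (C T : R) : 0 < T ->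
  (forall t : R, 0 <= t <= T -> {for t, continuous N}) ->
  (forall t : R, 0 < t < T -> is_derive t 1 N (dN t)) ->
  (forall t, 0 < t < T -> dN t <= C * N t) -> N 0 = 0 -> N T <= 0.
Proof.
move=> T0 cN dNd dNle N0.
pose E (t : R) := expR (- C * t).
have dE (t : R) : is_derive t 1 E (- C * E t).
  have D := is_derive_affine 0 (- C) t.
  have -> : E = expR \o (fun s => 0 + s * - C).
    by apply/funext => s /=; rewrite add0r mulrC.
  by apply: is_derive_eq; rewrite /E /= add0r mulrC [t * _]mulrC.
have H : N T * E T <= N 0 * E 0.
  apply: (@nonincreasing_is_derive _ (fun t => N t * E t)
    (fun t => N t * (- C * E t) + E t * dN t)) => //; first exact: ltW.
  - move=> t tT; apply: cvgM; first exact: cN.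
    exact: is_derive_continuous (dE t).
  - by move=> t tT; have D1 := dNd t tT; have D2 := dE t; apply: is_deriveM.
  - move=> t tT; have := dNle t tT; have : 0 <= E t by exact: expR_ge0.
    by move=> e0 /(ler_wpM2l e0); lra.
move: H; rewrite N0 mul0r => H.
by rewrite -(@ler_pM2r _ (E T)) ?expR_gt0// mul0r.
Qed.

End Gronwall.

(** * Energy estimate for the difference of two solutions *)

Section Uniqueness.
Context {R : realType} {d : nat}.
Implicit Types (F G : R -> 'rV[R]_d -> R).

Lemma finite_tuc_bounded (I : finType) (F : I -> R -> 'rV[R]_d -> R) (T : R) :
  (forall i, tuc (F i)) -> exists2 M : R, 0 <= M &
    forall i t, 0 <= t <= T -> forall x, `|F i t x| <= M.
Proof.
move=> tF; have /choice[M HM] : forall i, exists M : R, 0 <= M /\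
    forall t, 0 <= t <= T -> forall x, `|F i t x| <= M.
  by move=> i; have [M M0 H] := tuc_bounded _ T (tF i); exists M.
exists (\sum_i M i); first by apply: sumr_ge0 => i _; have [] := HM i.
move=> i t tT x; have [_ /(_ t tT x) H] := HM i.
by rewrite (bigD1 i)//= (le_trans H)// lerDl sumr_ge0// => j _; have [] := HM j.
Qed.

Lemma tuc_torus_integral_continuous F : tuc F -> continuous (fun t => torus_integral (F t)).
Proof.
move=> [uF _ cF] t; apply/cvgrPdist_le => e /(cF t)[r r0 Hr].
near=> s; rewrite -torus_integralB//; apply: torus_integral_norm_le.
  exact: ucbB.
move=> x; rewrite distrC; apply: Hr; rewrite distrC; near: s; exact: (@nbhs_dist_lt R R t r r0).
Unshelve. all: by end_near. Qed.

Lemma tC_by_parts F G t j : tC 1 F -> tC 1 G ->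
  torus_integral (fun x => F t x * partial j (G t) x) =
  - torus_integral (fun x => partial j (F t) x * G t x).
Proof.
move=> tF tG; have [uF pF _] := tC_tuc _ _ tF; have [uG pG _] := tC_tuc _ _ tG.
have [udF _ _] := tC_tuc _ _ (tC_partial _ _ j tF).
have [udG _ _] := tC_tuc _ _ (tC_partial _ _ j tG).
apply: torus_integral_by_parts => // x.
- by have [] := partial_tC _ _ t x j tF.
- by have [] := partial_tC _ _ t x j tG.
Qed.

Lemma H1_energy F t : tC 2 F ->
  torus_integral (fun x => F t x ^+ 2 + \sum_(j < d) partial j (F t) x ^+ 2) =
  torus_integral (fun x => F t x * (F t x - laplacian (F t) x)).
Proof.
move=> tF; have [uF _ _] := tC_tuc _ _ tF; have tF1 := tCS _ _ tF.
have ud j : ucb (partial j (F t)) by have [] := tC_tuc _ _ (tC_partial _ _ j tF).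
have udd j : ucb (partial j (partial j (F t))).
  by have [] := tC_tuc _ _ (tC_partial _ _ j (tC_partial _ _ j tF)).
have -> : (fun x => F t x * (F t x - laplacian (F t) x)) =
   (fun x => F t x ^+ 2 - \sum_(j < d) F t x * partial j (partial j (F t)) x).
  by apply/funext => x; rewrite mulrBr -expr2 /laplacian mulr_sumr.
rewrite torus_integralD ?torus_integralB; last 4 first.
- exact: ucbX.
- by apply: ucb_sum => j; exact: ucbM.
- exact: ucbX.
- by apply: ucb_sum => j; exact: ucbX.
congr (_ + _); rewrite !torus_integral_sum; last 2 first.
- by move=> j; exact: ucbM.
- by move=> j; exact: ucbX.
rewrite -sumrN; apply: eq_bigr => j _.
have E : torus_integral (fun x => F t x * partial j (partial j (F t)) x) =
    - torus_integral (fun x => partial j (F t) x * partial j (F t) x).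
  exact (tC_by_parts F (fun t => partial j (F t)) t j tF1 (tC_partial _ _ j tF)).
by rewrite E opprK.
Qed.

(** By parts, the left side is the integral of [F (F - laplacian F)], and [a b <= (a^2 + b^2) / 2]
    absorbs half of it. In the uniqueness proof the [L^2] norm of the momenta thus controls the
    velocities and their gradients. *)
Lemma H1_le_momentum F t : tC 2 F ->
  torus_integral (fun x => F t x ^+ 2 + \sum_(j < d) partial j (F t) x ^+ 2)
  <= torus_integral (fun x => (F t x - laplacian (F t) x) ^+ 2).
Proof.
move=> tF; have [uF _ _] := tC_tuc _ _ tF; have tF1 := tCS _ _ tF.
have ud j : ucb (partial j (F t)) by have [] := tC_tuc _ _ (tC_partial _ _ j tF).
have ul : ucb (laplacian (F t)).
  apply: ucb_sum => j.
  by have [] := tC_tuc _ _ (tC_partial _ _ j (tC_partial _ _ j tF)).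
have un : ucb (fun x => F t x - laplacian (F t) x) by exact: ucbB.
set A := torus_integral _; set B := torus_integral _.
have uA : ucb (fun x => F t x ^+ 2 + \sum_(j < d) partial j (F t) x ^+ 2).
  by apply: ucbD; [exact: ucbX|apply: ucb_sum => j; exact: ucbX].
suff : A <= 2^-1 * A + 2^-1 * B by lra.
rewrite {1}/A H1_energy// /A /B -!torus_integralZ//; last exact: ucbX.
rewrite -torus_integralD; last 2 first.
- exact: ucbZ.
- by apply: ucbZ; exact: ucbX.
apply: le_torus_integral.
- exact: ucbM.
- by apply: ucbD; [exact: ucbZ|apply: ucbZ; exact: ucbX].
move=> x; have : 0 <= \sum_(j < d) partial j (F t) x ^+ 2.
  by apply: sumr_ge0 => j _; exact: sqr_ge0.
have := sqr_ge0 (F t x - (F t x - laplacian (F t) x)).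
set y := F t x - laplacian (F t) x; set s := \sum_(j < d) _.
nra.
Qed.

End Uniqueness.

Section EnergyEstimate.
Context {R : realType} {d : nat}.

Lemma udiffB {X : Type} (f1 f2 : R -> X -> R) (t : R) (g1 g2 : X -> R) :
  udiff f1 t g1 -> udiff f2 t g2 ->
  udiff (fun s x => f1 s x - f2 s x) t (fun x => g1 x - g2 x).
Proof.
move=> d1 d2 e e0; have e20 : 0 < e / 2 by lra.
have [r1 r10 H1] := d1 _ e20; have [r2 r20 H2] := d2 _ e20.
exists (Num.min r1 r2); first by rewrite lt_min r10.
move=> s; rewrite lt_min => /andP[/H1 h1 /H2 h2] x.
have -> : f1 s x - f2 s x - (f1 t x - f2 t x) - (s - t) * (g1 x - g2 x) =
  (f1 s x - f1 t x - (s - t) * g1 x) - (f2 s x - f2 t x - (s - t) * g2 x) by ring.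
by apply: (le_trans (ler_normB _ _)); have := h1 x; have := h2 x; lra.
Qed.

(* With n and v the differences of the momenta and of the velocities, this is
   the part of the difference of the nonlinearities that contains no derivative
   of n. *)
Definition EP_lower_order (f g : 'rV[R]_d -> 'rV[R]_d) (i : 'I_d) (x : 'rV[R]_d) : R :=
  let n j := momentum f j x - momentum g j x in
  let v j := component f j x - component g j x in
  let dv l j := partial l (component f j) x - partial l (component g j) x in
  \sum_(j < d) v j * partial j (momentum f i) x
  + \sum_(j < d) n j * partial i (component f j) x
  + \sum_(j < d) momentum g j x * dv i j
  + \sum_(j < d) n i * partial j (component f j) x
  + \sum_(j < d) momentum g i x * dv j j.

Lemma sum_bilinear_diff (u1 u2 m1 m2 p1 p2 q1 q2 r1 r2 : 'I_d -> R) (c1 c2 : R) :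
  \sum_(j < d) u1 j * p1 j + \sum_(j < d) m1 j * q1 j + c1 * \sum_(j < d) r1 j -
  (\sum_(j < d) u2 j * p2 j + \sum_(j < d) m2 j * q2 j + c2 * \sum_(j < d) r2 j) =
  \sum_(j < d) (u1 j - u2 j) * p1 j + \sum_(j < d) (m1 j - m2 j) * q1 j +
  \sum_(j < d) m2 j * (q1 j - q2 j) + \sum_(j < d) (c1 - c2) * r1 j +
  \sum_(j < d) c2 * (r1 j - r2 j) + \sum_(j < d) u2 j * (p1 j - p2 j).
Proof.
rewrite !mulr_sumr -!big_split -sumrB/=.
by apply: eq_bigr => j _; ring.
Qed.

(** The only derivatives of the momentum difference sit in the last sum, a transport by the velocity
    [g]; integration by parts will remove them. *)
Lemma EP_nonlinearity_diff (f g : 'rV[R]_d -> 'rV[R]_d) i x :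
  EP_nonlinearity f i x - EP_nonlinearity g i x =
  EP_lower_order f g i x + \sum_(j < d) component g j x *
    (partial j (momentum f i) x - partial j (momentum g i) x).
Proof.
exact: sum_bilinear_diff.
Qed.

Lemma norm_triple_le (a b c M D : R) : 0 <= D -> a ^+ 2 <= D -> b ^+ 2 <= D ->
  `|c| <= M -> `|a * (b * c)| <= M * D.
Proof.
move=> D0 aD bD cM; rewrite mulrA normrM mulrC; apply: ler_pM => //.
rewrite normrM -(@ler_pXn2r _ 2%N)// ?nnegrE ?mulr_ge0//.
by rewrite exprMn !real_normK ?num_real// expr2 ler_pM ?sqr_ge0.
Qed.

Lemma sum_sqr_ge_terms (n v : 'I_d -> R) (p : 'I_d -> 'I_d -> R) (D : R) :
  D = \sum_(i < d) n i ^+ 2 + \sum_(i < d) (v i ^+ 2 + \sum_(j < d) p i j ^+ 2) ->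
  [/\ 0 <= D, forall i, n i ^+ 2 <= D, forall i, v i ^+ 2 <= D &
      forall i j, p i j ^+ 2 <= D].
Proof.
move=> ->.
have s0 (P : pred 'I_d) (a : 'I_d -> R) : 0 <= \sum_(i < d | P i) a i ^+ 2.
  by apply: sumr_ge0 => i _; exact: sqr_ge0.
have s1 (P : pred 'I_d) : 0 <= \sum_(i < d | P i) (v i ^+ 2 + \sum_(j < d) p i j ^+ 2).
  by apply: sumr_ge0 => i _; rewrite addr_ge0 ?sqr_ge0.
have le_v i : v i ^+ 2 + \sum_(j < d) p i j ^+ 2 <=
    \sum_(i < d) (v i ^+ 2 + \sum_(j < d) p i j ^+ 2).
  by rewrite [leRHS](bigD1 i)//= lerDl.
have le_n i : n i ^+ 2 <= \sum_(i < d) n i ^+ 2 by rewrite [leRHS](bigD1 i)//= lerDl.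
have le_p i j : p i j ^+ 2 <= \sum_(j < d) p i j ^+ 2.
  by rewrite [leRHS](bigD1 j)//= lerDl.
have n0 := s0 xpredT n; have v0 := s1 xpredT.
split => [|i|i|i j]; first exact: addr_ge0.
- by have := le_n i; lra.
- by have := le_v i; have := s0 xpredT (p i); lra.
- by have := le_v i; have := le_p i j; have := sqr_ge0 (v i); lra.
Qed.

Lemma lower_order_le (a M D : R) (v p n q m r s t : 'I_d -> R) : 0 <= D ->
  a ^+ 2 <= D -> (forall j, v j ^+ 2 <= D) -> (forall j, n j ^+ 2 <= D) ->
  (forall j, r j ^+ 2 <= D) -> (forall j, t j ^+ 2 <= D) ->
  (forall j, `|p j| <= M) -> (forall j, `|q j| <= M) -> (forall j, `|m j| <= M) ->
  (forall j, `|s j| <= M) -> forall c : R, `|c| <= M ->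
  `|a * (\sum_(j < d) v j * p j + \sum_(j < d) n j * q j + \sum_(j < d) m j * r j +
    \sum_(j < d) a * s j + \sum_(j < d) c * t j)| <= 5 * d%:R * M * D.
Proof.
move=> D0 aD vD nD rD tD pM qM mM sM c cM.
have S (b e : 'I_d -> R) : (forall j, (b j) ^+ 2 <= D) -> (forall j, `|e j| <= M) ->
    `|a * \sum_(j < d) b j * e j| <= d%:R * (M * D).
  move=> bD eM; rewrite mulr_sumr; apply: norm_sum_le => j.
  exact: norm_triple_le.
have S' (b e : 'I_d -> R) : (forall j, (b j) ^+ 2 <= D) -> (forall j, `|e j| <= M) ->
    `|a * \sum_(j < d) e j * b j| <= d%:R * (M * D).
  by move=> bD eM; under eq_bigr do rewrite mulrC; exact: S.
have -> : 5 * d%:R * M * D = d%:R * (M * D) + d%:R * (M * D) + d%:R * (M * D) +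
   d%:R * (M * D) + d%:R * (M * D) by ring.
rewrite !mulrDr.
apply: (le_trans (ler_normD _ _)); apply: lerD; last exact: (S' t (fun=> c)).
apply: (le_trans (ler_normD _ _)); apply: lerD; last exact: (S (fun=> a) s).
apply: (le_trans (ler_normD _ _)); apply: lerD; last exact: S'.
by apply: (le_trans (ler_normD _ _)); apply: lerD; exact: S.
Qed.

(** Dominates the square of every difference that occurs in [EP_lower_order], so each product of two
    of them is at most this quantity. *)
Definition H1_gap (f g : 'rV[R]_d -> 'rV[R]_d) (x : 'rV[R]_d) : R :=
  \sum_(i < d) (momentum f i x - momentum g i x) ^+ 2 +
  \sum_(i < d) ((component f i x - component g i x) ^+ 2 +
    \sum_(j < d) (partial j (component f i) x - partial j (component g i) x) ^+ 2).

Lemma EP_lower_order_le (f g : 'rV[R]_d -> 'rV[R]_d) (x : 'rV[R]_d) (M : R) i :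
  (forall i j, `|partial j (momentum f i) x| <= M) ->
  (forall i j, `|partial j (component f i) x| <= M) ->
  (forall i, `|momentum g i x| <= M) ->
  `|(momentum f i x - momentum g i x) * EP_lower_order f g i x|
    <= 5 * d%:R * M * H1_gap f g x.
Proof.
move=> pmM puM mM; have [D0 Dn Dv Dp] := @sum_sqr_ge_terms
  (fun i => momentum f i x - momentum g i x) (fun i => component f i x - component g i x)
  (fun i j => partial j (component f i) x - partial j (component g i) x) (H1_gap f g x) erefl.
exact: (lower_order_le (momentum f i x - momentum g i x) M (H1_gap f g x)
  (fun j => component f j x - component g j x) (fun j => partial j (momentum f i) x)
  (fun j => momentum f j x - momentum g j x) (fun j => partial i (component f j) x)
  (fun j => momentum g j x) (fun j => partial i (component f j) x - partial i (component g j) x)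
  (fun j => partial j (component f j) x)
  (fun j => partial j (component f j) x - partial j (component g j) x)).
Qed.

End EnergyEstimate.

Section UniqueSolution.
Context {R : realType} {d : nat}.

Lemma sum_transport (a l u : 'I_d -> R) (p : 'I_d -> 'I_d -> R) :
  \sum_(i < d) 2 * a i * - (l i + \sum_(j < d) u j * p i j) =
  - (\sum_(j < d) u j * (\sum_(i < d) 2 * a i * p i j) + 2 * \sum_(i < d) a i * l i) :> R.
Proof.
under [in RHS]eq_bigr do rewrite mulr_sumr.
rewrite exchange_big/= mulr_sumr -big_split/= -sumrN; apply: eq_bigr => i _.
rewrite mulrN mulrDr addrC; congr (- (_ + _)); first by ring.
by rewrite mulr_sumr; apply: eq_bigr => j _; ring.
Qed.

Lemma partial_tCB (F G : R -> 'rV[R]_d -> R) m t j : tC m.+1 F -> tC m.+1 G ->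
  partial j (fun x => F t x - G t x) = (fun x => partial j (F t) x - partial j (G t) x).
Proof.
move=> tF tG; apply/funext => x; apply: is_derive_val; apply: is_deriveB.
  exact: partial_tC tF.
exact: partial_tC tG.
Qed.

Lemma tC1_sqr (F : R -> 'rV[R]_d -> R) : tC 1 F -> tC 1 (fun t x => F t x ^+ 2) /\
  forall t j, partial j (fun x => F t x ^+ 2) = (fun x => 2 * F t x * partial j (F t) x).
Proof.
move=> tF; have tF0 := tC_tuc _ _ tF.
have D t x v (p : R) : is_derive x v (F t) p -> is_derive x v (fun x => F t x ^+ 2) (2 * F t x * p).
  move=> Dp; have -> : (fun x => F t x ^+ 2) = (fun x => F t x * F t x).
    by apply/funext => y; rewrite expr2.
  have := @is_deriveM _ _ (F t) (F t) x v p p Dp Dp.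
  by congr is_derive; rewrite /GRing.scale/=; ring.
have pE t j : partial j (fun x => F t x ^+ 2) = (fun x => 2 * F t x * partial j (F t) x).
  by apply/funext => x; apply: is_derive_val; apply: D; exact: partial_tC tF.
split => //; split; first exact: tucX.
split.
- move=> t x v; have [_ [dF _]] := tF; have := D t x v _ (dF t x v); congr is_derive.
  by rewrite mulr_sumr; apply: eq_bigr => j _; rewrite pE; ring.
- move=> j; under eq_fun do rewrite pE; split => //.
  apply: tucM; first exact: tucZ.
  exact: tC_tuc (tC_partial _ _ j tF).
Qed.

Variables w1 w2 : R -> 'rV[R]_d -> 'rV[R]_d.
Hypotheses (s1 : smooth_EP w1) (s2 : smooth_EP w2).

Let n (i : 'I_d) (t : R) (x : 'rV[R]_d) : R := momentum (w1 t) i x - momentum (w2 t) i x.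
Let v (i : 'I_d) (t : R) (x : 'rV[R]_d) : R := component (w1 t) i x - component (w2 t) i x.

Let tu1 i : tC 3 (fun t => component (w1 t) i). Proof. by have [+ _] := s1; apply. Qed.
Let tu2 i : tC 3 (fun t => component (w2 t) i). Proof. by have [+ _] := s2; apply. Qed.
Let tm1 i : tC 1 (fun t => momentum (w1 t) i).
Proof. by apply: tC_momentum; exact: tu1. Qed.
Let tm2 i : tC 1 (fun t => momentum (w2 t) i).
Proof. by apply: tC_momentum; exact: tu2. Qed.
Let tn i : tC 1 (n i). Proof. exact: tCB (tm1 i) (tm2 i). Qed.
Let tv i : tC 3 (v i). Proof. exact: tCB (tu1 i) (tu2 i). Qed.

Let pv i j t : partial j (v i t) =
  (fun x => partial j (component (w1 t) i) x - partial j (component (w2 t) i) x).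
Proof. exact: partial_tCB (tu1 i) (tu2 i). Qed.

Let pn i j t : partial j (n i t) =
  (fun x => partial j (momentum (w1 t) i) x - partial j (momentum (w2 t) i) x).
Proof. exact: partial_tCB (tm1 i) (tm2 i). Qed.

Let nv i t x : v i t x - laplacian (v i t) x = n i t x.
Proof.
have -> : laplacian (v i t) x = laplacian (component (w1 t) i) x - laplacian (component (w2 t) i) x.
  rewrite /laplacian -sumrB; apply: eq_bigr => j _; rewrite pv.
  have := partial_tCB _ _ _ t j (tC_partial _ _ j (tu1 i)) (tC_partial _ _ j (tu2 i)).
  by move=> /(congr1 (fun g => g x)).
rewrite /v /n /momentum.
move: (component (w1 t) i x) (component (w2 t) i x) (laplacian (component (w1 t) i) x)
  (laplacian (component (w2 t) i) x) => a b c e; ring.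
Qed.

Let N (t : R) : R := torus_integral (fun x => \sum_(i < d) n i t x ^+ 2).

Let tuc_n i : tuc (n i). Proof. exact: tC_tuc (tn i). Qed.
Let tuc_v i : tuc (v i). Proof. exact: tC_tuc (tv i). Qed.
Let tuc_pv i j : tuc (fun t => partial j (v i t)).
Proof. exact: tC_tuc (tC_partial _ _ j (tv i)). Qed.
Let tuc_Q : tuc (fun t x => \sum_(i < d) n i t x ^+ 2).
Proof. by apply: tuc_sum => i; exact: tucX. Qed.
Let tuc_V : tuc (fun t x => \sum_(i < d) (v i t x ^+ 2 + \sum_(j < d) partial j (v i t) x ^+ 2)).
Proof.
by apply: tuc_sum => i; apply: tucD; [exact: tucX|apply: tuc_sum => j; exact: tucX].
Qed.

Let gapE t : H1_gap (w1 t) (w2 t) = (fun x => \sum_(i < d) n i t x ^+ 2 +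
  \sum_(i < d) (v i t x ^+ 2 + \sum_(j < d) partial j (v i t) x ^+ 2)).
Proof.
apply/funext => x; congr (_ + _); apply: eq_bigr => i _; congr (_ + _).
by apply: eq_bigr => j _; rewrite pv.
Qed.

Let V_le t : torus_integral (fun x =>
  \sum_(i < d) (v i t x ^+ 2 + \sum_(j < d) partial j (v i t) x ^+ 2)) <= N t.
Proof.
have uv i : ucb (fun x => v i t x ^+ 2 + \sum_(j < d) partial j (v i t) x ^+ 2).
  have [u1 _ _] := tuc_v i; have u2 j : ucb (partial j (v i t)) by have [] := tuc_pv i j.
  by apply: ucbD; [exact: ucbX|apply: ucb_sum => j; exact: ucbX].
have un i : ucb (fun x => n i t x ^+ 2) by have [u1 _ _] := tuc_n i; exact: ucbX.
rewrite /N !torus_integral_sum//; apply: ler_sum => i _.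
have := H1_le_momentum (v i) t (tCS _ _ (tv i)).
by under [X in _ <= torus_integral X -> _]eq_fun do rewrite nv.
Qed.

Let gap_le t : torus_integral (H1_gap (w1 t) (w2 t)) <= 2 * N t.
Proof.
have [uQ _ _] := tuc_Q; have [uV _ _] := tuc_V.
rewrite gapE torus_integralD// mulr_natl mulr2n; apply: lerD => //.
Qed.

Let dN (t : R) : R := torus_integral (fun x => \sum_(i < d)
  2 * n i t x * (- EP_nonlinearity (w1 t) i x + EP_nonlinearity (w2 t) i x)).

Let tuc_EP1 i : tuc (fun t => EP_nonlinearity (w1 t) i).
Proof. by apply: tuc_EP_nonlinearity; exact: tu1. Qed.
Let tuc_EP2 i : tuc (fun t => EP_nonlinearity (w2 t) i).
Proof. by apply: tuc_EP_nonlinearity; exact: tu2. Qed.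

Let is_derive_N (t : R) : 0 < t -> is_derive t 1 N (dN t).
Proof.
move=> t0; apply: is_derive_torus_integral.
- by move=> s; have [] := tuc_Q.
- have [] : tuc (fun t x => \sum_(i < d)
    2 * n i t x * (- EP_nonlinearity (w1 t) i x + EP_nonlinearity (w2 t) i x)).
    apply: tuc_sum => i; apply: tucM; first exact: tucZ.
    by apply: tucD => //; exact: tucN.
  by move=> H _ _; exact: H.
apply: udiff_sum => i.
have dn : udiff (n i) t (fun x => - EP_nonlinearity (w1 t) i x - - EP_nonlinearity (w2 t) i x).
  by apply: udiffB; [exact: s1.2|exact: s2.2].
have [[M1 HM1] _] : ucb (n i t) by have [] := tuc_n i.
have ue : ucb (fun x => - EP_nonlinearity (w1 t) i x - - EP_nonlinearity (w2 t) i x).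
  have [u1 _ _] := tucN _ (tuc_EP1 i); have [u2 _ _] := tucN _ (tuc_EP2 i).
  by apply: ucbB; [exact: u1|exact: u2].
have [[M2 HM2] _] := ue.
have := udiffM (n i) (n i) t (Num.max M1 M2) _ _ _ _ _ _ dn dn.
have -> : (fun s x => n i s x * n i s x) = (fun s x => n i s x ^+ 2).
  by apply/funext => s; apply/funext => x; rewrite expr2.
set g := (fun x => _ + _).
have -> : g = (fun x => 2 * n i t x * (- EP_nonlinearity (w1 t) i x + EP_nonlinearity (w2 t) i x)).
  apply/funext => x; rewrite /g.
  move: (EP_nonlinearity (w1 t) i x) (EP_nonlinearity (w2 t) i x) (n i t x) => a b c; ring.
by apply => x; rewrite le_max ?HM1 ?HM2 ?orbT.
Qed.

Let ucb_lower t : ucb (fun x => 2 * \sum_(i < d) n i t x * EP_lower_order (w1 t) (w2 t) i x).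
Proof.
have uu j : ucb (component (w2 t) j) by have [] := tC_tuc _ _ (tu2 j).
apply: ucbZ; apply: ucb_sum => i; apply: ucbM; first by have [] := tuc_n i.
have -> : EP_lower_order (w1 t) (w2 t) i = (fun x =>
   EP_nonlinearity (w1 t) i x - EP_nonlinearity (w2 t) i x -
   \sum_(j < d) component (w2 t) j x *
  (partial j (momentum (w1 t) i) x - partial j (momentum (w2 t) i) x)).
  by apply/funext => x; rewrite EP_nonlinearity_diff addrK.
have [e1 _ _] := tuc_EP1 i; have [e2 _ _] := tuc_EP2 i.
apply: ucbB; first exact: ucbB.
apply: ucb_sum => j; apply: ucbM => //; apply: ucbB.
  by have [] := tC_tuc _ _ (tC_partial _ _ j (tm1 i)).
by have [] := tC_tuc _ _ (tC_partial _ _ j (tm2 i)).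
Qed.

Let ucb_dN t : ucb (fun x =>
  \sum_(j < d) partial j (component (w2 t) j) x * (\sum_(i < d) n i t x ^+ 2)
  - 2 * \sum_(i < d) n i t x * EP_lower_order (w1 t) (w2 t) i x).
Proof.
apply: ucbB; last exact: ucb_lower.
apply: ucb_sum => j; apply: ucbM; last by have [] := tuc_Q.
by have [] := tC_tuc _ _ (tC_partial _ _ j (tu2 j)).
Qed.

(** Since [2 n (partial n)] is the partial derivative of [n^2], the transport term becomes, by
    parts, the divergence of the velocity times the sum of the [n^2], and no derivative of [n] is
    left. *)
Let dN_E t : dN t = torus_integral (fun x =>
  \sum_(j < d) partial j (component (w2 t) j) x * (\sum_(i < d) n i t x ^+ 2)
  - 2 * \sum_(i < d) n i t x * EP_lower_order (w1 t) (w2 t) i x).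
Proof.
pose Q (t : R) (x : 'rV[R]_d) := \sum_(i < d) n i t x ^+ 2.
have tQ : tC 1 Q by apply: tC_sum => i; have [] := tC1_sqr _ (tn i).
have pQ j x : partial j (Q t) x = \sum_(i < d) 2 * n i t x * partial j (n i t) x.
  apply: is_derive_val; rewrite /Q.
  have -> : (fun x => \sum_(i < d) n i t x ^+ 2) = \sum_(i < d) (fun x => n i t x ^+ 2).
    by apply/funext => y; rewrite fct_sumE.
  apply: is_derive_sum => i; have [ts pE] := tC1_sqr _ (tn i).
  have := partial_tC _ _ t x j ts; rewrite pE; exact.
have uQ : ucb (Q t) by have [uQ0 _ _] := tuc_Q; exact: (uQ0 t).
have uu j : ucb (component (w2 t) j) by have [] := tC_tuc _ _ (tu2 j).
have upu j : ucb (partial j (component (w2 t) j)).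
  by have [] := tC_tuc _ _ (tC_partial _ _ j (tu2 j)).
have upQ j : ucb (partial j (Q t)) by have [] := tC_tuc _ _ (tC_partial _ _ j tQ).
have uEP := ucb_lower t.
have uP1 : ucb (fun x => \sum_(j < d) partial j (component (w2 t) j) x * Q t x).
  by apply: ucb_sum => j; exact: ucbM.
have uP2 : ucb (fun x => \sum_(j < d) component (w2 t) j x * partial j (Q t) x).
  by apply: ucb_sum => j; exact: ucbM.
rewrite torus_integralB//.
have -> : torus_integral (fun x => \sum_(j < d) partial j (component (w2 t) j) x * Q t x) =
   - torus_integral (fun x => \sum_(j < d) component (w2 t) j x * partial j (Q t) x).
  rewrite !torus_integral_sum; last 2 first.
  - by move=> j; exact: ucbM.
  - by move=> j; exact: ucbM.
  rewrite -sumrN; apply: eq_bigr => j _.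
  have E : torus_integral (fun x => component (w2 t) j x * partial j (Q t) x) =
      - torus_integral (fun x => partial j (component (w2 t) j) x * Q t x).
    exact (tC_by_parts _ _ t j (tCS _ _ (tCS _ _ (tu2 j))) tQ).
  by rewrite E opprK.
rewrite -opprD -torus_integralD// -torus_integralN; last exact: ucbD.
congr torus_integral; apply/funext => x.
have H i : - EP_nonlinearity (w1 t) i x + EP_nonlinearity (w2 t) i x =
    - (EP_lower_order (w1 t) (w2 t) i x +
       \sum_(j < d) component (w2 t) j x * partial j (n i t) x).
  transitivity (- (EP_nonlinearity (w1 t) i x - EP_nonlinearity (w2 t) i x)).
    by rewrite opprB addrC.
  rewrite EP_nonlinearity_diff; congr (- (_ + _)).
  by apply: eq_bigr => j _; rewrite pn.
under eq_bigr do rewrite H; under [in RHS]eq_bigr do rewrite pQ.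
exact: sum_transport.
Qed.

Let dN_le (T : R) : exists C : R, forall t, 0 <= t <= T -> dN t <= C * N t.
Proof.
have [M1 M10 HM1] := finite_tuc_bounded ('I_d * 'I_d)%type
  (fun ij t => partial ij.2 (momentum (w1 t) ij.1)) T
  (fun ij => tC_tuc _ _ (tC_partial _ _ ij.2 (tm1 ij.1))).
have [M2 M20 HM2] := finite_tuc_bounded ('I_d * 'I_d)%type
  (fun ij t => partial ij.2 (component (w1 t) ij.1)) T
  (fun ij => tC_tuc _ _ (tC_partial _ _ ij.2 (tu1 ij.1))).
have [M3 M30 HM3] := finite_tuc_bounded ('I_d)
  (fun i t => momentum (w2 t) i) T (fun i => tC_tuc _ _ (tm2 i)).
have [M4 M40 HM4] := finite_tuc_bounded ('I_d)
  (fun j t => partial j (component (w2 t) j)) T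
  (fun j => tC_tuc _ _ (tC_partial _ _ j (tu2 j))).
pose M := M1 + M2 + M3 + M4.
have M0 : 0 <= M by rewrite !addr_ge0.
(* The first summand comes from the divergence term, the second from the [d] products with the five
   sums of [EP_lower_order]. A further factor 2 comes from [gap_le]. *)
pose K := d%:R * M + 2 * (d%:R * (5 * d%:R * M)).
have K0 : 0 <= K by rewrite /K !(addr_ge0, mulr_ge0).
exists (K * 2) => t tT; rewrite -mulrA; apply: (le_trans _ (ler_wpM2l K0 (gap_le t))).
have ugap : ucb (H1_gap (w1 t) (w2 t)).
  by rewrite gapE; apply: ucbD; [have [] := tuc_Q|have [] := tuc_V].
rewrite dN_E -torus_integralZ//; apply: le_torus_integral.
- exact: ucb_dN.
- exact: ucbZ.
move=> x; have [D0 Dn Dv Dp] := @sum_sqr_ge_terms R d (fun i => n i t x)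
  (fun i => v i t x) (fun i j => partial j (v i t) x) (H1_gap (w1 t) (w2 t) x)
  (congr1 (fun g => g x) (gapE t)).
set D := H1_gap _ _ x in D0 Dn Dv Dp *.
have QD : 0 <= \sum_(i < d) n i t x ^+ 2 <= D.
  rewrite sumr_ge0/=; last by move=> i _; exact: sqr_ge0.
  rewrite /D gapE lerDl; apply: sumr_ge0 => i _.
  by rewrite addr_ge0 ?sqr_ge0// sumr_ge0// => j _; exact: sqr_ge0.
have A : \sum_(j < d) partial j (component (w2 t) j) x * (\sum_(i < d) n i t x ^+ 2) <= d%:R * (M * D).
  apply: le_trans (ler_norm _) _; apply: norm_sum_le => j.
  case/andP: QD => Q0 QD; rewrite normrM (ger0_norm Q0) ler_pM//.
  by apply: le_trans (HM4 j t tT x) _; rewrite /M lerDr !addr_ge0.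
have B : `|\sum_(i < d) n i t x * EP_lower_order (w1 t) (w2 t) i x| <= d%:R * (5 * d%:R * M * D).
  apply: norm_sum_le => i; apply: EP_lower_order_le => [k j|k j|k].
  - by apply: le_trans (HM1 (k, j) t tT x) _; rewrite /M -!addrA lerDl !addr_ge0.
  - by apply: le_trans (HM2 (k, j) t tT x) _; rewrite /M -!addrA addrCA lerDl !addr_ge0.
  - by apply: le_trans (HM3 k t tT x) _; rewrite /M -addrA addrCA lerDl !addr_ge0.
have -> : K * D = d%:R * (M * D) + 2 * (d%:R * (5 * d%:R * M * D)) by rewrite /K; ring.
move: A B; rewrite ler_norml; set a := \sum_(j < d) _; set b := \sum_(i < d) _.
by lra.
Qed.

(** Gronwall makes [N] vanish; [V_le] then bounds the integral of a nonnegative continuous density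
    containing the square of the velocity difference by 0, so that it vanishes at every point. *)
Lemma smooth_EP_unique : w1 0 =1 w2 0 -> forall t, 0 <= t -> w1 t =1 w2 t.
Proof.
move=> w0; have w0E : w1 0 = w2 0 by apply/funext.
have N0 : N 0 = 0.
  rewrite /N -[RHS](@torus_integral_cst R d); congr torus_integral; apply/funext => x.
  by rewrite big1// => i _; rewrite /n w0E subrr expr0n.
have Nle T : 0 <= T -> N T <= 0.
  rewrite le_eqVlt => /predU1P[<-|T0]; first by rewrite N0.
  have [C HC] := dN_le T; apply: (@gronwall_le0 _ N dN C T) => //.
  - by move=> t _; exact: tuc_torus_integral_continuous tuc_Q t.
  - by move=> t /andP[t0 _]; exact: is_derive_N.
  - by move=> t tT; apply: HC; lra.
move=> t t0 x; apply/rowP => i; apply/eqP; rewrite -subr_eq0 -sqrf_eq0; apply/eqP.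
have V0 : \sum_(i < d) (v i t x ^+ 2 + \sum_(j < d) partial j (v i t) x ^+ 2) = 0.
  have [uV pV _] := tuc_V.
  apply: (per_ge0_torus_integral_le0 _ (uV t) (pV t)).
    move=> y; apply: sumr_ge0 => k _.
    by rewrite addr_ge0 ?sqr_ge0// sumr_ge0// => j _; exact: sqr_ge0.
  exact: le_trans (V_le t) (Nle t t0).
apply/eqP; rewrite eq_le sqr_ge0 andbT -[leRHS]V0 (bigD1 i)//= -addrA lerDl.
rewrite addr_ge0 ?sumr_ge0// => [j _|k _]; first exact: sqr_ge0.
by rewrite addr_ge0 ?sqr_ge0// sumr_ge0// => j _; exact: sqr_ge0.
Qed.

End UniqueSolution.

(** * Plane waves *)

Section PlaneWaves.
Context {R : realType} {d : nat} (theta : 'rV[R]_d).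

Definition dot (z : 'rV[R]_d) : R := \sum_(j < d) theta 0 j * z 0 j.

Hypothesis theta1 : dot theta = 1.

(* Invariance under the hyperplane orthogonal to theta: f (x) only depends on
   the coordinate theta.x. *)
Definition plane_wave {T : Type} (f : 'rV[R]_d -> T) : Prop :=
  forall z, dot z = 0 -> translate z f = f.

Definition Dth (F : R -> 'rV[R]_d -> R) (t : R) (x : 'rV[R]_d) : R := 'D_theta (F t) x.

Lemma dot_delta j : dot (delta_mx 0 j) = theta 0 j.
Proof.
rewrite /dot (bigD1 j)//= mxE !eqxx mulr1 big1 ?addr0// => i ij.
by rewrite mxE (negbTE ij) mulr0.
Qed.

Lemma dotB x y : dot (x - y) = dot x - dot y.
Proof. by rewrite /dot -sumrB; apply: eq_bigr => j _; rewrite !mxE mulrBr. Qed.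

Lemma dotZ (a : R) x : dot (a *: x) = a * dot x.
Proof. by rewrite /dot mulr_sumr; apply: eq_bigr => j _; rewrite mxE; ring. Qed.

Lemma dot_delta_perp j : dot (delta_mx 0 j - theta 0 j *: theta) = 0.
Proof. by rewrite dotB dotZ theta1 dot_delta mulr1 subrr. Qed.

Lemma plane_waveE {T : Type} (f : 'rV[R]_d -> T) x : plane_wave f -> f x = f (dot x *: theta).
Proof.
move=> pf; have z0 : dot (x - dot x *: theta) = 0 by rewrite dotB dotZ theta1 mulr1 subrr.
have := congr1 (fun g => g (dot x *: theta)) (pf _ z0).
by rewrite /translate addrC subrK.
Qed.

(** The vector [e_j - theta_j theta] is orthogonal to [theta], so a shift by [theta_j theta] acts
    like the shift by the lattice vector [e_j], even when the direction [theta] is irrational. *)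
Lemma plane_wave_periodic (f : 'rV[R]_d -> R) j x : per f -> plane_wave f ->
  f (x + `|theta 0 j| *: theta) = f x.
Proof.
move=> pf wf; have P y : f (y + theta 0 j *: theta) = f y.
  rewrite -[LHS](congr1 (fun g => g _) (wf _ (dot_delta_perp j))) /translate.
  by rewrite -addrA [_ *: _ + _]addrC subrK pf.
case: (ger0P (theta 0 j)) => _; first exact: P.
by rewrite -[LHS]P -addrA scaleNr addNr addr0.
Qed.

Lemma is_derive_tC m (F : R -> 'rV[R]_d -> R) t x : tC m.+1 F ->
  is_derive x theta (F t) (Dth F t x).
Proof. by move=> [_ [/(_ t x theta) [D _] _]]; exact: derivableP. Qed.

Lemma DthE m (F : R -> 'rV[R]_d -> R) t x : tC m.+1 F ->
  Dth F t x = \sum_(j < d) theta 0 j * partial j (F t) x.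
Proof. by move=> [_ [/(_ t x theta) D _]]; exact: is_derive_val D. Qed.

Lemma tC_Dth m (F : R -> 'rV[R]_d -> R) : tC m.+1 F -> tC m (Dth F).
Proof.
move=> tF; apply: (eq_tC _ (fun t x => \sum_(j < d)
   (theta 0 j * partial j (F t) x + 0 * partial j (F t) x))) => [t x|].
  by rewrite (DthE m)//; apply: eq_bigr => j _; rewrite mul0r addr0.
by apply: tC_sum => j; apply: (tC_lin _ (fun t => partial j (F t)) (fun t => partial j (F t)));
  exact: tC_partial.
Qed.

Lemma plane_wave_Dth (F : R -> 'rV[R]_d -> R) t : plane_wave (F t) -> plane_wave (Dth F t).
Proof.
move=> wF z z0; apply/funext => x; rewrite {1}/translate /Dth -derive_translate.
by have := wF z z0; rewrite /translate => ->.
Qed.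

(** The derivative along [e_j - theta_j theta] vanishes, because [F t] is constant on that line. *)
Lemma partial_plane_wave m (F : R -> 'rV[R]_d -> R) t j x : tC m.+1 F -> plane_wave (F t) ->
  partial j (F t) x = theta 0 j * Dth F t x.
Proof.
move=> tF wF; pose z : 'rV[R]_d := delta_mx 0 j - theta 0 j *: theta.
have D0 : is_derive x z (F t) 0.
  apply: is_derive_of_line.
  have -> : (fun s : R => F t (x + s *: z)) = (fun=> F t x).
    apply/funext => s; have sz : dot (s *: z) = 0 by rewrite dotZ dot_delta_perp mulr0.
    exact: (congr1 (fun g => g x) (wF _ sz)).
  exact: is_derive_cst.
have [_ [dF _]] := tF; have := is_derive_val (dF t x z).
rewrite (is_derive_val D0) (DthE m)//.
have -> : \sum_(l < d) z 0 l * partial l (F t) x =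
    partial j (F t) x - theta 0 j * \sum_(l < d) theta 0 l * partial l (F t) x.
  transitivity (\sum_(l < d) ((l == j)%:R * partial l (F t) x -
      theta 0 j * (theta 0 l * partial l (F t) x))).
    by apply: eq_bigr => l _; rewrite !mxE eqxx/=; ring.
  rewrite sumrB -mulr_sumr; congr (_ - _).
  by rewrite (bigD1 j)//= eqxx mul1r big1 ?addr0// => l lj; rewrite (negbTE lj) mul0r.
by move=> /esym/eqP; rewrite subr_eq0 => /eqP.
Qed.

Lemma laplacian_plane_wave m (F : R -> 'rV[R]_d -> R) t x : tC m.+2 F ->
  (forall t, plane_wave (F t)) -> laplacian (F t) x = Dth (Dth F) t x.
Proof.
move=> tF wF; have tD := tC_Dth _ _ tF.
rewrite /laplacian -[RHS]mul1r -theta1 /dot mulr_suml; apply: eq_bigr => j _.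
have -> : partial j (F t) = (fun y => theta 0 j * Dth F t y).
  by apply/funext => y; exact: (partial_plane_wave _ _ _ _ _ tF).
have D := partial_tC _ _ t x j tD.
have -> : partial j (fun y => theta 0 j * Dth F t y) x = theta 0 j * partial j (Dth F t) x.
  by apply: is_derive_val; apply: (@is_deriveZ _ _ _ (Dth F t)).
by rewrite (partial_plane_wave _ _ _ _ _ tD) ?mulrA//; exact: plane_wave_Dth.
Qed.

Section Reduction.
Variable w : R -> 'rV[R]_d -> 'rV[R]_d.
Hypotheses (sw : smooth_EP w) (pw : forall t, plane_wave (w t)).

Definition wave (i : 'I_d) (t : R) (x : 'rV[R]_d) : R := component (w t) i x.
Definition waveM i t x : R := wave i t x - Dth (Dth (wave i)) t x.
Definition speed (t : R) (x : 'rV[R]_d) : R := \sum_(j < d) theta 0 j * wave j t x.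

Lemma tC_wave i : tC 3 (wave i). Proof. by have [+ _] := sw; apply. Qed.

Lemma plane_wave_wave i t : plane_wave (wave i t).
Proof.
move=> z z0; apply/funext => x; rewrite /translate /wave /component.
have E := congr1 (fun g : 'rV[R]_d -> 'rV[R]_d => g x 0 i) (pw t z z0).
exact: E.
Qed.

Lemma momentum_wave i t : momentum (w t) i = waveM i t.
Proof.
apply/funext => x; congr (_ - _).
exact: (laplacian_plane_wave _ (wave i) t x (tC_wave i) (plane_wave_wave i)).
Qed.

Lemma tC_waveM i : tC 1 (waveM i).
Proof.
apply: tCB; first exact/tCS/tCS/tC_wave.
by apply: tC_Dth; apply: tC_Dth; exact: tC_wave.
Qed.

Lemma plane_wave_waveM i t : plane_wave (waveM i t).
Proof.
move=> z z0; apply/funext => x; rewrite /translate /waveM.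
have E1 := congr1 (fun g => g x) (plane_wave_wave i t z z0).
have E2 := congr1 (fun g => g x) (plane_wave_Dth _ _ (plane_wave_Dth _ _ (plane_wave_wave i t)) z z0).
exact: (f_equal2 (fun a b => a - b) E1 E2).
Qed.

(** With every partial derivative replaced by [theta_j] times the derivative along [theta], the
    equations become a system in one space variable, transported by [speed]. *)
Lemma EP_nonlinearity_wave i t x : EP_nonlinearity (w t) i x =
  speed t x * Dth (waveM i) t x
  + theta 0 i * \sum_(j < d) waveM j t x * Dth (wave j) t x
  + waveM i t x * \sum_(j < d) theta 0 j * Dth (wave j) t x.
Proof.
have p1 j l : partial l (component (w t) j) x = theta 0 l * Dth (wave j) t x.
  exact: (partial_plane_wave _ (wave j) t l x (tC_wave j) (plane_wave_wave j t)).
have p2 l : partial l (momentum (w t) i) x = theta 0 l * Dth (waveM i) t x.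
  rewrite momentum_wave.
  exact: (partial_plane_wave _ (waveM i) t l x (tC_waveM i) (plane_wave_waveM i t)).
have mE j : momentum (w t) j x = waveM j t x by rewrite momentum_wave.
rewrite /EP_nonlinearity; congr (_ + _ + _).
- rewrite /speed mulr_suml; apply: eq_bigr => j _; rewrite p2 mulrCA mulrA.
  by congr (_ * _).
- by rewrite mulr_sumr; apply: eq_bigr => j _; rewrite p1 mE mulrCA.
- by rewrite mE; congr (_ * _); apply: eq_bigr => j _; rewrite p1.
Qed.

End Reduction.

End PlaneWaves.

(** * The Riccati inequality *)

Section PeriodicConvolution.
Context {R : realType} (L : R) (L0 : 0 < L).
Implicit Types (f g h : R -> R).

Let q : R := expR (- L).

Let E (s : R) : R := expR (- s).

Let is_derive_E (s : R) : is_derive s 1 E (- E s).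
Proof.
have D := is_derive_affine 0 (-1 : R) s.
have -> : E = expR \o (fun r => 0 + r * -1) by apply/funext => r /=; rewrite /E; congr expR; ring.
by apply: is_derive_eq; rewrite /E /= add0r !(mulrN1, mulN1r).
Qed.

Let cE : continuous E.
Proof. by move=> s; exact: is_derive_continuous (is_derive_E s). Qed.

Let E0 : E 0 = 1. Proof. by rewrite /E oppr0 expR0. Qed.
Let EL : E L = q. Proof. by []. Qed.
Let q1 : q < 1. Proof. by rewrite /q expR_lt1 oppr_lt0. Qed.
Let q0 : 0 < q. Proof. exact: expR_gt0. Qed.

Lemma continuous_mul f g : continuous f -> continuous g -> continuous (fun s => f s * g s).
Proof. by move=> cf cg x; apply: cvgM; [exact: cf|exact: cg]. Qed.

Lemma continuous_add f g : continuous f -> continuous g -> continuous (fun s => f s + g s).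
Proof. by move=> cf cg x; apply: cvgD; [exact: cf|exact: cg]. Qed.

Lemma continuous_sub f g : continuous f -> continuous g -> continuous (fun s => f s - g s).
Proof. by move=> cf cg x; apply: cvgB; [exact: cf|exact: cg]. Qed.

Lemma continuous_const (c : R) : continuous (fun _ : R => c).
Proof. by move=> x; exact: cvg_cst. Qed.

Lemma continuous_negarg f : continuous f -> continuous (fun s => f (- s)).
Proof. by move=> cf x; apply: (@continuous_comp _ _ _ -%R f); [exact: oppr_continuous|exact: cf]. Qed.

Lemma is_derive_mul f g (s a b : R) : is_derive s 1 f a -> is_derive s 1 g b ->
  is_derive s 1 (fun r => f r * g r) (f s * b + g s * a).
Proof. by move=> Df Dg; exact: is_deriveM. Qed.

Lemma is_derive_add f g (s a b : R) : is_derive s 1 f a -> is_derive s 1 g b ->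
  is_derive s 1 (fun r => f r + g r) (a + b).
Proof. by move=> Df Dg; exact: is_deriveD. Qed.

Lemma is_derive_sub f g (s a b : R) : is_derive s 1 f a -> is_derive s 1 g b ->
  is_derive s 1 (fun r => f r - g r) (a - b).
Proof. by move=> Df Dg; exact: is_deriveB. Qed.

Lemma is_derive_reflect f (s a c : R) : is_derive (c - s) 1 f a ->
  is_derive s 1 (fun r => f (c - r)) (- a).
Proof.
move=> Df; have D := is_derive_affine c (-1) s.
have -> : (fun r => f (c - r)) = f \o (fun r => c + r * -1).
  by apply/funext => r /=; rewrite mulrN1.
have Df' : is_derive (c + s * -1) 1 f a by rewrite mulrN1.
by apply: is_derive_eq; rewrite mulrN1.
Qed.

(** Convolution at 0 with the periodised kernel [exp (- |s|)], not normalised. Integrating on both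
    sides of 0 keeps a pure exponential in each integral; for [L]-periodic [h] the combined kernel
    on [[0, L]] is [exp (- s) + exp (- (L - s))]. *)
Definition Ks h : R :=
  intL L (fun s => expR (- s) * h s) + intL L (fun s => expR (- s) * h (- s)).

Lemma exp_weighted_derivative h h1 : (forall s : R, is_derive s 1 h (h1 s)) ->
  continuous h1 -> h L = h 0 ->
  intL L (fun s => expR (- s) * h1 s) = (q - 1) * h 0 + intL L (fun s => expR (- s) * h s).
Proof.
move=> dh ch1 hL.
have ch : continuous h by move=> s; exact: is_derive_continuous (dh s).
have c1 : continuous (fun s => E s * h1 s) by exact: continuous_mul.
have c2 : continuous (fun s => - E s * h s).
  by apply: continuous_mul => // s; apply: cvgN; exact: cE.
have H : intL L (fun s => E s * h1 s + - E s * h s) = E L * h L - E 0 * h 0.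
  apply: (intL_FTC _ _ (fun s => E s * h s)); first exact: ltW.
    exact: continuous_add.
  move=> s _; have := is_derive_mul _ _ _ _ _ (is_derive_E s) (dh s).
  by congr is_derive; ring.
move: H; rewrite intLD// E0 EL hL.
have -> : intL L (fun s => - E s * h s) = - intL L (fun s => E s * h s).
  rewrite -mulN1r -intLZ; last exact: continuous_mul.
  by apply: eq_intL => s _; ring.
rewrite /E; lra.
Qed.

Lemma exp_weighted_derivativeN h h1 : (forall s : R, is_derive s 1 h (h1 s)) ->
  continuous h1 -> h (- L) = h 0 ->
  intL L (fun s => expR (- s) * h1 (- s)) =
  (1 - q) * h 0 - intL L (fun s => expR (- s) * h (- s)).
Proof.
move=> dh ch1 hL.
have dg (s : R) : is_derive s 1 (fun s => h (- s)) (- h1 (- s)).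
  have := is_derive_reflect h s (h1 (- s)) 0; rewrite sub0r => /(_ (dh _)).
  by under [X in is_derive _ _ X _ -> _]eq_fun do rewrite sub0r.
have cg : continuous (fun s => - h1 (- s)).
  by move=> s; apply: cvgN; exact: continuous_negarg.
have := exp_weighted_derivative _ _ dg cg; rewrite oppr0 hL => /(_ erefl).
have -> : intL L (fun s => expR (- s) * - h1 (- s)) = - intL L (fun s => expR (- s) * h1 (- s)).
  rewrite -mulN1r -intLZ; last by apply: continuous_mul; [exact: cE|exact: continuous_negarg].
  by apply: eq_intL => s _; ring.
lra.
Qed.

Lemma Ks_lin f g (a b : R) : continuous f -> continuous g ->
  Ks (fun s => a * f s + b * g s) = a * Ks f + b * Ks g.
Proof.
move=> cf cg.
have lin (f' g' : R -> R) : continuous f' -> continuous g' ->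
    intL L (fun s => expR (- s) * (a * f' s + b * g' s)) =
    a * intL L (fun s => expR (- s) * f' s) + b * intL L (fun s => expR (- s) * g' s).
  move=> cf' cg'; rewrite -!intLZ; [|exact: continuous_mul|exact: continuous_mul].
  rewrite -intLD; last 2 first.
  - by apply: continuous_mul; [exact: continuous_const|exact: continuous_mul].
  - by apply: continuous_mul; [exact: continuous_const|exact: continuous_mul].
  by apply: eq_intL => s _; ring.
rewrite /Ks lin// (lin (fun s => f (- s)) (fun s => g (- s))); last 2 first.
- exact: continuous_negarg.
- exact: continuous_negarg.
ring.
Qed.

Lemma le_Ks f g : continuous f -> continuous g ->
  (forall s, f s <= g s) -> Ks f <= Ks g.
Proof.
move=> cf cg fg; apply: lerD; apply: le_intL => //.
- exact: continuous_mul.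
- exact: continuous_mul.
- by move=> s _; rewrite ler_wpM2l// expR_ge0.
- by apply: continuous_mul; [exact: cE|exact: continuous_negarg].
- by apply: continuous_mul; [exact: cE|exact: continuous_negarg].
- by move=> s _; rewrite ler_wpM2l// expR_ge0.
Qed.

Lemma Ks_cst c : Ks (fun=> c) = 2 * (1 - q) * c.
Proof.
have H : intL L (fun s => E s) = 1 - q.
  have -> : intL L E = - E L - - E 0.
    apply: (intL_FTC _ _ (fun s => - E s)) => //; first exact: ltW.
    by move=> s _; have := is_deriveN (is_derive_E s); rewrite opprK.
  by rewrite E0 EL; ring.
have -> : Ks (fun=> c) = intL L (fun s => c * E s) + intL L (fun s => c * E s).
  by congr (_ + _); apply: eq_intL => s _; rewrite mulrC.
by rewrite intLZ// H; ring.
Qed.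

(* The kernel of Ks is, up to the factor 2 (1 - exp(-L)), the Green function of
   1 - d^2/ds^2 for the period L. *)
Lemma Ks_green f f1 f2 : (forall s : R, is_derive s 1 f (f1 s)) ->
  (forall s : R, is_derive s 1 f1 (f2 s)) -> continuous f2 ->
  (forall s, f (s + L) = f s) -> (forall s, f1 (s + L) = f1 s) ->
  [/\ Ks (fun s => f s - f2 s) = 2 * (1 - q) * f 0 &
      intL L (fun s => expR (- s) * (f s - f2 s)) -
      intL L (fun s => expR (- s) * (f (- s) - f2 (- s))) = 2 * (1 - q) * f1 0].
Proof.
move=> df df1 cf2 pf pf1.
have cf : continuous f by move=> s; exact: is_derive_continuous (df s).
have cf1 : continuous f1 by move=> s; exact: is_derive_continuous (df1 s).
have fL : f L = f 0 by rewrite -[in RHS]pf add0r.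
have f1L : f1 L = f1 0 by rewrite -[in RHS]pf1 add0r.
have fNL : f (- L) = f 0 by rewrite -[in LHS]pf addNr.
have f1NL : f1 (- L) = f1 0 by rewrite -[in LHS]pf1 addNr.
have cEm (g : R -> R) : continuous g -> continuous (fun s => expR (- s) * g s).
  by move=> cg; apply: continuous_mul.
(* Two integrations by parts on each side of 0. The boundary terms in [f1 0] cancel in the sum of
   the sides, those in [f 0] cancel in the difference, which is a convolution with the derivative of
   the kernel. *)
have A1 := exp_weighted_derivative _ _ df cf1 fL.
have A2 := exp_weighted_derivative _ _ df1 cf2 f1L.
have B1 := exp_weighted_derivativeN _ _ df cf1 fNL.
have B2 := exp_weighted_derivativeN _ _ df1 cf2 f1NL.
have S1 : intL L (fun s => expR (- s) * (f s - f2 s)) =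
    intL L (fun s => expR (- s) * f s) - intL L (fun s => expR (- s) * f2 s).
  by rewrite -intLB; [apply: eq_intL => s _; ring|exact: cEm|exact: cEm].
have S2 : intL L (fun s => expR (- s) * (f (- s) - f2 (- s))) =
    intL L (fun s => expR (- s) * f (- s)) - intL L (fun s => expR (- s) * f2 (- s)).
  rewrite -intLB; [by apply: eq_intL => s _; ring|..].
  - by apply: cEm; exact: continuous_negarg.
  - by apply: cEm; exact: continuous_negarg.
rewrite /Ks S1 S2 A2 B2 A1 B1; split; ring.
Qed.

(** The kernel is largest at 0: for [a = exp (- s)] and [b = exp (- (L - s))] one has [a b = q], and
    [(1 - a) (1 - b) >= 0] gives [a + b <= 1 + q]. *)
Lemma Ks_le_int f : continuous f -> (forall s, 0 <= f s) -> (forall s, f (s + L) = f s) ->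
  Ks f <= (1 + q) * intL L f.
Proof.
move=> cf f0 pf.
have -> : Ks f = intL L (fun s => E s * f s) + intL L (fun s => E (L - s) * f s).
  congr (_ + _).
  pose g s := E s * f (- s).
  have cg : continuous g by apply: continuous_mul => //; exact: continuous_negarg.
  have [G dG] := antiderivative (L + 1) g cg.
  have dG' (s : R) : 0 <= s <= L -> is_derive s 1 G (g s).
    by move=> sL; apply: dG; rewrite ltr_norml; lra.
  have -> : intL L g = G L - G 0 by apply: intL_FTC => //; exact: ltW.
  (* Periodicity allows the substitution [s -> L - s], performed on the primitive [G]. *)
  have -> : intL L (fun s => E (L - s) * f s) = intL L (fun s => g (L - s)).
    apply: eq_intL => s _; rewrite /g opprB.
    by have -> : f s = f (s - L) by rewrite -[in LHS](subrK L s) pf.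
  have -> : intL L (fun s => g (L - s)) = - G (L - L) - - G (L - 0).
    apply: (intL_FTC _ _ (fun s => - G (L - s))); first exact: ltW.
  - by move=> s; apply: (@continuous_comp _ _ _ (fun s => L - s) g);
      [apply: cvgB; [exact: cvg_cst|exact: cvg_id]|exact: cg].
  - move=> s sL; have D : is_derive (L - s) 1 G (g (L - s)) by apply: dG'; lra.
    by have := is_deriveN (is_derive_reflect _ _ _ _ D); rewrite opprK.
  by rewrite subrr subr0 opprK addrC.
rewrite -intLD; last 2 first.
- exact: continuous_mul.
- apply: continuous_mul => // s; apply: (@continuous_comp _ _ _ (fun s => L - s) E); last exact: cE.
  by apply: cvgB; [exact: cvg_cst|exact: cvg_id].
rewrite -intLZ//; apply: le_intL.
- apply: continuous_add; apply: continuous_mul => // s.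
  apply: (@continuous_comp _ _ _ (fun s => L - s) E); last exact: cE.
  by apply: cvgB; [exact: cvg_cst|exact: cvg_id].
- by apply: continuous_mul => //; exact: continuous_const.
move=> s /andP[s0 sL]; rewrite -mulrDl ler_wpM2r//.
have a1 : E s <= 1 by rewrite /E expR_le1; lra.
have b1 : E (L - s) <= 1 by rewrite /E expR_le1; lra.
have ab : E s * E (L - s) = q by rewrite /E -expRD /q; congr expR; ring.
have := mulr_ge0 (_ : 0 <= 1 - E s) (_ : 0 <= 1 - E (L - s)).
rewrite !subr_ge0 a1 b1 => /(_ isT isT); lra.
Qed.

(* Going around the period both ways. *)
Lemma oscillation_le y y1 z : (forall s : R, is_derive s 1 y (y1 s)) -> continuous z ->
  (forall s, `|y1 s| <= z s) -> (forall s, y (s + L) = y s) ->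
  2 * (1 - q) * y 0 - Ks y <= (1 - q) * intL L z.
Proof.
move=> dy cz yz py.
have cy : continuous y by move=> s; exact: is_derive_continuous (dy s).
have [G dG] := antiderivative (L + 1) z cz.
have dG' (s : R) : 0 <= s <= L -> is_derive s 1 G (z s).
  by move=> sL; apply: dG; rewrite ltr_norml; lra.
have Iz : intL L z = G L - G 0 by apply: intL_FTC => //; exact: ltW.
have yL : y L = y 0 by rewrite -[in RHS]py add0r.
have D s : 0 <= s <= L -> y 0 - y s <= 2^-1 * intL L z.
  move=> sL.
  have m1 : - (y s + G s) <= - (y 0 + G 0).
    apply: (@nonincreasing_is_derive _ (fun s => - (y s + G s)) (fun s => - (y1 s + z s))).
    - lra.
    - move=> r rs; apply: is_derive_continuous; apply: is_deriveN.
      by apply: is_derive_add; apply: dG'; lra.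
    - move=> r rs; apply: is_deriveN.
      by apply: is_derive_add; apply: dG'; lra.
    - by move=> r _; have := yz r; rewrite ler_norml; lra.
  have m2 : y L - G L <= y s - G s.
    apply: (@nonincreasing_is_derive _ (fun s => y s - G s) (fun s => y1 s - z s)).
    - lra.
    - move=> r rs; apply: is_derive_continuous.
      by apply: is_derive_sub; apply: dG'; lra.
    - by move=> r rs; apply: is_derive_sub; apply: dG'; lra.
    - by move=> r _; have := yz r; rewrite ler_norml; lra.
  by rewrite Iz; lra.
have le1 (w : R -> R) : continuous w -> (forall s, 0 <= s <= L -> y 0 - 2^-1 * intL L z <= w s) ->
    (1 - q) * (y 0 - 2^-1 * intL L z) <= intL L (fun s => expR (- s) * w s).
  move=> cw wy.
  have Hc := Ks_cst (y 0 - 2^-1 * intL L z).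
  have : intL L (fun s => expR (- s) * (y 0 - 2^-1 * intL L z)) <=
      intL L (fun s => expR (- s) * w s).
    apply: le_intL; [|exact: continuous_mul|].
      by apply: continuous_mul; [exact: cE|exact: continuous_const].
    by move=> s sL; rewrite ler_wpM2l ?expR_ge0// wy.
  by move: Hc; rewrite /Ks; lra.
have A1 := le1 y cy; have A2 := le1 (fun s => y (- s)) (continuous_negarg _ cy).
have {}A1 : (1 - q) * (y 0 - 2^-1 * intL L z) <= intL L (fun s => expR (- s) * y s).
  by apply: A1 => s sL; have := D s sL; lra.
have {}A2 : (1 - q) * (y 0 - 2^-1 * intL L z) <= intL L (fun s => expR (- s) * y (- s)).
  apply: A2 => s sL; have := D (L - s); rewrite -(py (- s)) (addrC (- s)); lra.
by rewrite /Ks; lra.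
Qed.

End PeriodicConvolution.

Section RiccatiBound.
Context {R : realType}.

(** This is [L coth (L/2) <= 14/5]. Multiplied by [exp L] it reads [14/5 + L <= (14/5 - L) exp L],
    for which [exp L >= (1 + L/2)^2] suffices. At [L = 1] the left side is about 2.16, so 14/5
    leaves room for this crude bound and stays below the critical value 3. *)
Lemma kernel_constant_le (L : R) : 0 < L -> L <= 1 ->
  L * (1 + expR (- L)) <= 14 / 5 * (1 - expR (- L)).
Proof.
move=> L0 L1; set q := expR (- L).
have q0 : 0 < q by exact: expR_gt0.
have r1 : (1 + L / 2) ^+ 2 <= expR L.
  have -> : expR L = expR (L / 2) ^+ 2 by rewrite -expRM_natl; congr expR; field.
  have h := expR_ge1Dx (L / 2).
  by apply: lerXn2r; rewrite ?nnegrE ?expR_ge0//; lra.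
have qr : q * expR L = 1 by rewrite /q -expRD addNr expR0.
have H : 14 / 5 + L <= (14 / 5 - L) * expR L.
  apply: (@le_trans _ _ ((14 / 5 - L) * (1 + L / 2) ^+ 2)); last first.
    by rewrite ler_wpM2l//; lra.
  have -> : (14 / 5 - L) * (1 + L / 2) ^+ 2 =
    14 / 5 + L + L * (4 / 5 - 3 / 10 * L - L ^+ 2 / 4) by field.
  have L2 : L ^+ 2 <= 1 by rewrite expr_le1// ltW.
  by rewrite lerDl mulr_ge0//; lra.
have := ler_wpM2l (ltW q0) H.
have -> : q * ((14 / 5 - L) * expR L) = (14 / 5 - L) * (q * expR L) by ring.
rewrite qr; lra.
Qed.

Variables (L : R) (u u1 u2 y0 dy0 y1 : R -> R).
Hypotheses (L0 : 0 < L) (L1 : L <= 1).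
Hypotheses (du : forall s : R, is_derive s 1 u (u1 s))
  (du1 : forall s : R, is_derive s 1 u1 (u2 s)) (cu2 : continuous u2)
  (pu : forall s, u (s + L) = u s) (pu1 : forall s, u1 (s + L) = u1 s).
Hypotheses (dy : forall s : R, is_derive s 1 y0 (dy0 s))
  (dyle : forall s, `|dy0 s| <= y0 s + y1 s) (py0 : forall s, y0 (s + L) = y0 s)
  (cy1 : continuous y1) (py1 : forall s, y1 (s + L) = y1 s).
Hypotheses (uy0 : forall s, u s ^+ 2 <= y0 s) (uy1 : forall s, u1 s ^+ 2 <= y1 s).

(* At a minimum of u1 = u', where u2 = 0, the time derivative of u1 is
   H - G * H with H = u (u - u'') + (y0 - y1) / 2. *)
Lemma riccati_bound (H : R -> R) : u2 0 = 0 ->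
  (forall s, H s = u s * (u s - u2 s) + (y0 s - y1 s) / 2) ->
  2 * (1 - expR (- L)) * H 0 - Ks L H <=
  2 * (1 - expR (- L)) * (- (u1 0 ^+ 2) / 2
    + 19 / 20 * (L^-1 * intL L (fun s => y0 s + y1 s))).
Proof.
move=> u20 HE; set q := expR (- L).
have q1 : q < 1 by rewrite /q expR_lt1 oppr_lt0.
have cu : continuous u by move=> s; exact: is_derive_continuous (du s).
have cu1 : continuous u1 by move=> s; exact: is_derive_continuous (du1 s).
have cy0 : continuous y0 by move=> s; exact: is_derive_continuous (dy s).
(* With [g = u^2] and [w = u'^2] one has [u (u - u'') = (g - g'') / 2 + g / 2 + w]. The Green
   function evaluates the first part exactly, as [g 0]; the second derivative of [u] disappears from
   the estimate. *)
pose g s := u s * u s.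
pose g1 s := u s * u1 s + u s * u1 s.
pose g2 s := (u s * u2 s + u1 s * u1 s) + (u s * u2 s + u1 s * u1 s).
pose w s := u1 s * u1 s.
have dg (s : R) : is_derive s 1 g (g1 s) by apply: is_derive_mul.
have dg1 (s : R) : is_derive s 1 g1 (g2 s).
  by apply: is_derive_add; apply: is_derive_mul.
have cg : continuous g by exact: continuous_mul.
have cw : continuous w by exact: continuous_mul.
have cg2 : continuous g2.
  by apply: continuous_add; apply: continuous_add; exact: continuous_mul.
have [Kg _] : _ /\ _ := Ks_green L L0 g g1 g2 dg dg1 cg2
  (fun s => f_equal2 *%R (pu s) (pu s))
  (fun s => f_equal2 +%R (f_equal2 *%R (pu s) (pu1 s)) (f_equal2 *%R (pu s) (pu1 s))).
rewrite -/q in Kg.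
have cgg2 : continuous (fun s => g s - g2 s) by exact: continuous_sub.
have KH : Ks L H = 2^-1 * Ks L (fun s => g s - g2 s) + 2^-1 * Ks L g + Ks L w +
    2^-1 * Ks L y0 - 2^-1 * Ks L y1.
  transitivity (Ks L (fun s => 1 * (2^-1 * (g s - g2 s) + 2^-1 * g s) +
      1 * (1 * (1 * w s + 2^-1 * y0 s) + - 2^-1 * y1 s))).
    congr (Ks L _); apply/funext => s; rewrite HE /g /g2 /w; lra.
  have c1 : continuous (fun s => 2^-1 * (g s - g2 s) + 2^-1 * g s).
    by apply: continuous_add; apply: continuous_mul => //; exact: continuous_const.
  have c2 : continuous (fun s => 1 * w s + 2^-1 * y0 s).
    by apply: continuous_add; apply: continuous_mul => //; exact: continuous_const.
  have c3 : continuous (fun s => 1 * (1 * w s + 2^-1 * y0 s) + - 2^-1 * y1 s).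
    by apply: continuous_add; apply: continuous_mul => //; exact: continuous_const.
  rewrite (Ks_lin _ _ _ _ _ c1 c3) (Ks_lin _ _ _ _ _ cgg2 cg).
  rewrite (Ks_lin _ _ _ _ _ c2 cy1) (Ks_lin _ _ _ _ _ cw cy0); lra.
have cz1 : continuous (fun s => g s + w s) by exact: continuous_add.
have cz2 : continuous (fun s => y0 s + y1 s) by exact: continuous_add.
have O1 : 2 * (1 - q) * g 0 - Ks L g <= (1 - q) * intL L (fun s => g s + w s).
  apply: (oscillation_le _ L0 g g1 (fun s => g s + w s) dg cz1).
    by move=> s; rewrite ler_norml /g1 /g /w; have := sqr_ge0 (u s - u1 s);
      have := sqr_ge0 (u s + u1 s); rewrite !expr2; nra.
  by move=> s; rewrite /g pu.
have O2 : 2 * (1 - q) * y0 0 - Ks L y0 <= (1 - q) * intL L (fun s => y0 s + y1 s).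
  exact: (oscillation_le _ L0 y0 dy0 (fun s => y0 s + y1 s) dy cz2).
have cyw : continuous (fun s => y1 s - w s) by exact: continuous_sub.
(* The term [- y1 / 2] of [H] enters with the bad sign, but its part [w] is compensated by the
   [Ks L w] gained above. Only the excess [y1 - w], due to the components transverse to [theta],
   meets the maximum of the kernel. *)
have W : Ks L y1 - Ks L w <= (1 + q) * intL L (fun s => y1 s - w s).
  have := Ks_le_int L L0 (fun s => y1 s - w s) cyw.
  have -> : Ks L (fun s => y1 s - w s) = Ks L y1 - Ks L w.
    have := Ks_lin L y1 w 1 (- 1) cy1 cw; rewrite mul1r mulN1r => <-.
    by congr (Ks L _); apply/funext => s; rewrite mul1r mulN1r.
  apply=> s; last by rewrite /w py1 pu1.
  by rewrite subr_ge0 /w -expr2.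
have Kw : 0 <= Ks L w.
  have := le_Ks L (fun=> 0) w (continuous_const 0) cw; rewrite Ks_cst// mulr0.
  by apply=> s; rewrite /w -expr2 sqr_ge0.
have int_le : intL L (fun s => g s + w s) + intL L (fun s => y1 s - w s) <=
    intL L (fun s => y0 s + y1 s).
  rewrite -intLD//; apply: le_intL => //; first exact: continuous_add.
  by move=> s _; have := uy0 s; rewrite /g expr2; lra.
have I00 : intL L (fun=> 0) = 0 :> R by rewrite intL_cst ?mul0r//; exact: ltW.
have IU0 : 0 <= intL L (fun s => g s + w s).
  have := le_intL L (fun=> 0) (fun s => g s + w s) (continuous_const 0) cz1.
  rewrite I00; apply => s _.
  by rewrite /g /w -!expr2 addr_ge0 ?sqr_ge0.
have IW0 : 0 <= intL L (fun s => y1 s - w s).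
  have := le_intL L (fun=> 0) (fun s => y1 s - w s) (continuous_const 0) cyw.
  rewrite I00; apply => s _.
  by rewrite subr_ge0 /w -expr2.
have H0 : H 0 = g 0 + (y0 0 - y1 0) / 2 by rewrite HE u20 subr0.
have Y1 : u1 0 ^+ 2 <= y1 0 by [].
have kc := kernel_constant_le L L0 L1; rewrite -/q in kc.
move: O1 O2 W Kw int_le IU0 IW0; rewrite H0 KH Kg.
set IU := intL L (fun s => g s + w s); set IW := intL L (fun s => y1 s - w s).
set I := intL L (fun s => y0 s + y1 s).
move: (Ks L g) (Ks L w) (Ks L y0) (Ks L y1) => Kg' Kw' Ky0 Ky1.
move=> O1 O2 W Kw int_le IU0 IW0.
(* In units of [c], [IU] and [I] get weight 1/2 and [IW] gets 7/5, half of 14/5. As [IU + IW <= I],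
   the worst case is [IW = I], with total [1/2 + 7/5 = 19/10]; division by [2 (1 - q)] turns this
   into 19/20 of the mean. *)
pose c := (1 - q) / L.
have c0 : 0 < c by rewrite divr_gt0// subr_gt0.
have cL : 1 - q <= c by rewrite /c ler_pdivlMr// ger_pMr// subr_gt0.
have kq : 1 + q <= 14 / 5 * c.
  by rewrite /c mulrA ler_pdivlMr// mulrC.
have -> : 2 * (1 - q) * (- (u1 0 ^+ 2) / 2 + 19 / 20 * (L^-1 * I)) =
  - (1 - q) * u1 0 ^+ 2 + 19 / 10 * c * I by rewrite /c; field; rewrite gt_eqF.
have h1 : (1 - q) * (IU + I) <= c * (IU + I) by apply: ler_wpM2r => //; lra.
have h2 : (1 + q) * IW <= 14 / 5 * c * IW by apply: ler_wpM2r.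
have h3 : c * (IU + IW) <= c * I by apply: ler_wpM2l => //; exact: ltW.
have h4 : (1 - q) * u1 0 ^+ 2 <= (1 - q) * y1 0 by apply: ler_wpM2l => //; lra.
have h5 : 0 <= c * IU by rewrite mulr_ge0// ltW.
lra.
Qed.

End RiccatiBound.

(** * Comparison of a spatial minimum with a barrier *)

Section Barrier.
Context {R : realType} {d : nat}.

(** At the supremum of the times up to which [P] has held, the left-limit hypothesis gives [P] and
    the right-extension hypothesis passes beyond it. *)
Lemma real_induction (P : R -> Prop) (T : R) : P 0 ->
  (forall t, 0 <= t < T -> P t -> exists2 r : R, 0 < r & forall s, t <= s < t + r -> P s) ->
  (forall t, 0 < t < T -> (forall s, 0 <= s < t -> P s) -> P t) ->
  forall t, 0 <= t < T -> P t.
Proof.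
move=> P0 Pr Pl t1 /andP[t10 t1T].
pose S := [set s : R | 0 <= s <= t1 /\ forall r, 0 <= r <= s -> P r].
have S0 : S 0.
  by split; [rewrite lexx|move=> r r0; have -> : r = 0 by lra].
have hS : has_sup S by split; [exists 0|exists t1 => s [/andP[_ ]]].
set m := sup S.
have m0 : 0 <= m by apply: sup_upper_bound.
have mt1 : m <= t1 by apply: ge_sup; [exists 0|move=> s [/andP[_ ]]].
have below s : 0 <= s < m -> P s.
  move=> /andP[s0 sm].
  have ms0 : 0 < m - s by rewrite subr_gt0.
  have [r [_ Hr] mr] := sup_adherent ms0 hS.
  by apply: Hr; move: mr; rewrite -/m; lra.
have Pm : P m.
  move: m0; rewrite le_eqVlt => /predU1P[<-//|m0].
  by apply: Pl => //; lra.
have mT : 0 <= m < T by lra.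
have [r r0 Hr] := Pr m mT Pm.
have [mt|mt] := ltP m t1; last by have -> : t1 = m by lra.
exfalso.
pose s := m + Num.min (t1 - m) (r / 2).
have k0 : 0 < Num.min (t1 - m) (r / 2) by rewrite lt_min; lra.
have k1 : Num.min (t1 - m) (r / 2) <= t1 - m by rewrite ge_min lexx.
have k2 : Num.min (t1 - m) (r / 2) <= r / 2 by rewrite ge_min lexx orbT.
have : s <= m.
  apply: sup_upper_bound => //; split; first by rewrite /s; lra.
  move=> z zs; have [zm|mz] := ltP z m; first by apply: below; lra.
  by apply: Hr => //; rewrite /s in zs; lra.
by rewrite /s; lra.
Qed.

Lemma tuc_min (g : R -> 'rV[R]_d -> R) t : tuc g ->
  exists x : 'rV[R]_d, forall y, g t x <= g t y.
Proof.
move=> [ug pg _]; pose K := [set x : 'rV[R]_d | forall i, `[0, 1]%classic (x ord0 i)].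
have K0 : K !=set0 by exists 0 => i /=; rewrite in_itv/= mxE lexx ler01.
have cK : compact K by exact: box_compact.
have cg : {within K, continuous (g t)}.
  by apply: continuous_subspaceT; exact: ucb_continuous.
have [x _ xmin] := EVT_min_rV K0 cK cg.
exists x => y; have [z z01 ->] := per_reduce _ (pg t) y.
apply: xmin; rewrite inE => i /=; rewrite in_itv/=; have := z01 i; lra.
Qed.

(* The infimum of g (t, .) cannot cross the barrier b (t) = -1 / (a - t / 50),
   which reaches -oo in finite time: where they touch, g' <= -g^2/2 + 19/20 e0
   and g^2 >= 2 e0 give g' <= -b^2 / 40 < -b^2 / 50 = b'. Any constant below 1
   would do in place of 19/20. *)
Lemma riccati_barrier (g : R -> 'rV[R]_d -> R) (e0 : R) (x0 : 'rV[R]_d) : tuc g -> 0 <= e0 ->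
  (forall (t : R) x, 0 < t -> (forall y, g t x <= g t y) ->
    exists2 c : R, is_derive t 1 (g ^~ x) c & c <= - (g t x ^+ 2) / 2 + 19 / 20 * e0) ->
  g 0 x0 < - Num.sqrt (2 * e0) -> False.
Proof.
move=> tg e00 rate g0; have [ug pg cg] := tg.
(* Strictly between [g 0 x0] and [- sqrt (2 e0)]: the first gap excludes contact at time 0, where no
   derivative is available; the second keeps [b^2 >= 2 e0] along the decreasing barrier. *)
pose b0 := (g 0 x0 - Num.sqrt (2 * e0)) / 2.
have sq0 := sqrtr_ge0 (2 * e0).
have b0g : g 0 x0 < b0 by rewrite /b0; lra.
have b0s : b0 < - Num.sqrt (2 * e0) by rewrite /b0; lra.
have b0n : b0 < 0 by lra.
pose a := - b0^-1.
have a0 : 0 < a by rewrite /a oppr_gt0 invr_lt0.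
pose k : R := 50^-1.
have k0 : 0 < k by rewrite /k; lra.
pose b (t : R) := - (a - k * t)^-1.
pose T : R := a / k.
have T0 : 0 < T by rewrite divr_gt0.
have den (t : R) : t < T -> 0 < a - k * t.
  by rewrite /T ltr_pdivlMr// mulrC subr_gt0.
have b0E : b 0 = b0 by rewrite /b /a mulr0 subr0 invrN invrK opprK.
have db (t : R) : 0 <= t -> t < T -> is_derive t 1 b (- k * b t ^+ 2).
  move=> _ tT; have [D1 D2] := is_derive_affine a (- k) t.
  have dn : a + t * - k != 0 by rewrite mulrN mulrC gt_eqF ?den.
  have -> : b = - (fun s => (a + s * - k)^-1).
    by apply/funext => s; rewrite fctE /b mulrN mulrC.
  have DV : is_derive t 1 (fun s => (a + s * - k)^-1) (- (a + t * - k) ^- 2 *: - k).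
    by split; [exact: derivableV|rewrite deriveV// D2].
  have := is_deriveN DV; congr is_derive.
  by rewrite fctE /GRing.scale/= sqrrN exprVn; ring.
have ble (t : R) : 0 <= t -> t < T -> b t <= b0.
  move=> t0 tT; rewrite -b0E lerN2 lef_pV2 ?posrE ?den// mulr0 subr0.
  by rewrite lerBlDr lerDl mulr_ge0// ltW.
have bsq (t : R) : 0 <= t -> t < T -> 2 * e0 <= b t ^+ 2.
  move=> t0 tT; have := ble t t0 tT; rewrite -[2 * e0]sqr_sqrtr ?mulr_ge0//.
  set q := Num.sqrt _ in sq0 b0s *; move=> bb; rewrite -[b t ^+ 2]sqrrN lerXn2r ?nnegrE//; lra.
have bcont (t : R) : 0 <= t -> t < T -> forall e : R, 0 < e ->
    exists2 r : R, 0 < r & forall s : R, `|s - t| < r -> `|b s - b t| <= e.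
  move=> t0 tT e e00'.
  have C : {for t, continuous b} by have D := db t t0 tT; exact: is_derive_continuous D.
  have N : nbhs t (fun s => `|b t - b s| <= e) by move: C => /cvgrPdist_le; apply.
  have [r r0 Hr] := nbhs_distP _ _ N.
  by exists r => // s st; rewrite distrC; apply: Hr; rewrite distrC.
pose P (t : R) := exists x, g t x <= b t.
have PT : forall t, 0 <= t < T -> P t.
  apply: real_induction.
  - by exists x0; rewrite b0E ltW.
  - move=> t /andP[t0 tT] [x' gx'].
    have [y ymin] := tuc_min g t tg; have gy := le_trans (ymin x') gx'.
    move: gy; rewrite le_eqVlt => /predU1P[gE|gl].
      have tp : 0 < t.
        rewrite lt_neqAle t0 andbT; apply/eqP => tE; move: gE; rewrite -tE b0E => gE.
        by have := ymin x0; rewrite -tE gE; lra.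
      have [c Dc cle] := rate t y tp ymin.
      have B0 : 0 < b t ^+ 2 by rewrite exprn_even_gt0//= lt_eqF//; have := ble t t0 tT; lra.
      (* The slopes differ by at least [b^2 (1/40 - 1/50) = b^2 / 200]; half of this for each of the
         two remainders keeps [g] at the contact point below the barrier for a while. *)
      have e400 : 0 < b t ^+ 2 / 400 by lra.
      have /is_derive_epsP/(_ _ e400)[r1 r10 H1] := Dc.
      have /is_derive_epsP/(_ _ e400)[r2 r20 H2] := db t t0 tT.
      exists (Num.min r1 r2); first by rewrite lt_min r10.
      move=> s /andP[ts str]; exists y.
      have st0 : 0 <= s - t by lra.
      have : s - t < Num.min r1 r2 by lra.
      rewrite lt_min => /andP[s1 s2].
      have := H1 s; have := H2 s; rewrite !(ger0_norm st0) => /(_ s2) + /(_ s1).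
      have := bsq t t0 tT; rewrite gE in cle *.
      rewrite !ler_norml /k; move: (b t ^+ 2) B0 cle => B B0 cle Be.
      have : (s - t) * c <= (s - t) * (- B / 40) by rewrite ler_wpM2l//; lra.
      have : 0 <= (s - t) * B by rewrite mulr_ge0// ltW.
      move: (b s) (b t) (g s y) => bs bt gs; lra.
    have e3 : 0 < (b t - g t y) / 2 by lra.
    have [r1 r10 H1] := cg t _ e3; have [r2 r20 H2] := bcont t t0 tT _ e3.
    exists (Num.min r1 r2); first by rewrite lt_min r10.
    move=> s /andP[ts str]; exists y.
    have st0 : 0 <= s - t by lra.
    have : s - t < Num.min r1 r2 by lra.
    rewrite lt_min => /andP[s1 s2].
    have := H1 s; have := H2 s; rewrite !(ger0_norm st0) => /(_ s2) + /(_ s1 y).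
    by rewrite !ler_norml; lra.
  - move=> t /andP[t0 tT] Ps; have [y ymin] := tuc_min g t tg; exists y.
    rewrite leNgt; apply/negP => bg.
    (* If the minimum at [t] were above the barrier, then at a slightly earlier time, after moves of
       at most a third of the gap by [g] (uniformly in space) and by [b], every value of [g] would
       still be above it, against [Ps]. *)
    have e3 : 0 < (g t y - b t) / 3 by lra.
    have [r1 r10 H1] := cg t _ e3; have [r2 r20 H2] := bcont t (ltW t0) tT _ e3.
    pose m := Num.min t (Num.min r1 r2).
    have m0 : 0 < m by rewrite !lt_min t0 r10.
    have [mt mr1 mr2] : [/\ m <= t, m <= r1 & m <= r2].
      by split; rewrite /m !ge_min lexx ?orbT.
    have sN : `|t - m / 2 - t| = m / 2 by rewrite addrAC subrr sub0r normrN ger0_norm//; lra.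
    have s01 : 0 <= t - m / 2 < t by lra.
    have [x gx] := Ps _ s01.
    have := H1 (t - m / 2); have := H2 (t - m / 2); rewrite sN => h2 h1.
    have := ymin x; have : m / 2 < r1 by lra.
    move=> /h1/(_ x); have : m / 2 < r2 by lra.
    by move=> /h2; rewrite !ler_norml; lra.
have [M M0 HM] := tuc_bounded g T tg.
(* At time [(a - m) / k], just before [T], the barrier equals [- 1 / m <= - (M + 1)], below the
   bound [M] for [|g|] on [[0, T]]. *)
pose m := Num.min a (M + 1)^-1.
have m0 : 0 < m by rewrite lt_min a0 invr_gt0; lra.
have ma : m <= a by rewrite ge_min lexx.
have mM : m <= (M + 1)^-1 by rewrite ge_min lexx orbT.
have tT : 0 <= (a - m) / k < T.
  by rewrite divr_ge0 ?subr_ge0 ?(ltW k0)//= ltr_pM2r ?invr_gt0//; lra.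
have [x] := PT _ tT; rewrite /b.
have -> : a - k * ((a - m) / k) = m by field; exact: lt0r_neq0.
have : M + 1 <= m^-1 by rewrite -[leLHS]invrK lef_pV2 ?posrE ?invr_gt0//; lra.
have : `|g ((a - m) / k) x| <= M by apply: HM; lra.
by rewrite ler_norml; lra.
Qed.

End Barrier.

(** * Energy and slope of a plane wave solution *)

Section WeightedDerivative.
Context {R : realType}.

Lemma is_derive_weighted_intL {X : Type} (L : R) (p : R -> R) (c : R -> X) (F : R -> X -> R) (t : R)
    (g : X -> R) : 0 <= L -> continuous p -> (forall s, 0 <= s <= L -> 0 <= p s <= 1) ->
  (forall s, continuous (fun r => F s (c r))) -> continuous (fun r => g (c r)) -> udiff F t g ->
  is_derive t 1 (fun s => intL L (fun r => p r * F s (c r))) (intL L (fun r => p r * g (c r))).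
Proof.
move=> L0 cp p01 cF cg Fg; apply/is_derive_epsP => e e0.
have eL : 0 < e / (L + 1) by rewrite divr_gt0//; lra.
have [r r0 Hr] := Fg _ eL; exists r => // s /Hr sr.
have c1 s' := continuous_mul _ _ cp (cF s'); have c2 := continuous_mul _ _ cp cg.
have c3 := continuous_mul _ _ (continuous_const (s - t)) c2.
have c4 := continuous_sub _ _ (c1 s) (c1 t).
rewrite -intLB// -intLZ// -intLB//.
apply: (@le_trans _ _ (e / (L + 1) * `|s - t| * L)).
  apply: intL_norm_le => //; first exact: continuous_sub.
  move=> z zL; have /andP[pz0 pz1] := p01 z zL.
  have -> : p z * F s (c z) - p z * F t (c z) - (s - t) * (p z * g (c z)) =
    p z * (F s (c z) - F t (c z) - (s - t) * g (c z)) by ring.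
  rewrite normrM (ger0_norm pz0) -[leRHS]mul1r.
  by apply: ler_pM => //; exact: sr.
rewrite mulrAC ler_wpM2r// mulrAC ler_pdivrMr; last lra.
by rewrite ler_wpM2l ?ltW//; lra.
Qed.

(** A product rule in which the second factor vanishes at [t], so continuity in time suffices for
    the first one. In the energy, the first factor is built from velocities and the second is an
    increment of momentum. *)
Lemma udiff_mul0 {X : Type} (f1 f2 : R -> X -> R) (t M : R) (g : X -> R) :
  (forall x, `|f1 t x| <= M) -> (forall x, `|g x| <= M) ->
  (forall e : R, 0 < e -> exists2 r : R, 0 < r & forall s : R, `|s - t| < r ->
    forall x, `|f1 s x - f1 t x| <= e) ->
  (forall x, f2 t x = 0) -> udiff f2 t g ->
  udiff (fun s x => f1 s x * f2 s x) t (fun x => f1 t x * g x).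
Proof.
move=> f1M gM cf1 f20 d2 e e0.
pose M' := `|M| + 1; have M'0 : 0 < M' by rewrite /M'; have := normr_ge0 M; lra.
have MM : M <= M' by rewrite /M'; have := ler_norm M; lra.
have e1 : 0 < e / (2 * M') by rewrite divr_gt0// mulr_gt0.
have [r1 r10 H1] := cf1 _ e1.
have e2 : 0 < e / (2 * (2 * M')) by rewrite divr_gt0// !mulr_gt0.
have [r2 r20 H2] := d2 _ e2.
have [r3 r30 H3] := cf1 _ M'0.
exists (Num.min r1 (Num.min r2 r3)); first by rewrite !lt_min r10 r20.
move=> s; rewrite !lt_min => /andP[/H1 h1 /andP[/H2 h2 /H3 h3]] x.
rewrite f20 mulr0 subr0.
have -> : f1 s x * f2 s x - (s - t) * (f1 t x * g x) =
  f1 s x * (f2 s x - f2 t x - (s - t) * g x) + (s - t) * ((f1 s x - f1 t x) * g x).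
  by rewrite f20; ring.
apply: (le_trans (ler_normD _ _)); rewrite !normrM.
have A : `|f1 s x| * `|f2 s x - f2 t x - (s - t) * g x| <=
    (2 * M') * (e / (2 * (2 * M')) * `|s - t|).
  apply: ler_pM => //.
  have -> : f1 s x = (f1 s x - f1 t x) + f1 t x by ring.
  apply: (le_trans (ler_normD _ _)); have := h3 x; have := f1M x; lra.
have B : `|s - t| * (`|f1 s x - f1 t x| * `|g x|) <= `|s - t| * (e / (2 * M') * M').
  apply: ler_wpM2l => //; apply: ler_pM => //.
  exact: le_trans (gM x) MM.
have E1 : (2 * M') * (e / (2 * (2 * M')) * `|s - t|) = e / 2 * `|s - t|.
  by field; exact: lt0r_neq0.
have E2 : `|s - t| * (e / (2 * M') * M') = e / 2 * `|s - t|.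
  by field; exact: lt0r_neq0.
by rewrite E1 in A; rewrite E2 in B; lra.
Qed.

End WeightedDerivative.

Section Frozen.
Context {R : realType} {d : nat}.

(** Lemmas about curves at one common time thereby apply to two functions taken at different
    times. *)
Lemma tC_freeze m (F : R -> 'rV[R]_d -> R) (s : R) : tC m F -> tC m (fun=> F s).
Proof.
have T G : tuc G -> tuc (fun=> G s).
  move=> [uG pG _]; split => [t|t|t e e0]; [exact: uG|exact: pG|].
  by exists 1 => // r _ x; rewrite subrr normr0 ltW.
elim: m F => [|m IH] F tF; first by split => //; exact: T (tC_tuc _ _ tF).
split; first exact: T (tC_tuc _ _ tF).
have [_ [dF pF']] := tF; split; first by move=> _; exact: dF.
by move=> j; exact: (IH (fun t => partial j (F t)) (pF' j)).
Qed.

Lemma torus_integral_momentum_sym (F G : R -> 'rV[R]_d -> R) t s : tC 2 F -> tC 2 G ->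
  torus_integral (fun x => F t x * (G s x - laplacian (G s) x)) =
  torus_integral (fun x => G s x * (F t x - laplacian (F t) x)).
Proof.
have H (F' G' : R -> 'rV[R]_d -> R) (a b : R) : tC 2 F' -> tC 2 G' ->
    torus_integral (fun x => F' a x * (G' b x - laplacian (G' b) x)) =
    torus_integral (fun x => F' a x * G' b x) +
    torus_integral (fun x => \sum_(j < d) partial j (F' a) x * partial j (G' b) x).
  move=> tF tG; have [uF _ _] := tC_tuc _ _ tF; have [uG _ _] := tC_tuc _ _ tG.
  have upF j : ucb (partial j (F' a)) by have [] := tC_tuc _ _ (tC_partial _ _ j tF).
  have upG j : ucb (partial j (G' b)) by have [] := tC_tuc _ _ (tC_partial _ _ j tG).
  have uppG j : ucb (partial j (partial j (G' b))).
    by have [] := tC_tuc _ _ (tC_partial _ _ j (tC_partial _ _ j tG)).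
  have -> : (fun x => F' a x * (G' b x - laplacian (G' b) x)) =
     (fun x => F' a x * G' b x - \sum_(j < d) F' a x * partial j (partial j (G' b)) x).
    by apply/funext => x; rewrite mulrBr /laplacian mulr_sumr.
  rewrite torus_integralB; [|exact: ucbM|by apply: ucb_sum => j; exact: ucbM].
  congr (_ + _); rewrite !torus_integral_sum; [|by move=> j; exact: ucbM..].
  rewrite -sumrN; apply: eq_bigr => j _.
  have E : torus_integral (fun x => F' a x * partial j (partial j (G' b)) x) =
      - torus_integral (fun x => partial j (F' a) x * partial j (G' b) x).
    exact (tC_by_parts (fun=> F' a) (fun=> partial j (G' b)) 0 j
      (tCS _ _ (tC_freeze _ _ a tF)) (tC_partial _ _ j (tC_freeze _ _ b tG))).
  by rewrite E opprK.
move=> tF tG; apply: (etrans (H F G t s tF tG)); apply: (etrans _ (esym (H G F s t tG tF))).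
congr (_ + _); congr torus_integral; apply/funext => x.
  exact: mulrC.
by apply: eq_bigr => j _; exact: mulrC.
Qed.

End Frozen.

(** * The energy of a plane wave and its increments *)

Section EnergyIdentities.
Context {R : realType} {d : nat} (theta : 'rV[R]_d).

Lemma tC1M (F G : R -> 'rV[R]_d -> R) : tC 1 F -> tC 1 G -> tC 1 (fun t x => F t x * G t x).
Proof.
move=> tF tG; have tF0 := tC_tuc _ _ tF; have tG0 := tC_tuc _ _ tG.
have D t x v (p q : R) : is_derive x v (F t) p -> is_derive x v (G t) q ->
    is_derive x v (fun x => F t x * G t x) (F t x * q + G t x * p).
  by move=> Dp Dq; exact: (@is_deriveM _ _ (F t) (G t) x v p q Dp Dq).
have pE t j : partial j (fun x => F t x * G t x) =
    (fun x => F t x * partial j (G t) x + G t x * partial j (F t) x).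
  by apply/funext => x; apply: is_derive_val; apply: D; [exact: partial_tC tF|exact: partial_tC tG].
split; first exact: tucM.
split.
- move=> t x v; have [_ [dF _]] := tF; have [_ [dG _]] := tG.
  have := D t x v _ _ (dF t x v) (dG t x v); congr is_derive.
  by rewrite !mulr_sumr -big_split/=; apply: eq_bigr => j _; rewrite pE; ring.
- move=> j; under eq_fun do rewrite pE; split => //.
  by apply: tucD; apply: tucM => //; [exact: tC_tuc (tC_partial _ _ j tG)|
    exact: tC_tuc (tC_partial _ _ j tF)].
Qed.

Lemma tC1_mulD (F G : R -> 'rV[R]_d -> R) t x : tC 1 F -> tC 1 G ->
  is_derive x theta (fun x => F t x * G t x) (F t x * Dth theta G t x + G t x * Dth theta F t x).
Proof.
move=> tF tG; have DF := is_derive_tC theta 0 _ t x tF; have DG := is_derive_tC theta 0 _ t x tG.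
exact: (@is_deriveM _ _ (F t) (G t) x theta _ _ DF DG).
Qed.

Lemma torus_integral_Dth (F : R -> 'rV[R]_d -> R) t : tC 1 F -> torus_integral (Dth theta F t) = 0.
Proof.
move=> tF; have [uF pF _] := tC_tuc _ _ tF.
have upF j : ucb (partial j (F t)) by have [] := tC_tuc _ _ (tC_partial _ _ j tF).
have -> : Dth theta F t = (fun x => \sum_(j < d) theta 0 j * partial j (F t) x).
  by apply/funext => x; exact: DthE tF.
rewrite torus_integral_sum; last by move=> j; exact: ucbZ.
rewrite big1// => j _; rewrite torus_integralZ// torus_integral_partial ?mulr0//.
by move=> x; have [] := partial_tC _ _ t x j tF.
Qed.

(** Difference of two values of a quadratic form, by symmetry: [<a, c> - <b, e> = <a + b, c - e>]
    when [<a, e> = <b, c>]. It is applied to velocities [a], [b] and their momenta [c], [e]. *)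
Lemma torus_integral_polarize (a b c e : 'rV[R]_d -> R) : ucb a -> ucb b -> ucb c -> ucb e ->
  torus_integral (fun x => a x * e x) = torus_integral (fun x => b x * c x) ->
  torus_integral (fun x => a x * c x) = torus_integral (fun x => b x * e x) +
    torus_integral (fun x => (a x + b x) * (c x - e x)).
Proof.
move=> ua ub uc ue S.
have E : (fun x => (a x + b x) * (c x - e x)) =
    (fun x => (a x * c x - a x * e x) + (b x * c x - b x * e x)).
  by apply/funext => x; ring.
have u1 := ucbM _ _ ua uc; have u2 := ucbM _ _ ua ue.
have u3 := ucbM _ _ ub uc; have u4 := ucbM _ _ ub ue.
rewrite E torus_integralD ?torus_integralB//; [|exact: ucbB..].
by rewrite S; ring.
Qed.

Hypothesis theta1 : dot theta theta = 1.
Variable w : R -> 'rV[R]_d -> 'rV[R]_d.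
Hypotheses (sw : smooth_EP w) (pw : forall t, plane_wave theta (w t)).

Let W (i : 'I_d) := wave w i.
Let M (i : 'I_d) := waveM theta w i.
Let tW i : tC 3 (W i). Proof. exact: tC_wave. Qed.
Let tM i : tC 1 (M i). Proof. exact: tC_waveM. Qed.
Let tD i : tC 2 (Dth theta (W i)). Proof. exact: tC_Dth. Qed.

Definition energy_density (t : R) (x : 'rV[R]_d) : R :=
  \sum_(i < d) wave w i t x ^+ 2 + \sum_(i < d) Dth theta (wave w i) t x ^+ 2.

Lemma tuc_energy_density : tuc energy_density.
Proof.
apply: tucD; apply: tuc_sum => i; apply: tucX; first exact: tC_tuc (tW i).
exact: tC_tuc (tD i).
Qed.

Lemma H1_norm_wave t : H1_norm (w t) ^+ 2 = torus_integral (energy_density t).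
Proof.
have E : (fun x => \sum_(i < d) component (w t) i x ^+ 2
    + \sum_(i < d) \sum_(j < d) partial j (component (w t) i) x ^+ 2) = energy_density t.
  apply/funext => x; congr (_ + _); apply: eq_bigr => i _.
  rewrite -[RHS]mul1r -theta1 /dot mulr_suml; apply: eq_bigr => j _.
  have -> : partial j (component (w t) i) x = theta 0 j * Dth theta (W i) t x.
    exact: (partial_plane_wave theta theta1 _ (W i) t j x (tW i) (plane_wave_wave theta w pw i t)).
  by ring.
rewrite /H1_norm E sqr_sqrtr// -(@torus_integral_cst R d 0); apply: le_torus_integral.
- exact: ucb_cst.
- by have [u _ _] := tuc_energy_density; exact: u.
- by move=> x; rewrite addr_ge0// sumr_ge0// => i _; exact: sqr_ge0.
Qed.

Let ME i t : M i t = (fun x => W i t x - laplacian (W i t) x).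
Proof.
apply/funext => x; rewrite /M /waveM.
have E := laplacian_plane_wave theta theta1 _ (W i) t x (tCS _ _ (tW i)) (plane_wave_wave theta w pw i).
exact: (congr1 (fun a => W i t x - a) (esym E)).
Qed.

Lemma energy_momentum t : torus_integral (energy_density t) =
  torus_integral (fun x => \sum_(i < d) wave w i t x * waveM theta w i t x).
Proof.
have uW i : ucb (W i t) by have [] := tC_tuc _ _ (tW i).
have uD i : ucb (Dth theta (W i) t) by have [] := tC_tuc _ _ (tD i).
have uM i : ucb (M i t) by have [] := tC_tuc _ _ (tM i).
rewrite torus_integral_sum; last by move=> i; exact: ucbM.
have -> : energy_density t = (fun x => \sum_(i < d) (W i t x ^+ 2 + Dth theta (W i) t x ^+ 2)).
  by apply/funext => x; rewrite big_split.
rewrite torus_integral_sum; last by move=> i; apply: ucbD; exact: ucbX.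
apply: eq_bigr => i _; have E := H1_energy (W i) t (tCS _ _ (tW i)).
apply: etrans (etrans E _); last by rewrite -[waveM _ _ _]/(M i) ME.
congr torus_integral; apply/funext => x; congr (_ + _).
rewrite -[LHS]mul1r -theta1 /dot mulr_suml; apply: eq_bigr => j _.
rewrite (partial_plane_wave theta theta1 _ (W i) t j x (tW i) (plane_wave_wave theta w pw i t)).
by ring.
Qed.

(** Self-adjointness of [1 - laplacian] puts the whole increment on the momentum, the quantity whose
    time derivative the equations provide. *)
Lemma energy_difference s t : torus_integral (energy_density s) = torus_integral (energy_density t) +
  torus_integral (fun x => \sum_(i < d)
    (wave w i s x + wave w i t x) * (waveM theta w i s x - waveM theta w i t x)).
Proof.
have uW i r : ucb (W i r) by have [] := tC_tuc _ _ (tW i).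
have uM i r : ucb (M i r) by have [] := tC_tuc _ _ (tM i).
have ES r : torus_integral (energy_density r) = \sum_(i < d) torus_integral (fun x => W i r x * M i r x).
  apply: (etrans (energy_momentum r)).
  apply: (@torus_integral_sum _ _ _ _ (fun i x => W i r x * M i r x)) => i.
  exact: ucbM.
have ED : torus_integral (fun x => \sum_(i < d) (W i s x + W i t x) * (M i s x - M i t x)) =
    \sum_(i < d) torus_integral (fun x => (W i s x + W i t x) * (M i s x - M i t x)).
  apply: (@torus_integral_sum _ _ _ _ (fun i x => (W i s x + W i t x) * (M i s x - M i t x))) => i.
  by apply: ucbM; [exact: ucbD|exact: ucbB].
apply: (etrans (ES s)); apply: etrans (f_equal2 +%R (esym (ES t)) (esym ED)).
rewrite -big_split; apply: eq_bigr => i _ /=.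
have S : torus_integral (fun x => W i s x * M i t x) = torus_integral (fun x => W i t x * M i s x).
  by rewrite !ME; exact: torus_integral_momentum_sym _ _ _ _ (tCS _ _ (tW i)) (tCS _ _ (tW i)).
exact: (torus_integral_polarize (W i s) (W i t) (M i s) (M i t)).
Qed.

End EnergyIdentities.

Section EnergyConservation.
Context {R : realType} {d : nat} (theta : 'rV[R]_d).

Lemma udiff_sub_init {X : Type} (f : R -> X -> R) (t : R) (g : X -> R) : udiff f t g ->
  udiff (fun s x => f s x - f t x) t g.
Proof.
by move=> fg e /fg[r r0 Hr]; exists r => // s /Hr sr x; have := sr x; rewrite subrr subr0.
Qed.

Lemma Dth_lincomb (c : 'I_d -> R) (F : 'I_d -> R -> 'rV[R]_d -> R) : (forall j, tC 1 (F j)) ->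
  Dth theta (fun t x => \sum_(j < d) c j * F j t x) =
  (fun t x => \sum_(j < d) c j * Dth theta (F j) t x).
Proof.
move=> tF; apply/funext => t; apply/funext => x; apply: is_derive_val.
have -> : (fun x => \sum_(j < d) c j * F j t x) = \sum_(j < d) (c j \*: F j t).
  by apply/funext => y; rewrite fct_sumE.
apply: is_derive_sum => j; apply: is_deriveZ; exact: is_derive_tC (tF j).
Qed.

(** Read with [a] the velocity, [m] the momentum and [v] the speed, the right side is [-2 (v K)']
    for [K] the sum of the [a_i m_i]: twice velocity times the equation is an exact derivative along
    [theta]. *)
Lemma energy_flux (th a m dm da : 'I_d -> R) (v dv : R) : v = \sum_(i < d) th i * a i ->
  \sum_(i < d) (a i + a i) * - (v * dm i + th i * (\sum_(j < d) m j * da j) + m i * dv) =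
  -2 * (v * (\sum_(i < d) (a i * dm i + m i * da i)) + (\sum_(i < d) a i * m i) * dv).
Proof.
move=> vE; rewrite big_split/=; set S := \sum_(j < d) m j * da j; set K := \sum_(j < d) a j * m j.
have -> : \sum_(i < d) (a i + a i) * - (v * dm i + th i * S + m i * dv) =
  \sum_(i < d) (-2 * (v * (a i * dm i)) + -2 * (th i * a i * S) + -2 * (a i * m i * dv)).
  by apply: eq_bigr => i _; ring.
rewrite !big_split/= -!mulr_sumr -!mulr_suml -vE -/K; ring.
Qed.

Hypothesis theta1 : dot theta theta = 1.
Variable w : R -> 'rV[R]_d -> 'rV[R]_d.
Hypotheses (sw : smooth_EP w) (pw : forall t, plane_wave theta (w t)).

Let W (i : 'I_d) := wave w i.
Let M (i : 'I_d) := waveM theta w i.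
Let tW i : tC 3 (W i). Proof. exact: tC_wave. Qed.
Let tM i : tC 1 (M i). Proof. exact: tC_waveM. Qed.
Let tW1 i : tC 1 (W i). Proof. by apply: tCS; apply: tCS. Qed.

Lemma tC_speed : tC 3 (speed theta w).
Proof.
apply: tC_sum => j; apply: (eq_tC _ (fun t x => theta 0 j * W j t x + 0 * W j t x)) => [t x|].
  by rewrite mul0r addr0.
exact: tC_lin.
Qed.

Lemma Dth_speed : Dth theta (speed theta w) =
  (fun t x => \sum_(j < d) theta 0 j * Dth theta (wave w j) t x).
Proof. exact: Dth_lincomb. Qed.

Lemma udiff_waveM (t : R) i : 0 < t ->
  udiff (M i) t (fun x => - EP_nonlinearity (w t) i x).
Proof.
move=> t0; have -> : M i = (fun s => momentum (w s) i).
  by apply/funext => s; exact: esym (momentum_wave theta theta1 w sw pw i s).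
exact: sw.2.
Qed.

(** The rate of the increment in [energy_difference] is the integral of twice the velocity against
    the equation, which is the integral of a derivative along [theta]. *)
Lemma is_derive_energy (t : R) : 0 < t ->
  is_derive t 1 (fun s => torus_integral (energy_density theta w s)) 0.
Proof.
move=> t0; pose f (s : R) x := \sum_(i < d) (W i s x + W i t x) * (M i s x - M i t x).
pose g x := \sum_(i < d) (W i t x + W i t x) * - EP_nonlinearity (w t) i x.
have uW i s : ucb (W i s) by have [] := tC_tuc _ _ (tW i).
have uM i s : ucb (M i s) by have [] := tC_tuc _ _ (tM i).
have tE i : tuc (fun t => EP_nonlinearity (w t) i) by apply: tuc_EP_nonlinearity; have [] := sw.
have uE i : ucb (EP_nonlinearity (w t) i) by have [] := tE i.
have uf s : ucb (f s).
  by apply: ucb_sum => i; apply: ucbM; [exact: ucbD|exact: ucbB].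
have ug : ucb g.
  by apply: ucb_sum => i; apply: ucbM; [exact: ucbD|exact: ucbN].
have fg : udiff f t g.
  apply: udiff_sum => i.
  have [[B1 HB1] _] := ucbD _ _ (uW i t) (uW i t); have [[B2 HB2] _] := ucbN _ (uE i).
  apply: (udiff_mul0 (fun s x => W i s x + W i t x) (fun s x => M i s x - M i t x) t
    (Num.max B1 B2) (fun x => - EP_nonlinearity (w t) i x)).
  - by move=> x; rewrite le_max HB1.
  - by move=> x; rewrite le_max HB2 orbT.
  - move=> e e0; have [_ _ cW] := tC_tuc _ _ (tW i); have [r r0 Hr] := cW t e e0.
    exists r => // s /Hr sr x; have := sr x.
    by have -> : W i s x + W i t x - (W i t x + W i t x) = W i s x - W i t x by ring.
  - by move=> x; exact: subrr.
  - exact: (udiff_sub_init (M i) t _ (udiff_waveM t i t0)).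
have Tg : torus_integral g = 0.
  pose Q (t : R) x := speed theta w t x * \sum_(i < d) W i t x * M i t x.
  have tK : tC 1 (fun t x => \sum_(i < d) W i t x * M i t x).
    by apply: tC_sum => i; exact: tC1M.
  have tU : tC 1 (speed theta w) by apply: tCS; apply: tCS; exact: tC_speed.
  have tQ : tC 1 Q by exact: tC1M.
  have uQ : ucb (Dth theta Q t) by have [] := tC_tuc _ _ (tC_Dth theta _ _ tQ).
  have KE x : Dth theta (fun t x => \sum_(i < d) W i t x * M i t x) t x =
      \sum_(i < d) (W i t x * Dth theta (M i) t x + M i t x * Dth theta (W i) t x).
    apply: is_derive_val.
    have -> : (fun x => \sum_(j < d) W j t x * M j t x) = \sum_(j < d) (fun x => W j t x * M j t x).
      by apply/funext => y; rewrite fct_sumE.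
    by apply: is_derive_sum => i; exact: tC1_mulD.
  have -> : g = (fun x => -2 * Dth theta Q t x).
    apply/funext => x.
    have -> : Dth theta Q t x = speed theta w t x * (\sum_(i < d)
        (W i t x * Dth theta (M i) t x + M i t x * Dth theta (W i) t x)) +
        (\sum_(i < d) W i t x * M i t x) * Dth theta (speed theta w) t x.
      by apply: is_derive_val; rewrite -KE; exact: tC1_mulD.
    rewrite Dth_speed -(energy_flux (fun i => theta 0 i)); last by [].
    apply: eq_bigr => i _; congr (_ * - _).
    exact: EP_nonlinearity_wave.
  by rewrite torus_integralZ// torus_integral_Dth// mulr0.
have -> : (fun s => torus_integral (energy_density theta w s)) =
    (fun s => torus_integral (energy_density theta w t) + torus_integral (f s)).
  by apply/funext => s; exact: energy_difference.
have D := is_derive_torus_integral _ f t g uf ug fg; rewrite Tg in D.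
have := is_deriveD (is_derive_cst (torus_integral (energy_density theta w t)) t (1 : R)) D.
by rewrite add0r.
Qed.

Lemma energy_const (t : R) : 0 <= t ->
  torus_integral (energy_density theta w t) = torus_integral (energy_density theta w 0).
Proof.
rewrite le_eqVlt => /predU1P[<-//|t0].
apply/esym; apply: (is_derive_cst_eq (fun s => torus_integral (energy_density theta w s))) => //.
- exact: ltW.
- by move=> s _; apply: tuc_torus_integral_continuous; exact: tuc_energy_density.
- by move=> s /andP[s0 _]; exact: is_derive_energy.
Qed.

End EnergyConservation.

(** * The time derivative of the slope *)

Section SlopeAtMinimum.
Context {R : realType} {d : nat} (theta : 'rV[R]_d).
Hypothesis theta1 : dot theta theta = 1.

Lemma sqr_dot_le (a : 'I_d -> R) : (\sum_(j < d) theta 0 j * a j) ^+ 2 <= \sum_(j < d) a j ^+ 2.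
Proof.
set v := \sum_(j < d) theta 0 j * a j.
have : 0 <= \sum_(j < d) (a j - v * theta 0 j) ^+ 2 by apply: sumr_ge0 => j _; exact: sqr_ge0.
have -> : \sum_(j < d) (a j - v * theta 0 j) ^+ 2 =
    \sum_(j < d) (a j ^+ 2 + - 2 * v * (theta 0 j * a j) + v ^+ 2 * (theta 0 j * theta 0 j)).
  by apply: eq_bigr => j _; ring.
by rewrite !big_split/= -!mulr_sumr -/v -/(dot theta theta) theta1; lra.
Qed.

Variable w : R -> 'rV[R]_d -> 'rV[R]_d.
Hypotheses (sw : smooth_EP w) (pw : forall t, plane_wave theta (w t)).
Variable j0 : 'I_d.
Hypothesis thetaj0 : theta 0 j0 != 0.

Let L : R := `|theta 0 j0|.
Let L0 : 0 < L. Proof. by rewrite /L normr_gt0. Qed.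
Let L1 : L <= 1.
Proof.
have : L ^+ 2 <= 1.
  rewrite /L real_normK ?num_real// -theta1 /dot (bigD1 j0)//= -expr2 lerDl.
  by apply: sumr_ge0 => j _; rewrite -expr2 sqr_ge0.
by have := L0; nra.
Qed.

Let W (i : 'I_d) := wave w i.
Let M (i : 'I_d) := waveM theta w i.
Let U := speed theta w.
Let D := Dth theta.
Let tW i : tC 3 (W i). Proof. exact: tC_wave. Qed.
Let tM i : tC 1 (M i). Proof. exact: tC_waveM. Qed.
Let tW1 i : tC 1 (W i). Proof. by apply: tCS; apply: tCS. Qed.
Let tDW i : tC 2 (D (W i)). Proof. exact: tC_Dth. Qed.
Let tU : tC 3 U. Proof. exact: tC_speed. Qed.
Let tU1 : tC 2 (D U). Proof. exact: tC_Dth. Qed.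
Let tU2 : tC 1 (D (D U)). Proof. exact: tC_Dth. Qed.
Let tUM : tC 1 (fun t x => U t x - D (D U) t x).
Proof. by apply: tCB => //; apply: tCS; exact: tCS. Qed.
Let pW i t : plane_wave theta (W i t). Proof. exact: plane_wave_wave. Qed.

Definition half_density (t : R) (x : 'rV[R]_d) : R :=
  (\sum_(i < d) W i t x ^+ 2 - \sum_(i < d) D (W i) t x ^+ 2) / 2.
(** The function [H] of the Riccati inequality. *)
Definition slope_flux (t : R) (x : 'rV[R]_d) : R := U t x * (U t x - D (D U) t x) + half_density t x.

Lemma plane_wave_speed (t : R) : plane_wave theta (U t).
Proof.
move=> z z0; apply/funext => x; rewrite /translate /U /speed; apply: eq_bigr => j _.
congr (_ * _); exact: (congr1 (fun g => g x) (pW j t z z0)).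
Qed.

Lemma speedM (t : R) (x : 'rV[R]_d) : U t x - D (D U) t x = \sum_(i < d) theta 0 i * M i t x.
Proof.
have E1 : D U = (fun t x => \sum_(j < d) theta 0 j * D (W j) t x) by exact: Dth_speed.
have E2 : D (fun t x => \sum_(j < d) theta 0 j * D (W j) t x) t x =
    \sum_(j < d) theta 0 j * D (D (W j)) t x.
  exact: (congr1 (fun g => g t x) (Dth_lincomb theta (fun j => theta 0 j) (fun j => D (W j))
    (fun j => tCS _ _ (tDW j)))).
rewrite [in LHS]E1 [X in _ - X]E2 /U /speed -sumrB; apply: eq_bigr => j _; rewrite -mulrBr.
by [].
Qed.

Lemma is_derive_tC_line m (F : R -> 'rV[R]_d -> R) (t : R) (x : 'rV[R]_d) (s : R) : tC m.+1 F ->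
  is_derive s 1 (fun r : R => F t (x + r *: theta)) (D F t (x + s *: theta)).
Proof.
move=> tF; have Dx := is_derive_tC theta _ F t (x + s *: theta) tF.
by apply: is_derive_line; case: Dx.
Qed.

Lemma tC_continuous_line m (F : R -> 'rV[R]_d -> R) (t : R) (x : 'rV[R]_d) : tC m F ->
  continuous (fun r : R => F t (x + r *: theta)).
Proof.
move=> tF; have [uF _ _] := tC_tuc _ _ tF; apply: ucb_continuous.
exact: ucb_line.
Qed.

Lemma line_periodic m (F : R -> 'rV[R]_d -> R) (t : R) (x : 'rV[R]_d) (s : R) :
  tC m F -> plane_wave theta (F t) ->
  F t (x + (s + L) *: theta) = F t (x + s *: theta).
Proof.
move=> tF wF; have [_ pF _] := tC_tuc _ _ tF.
by rewrite scalerDl addrA; exact: plane_wave_periodic.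
Qed.

Lemma is_derive_sum_sqr (F : 'I_d -> R -> 'rV[R]_d -> R) (t : R) (x : 'rV[R]_d) :
  (forall i, tC 1 (F i)) ->
  is_derive x theta (fun x => \sum_(i < d) F i t x ^+ 2)
    (\sum_(i < d) 2 * F i t x * D (F i) t x).
Proof.
move=> tF; have -> : (fun x => \sum_(j < d) F j t x ^+ 2) = \sum_(j < d) (fun x => F j t x * F j t x).
  by apply/funext => y; rewrite fct_sumE; apply: eq_bigr => i _; rewrite expr2.
apply: is_derive_sum => i; have := tC1_mulD theta (F i) (F i) t x (tF i) (tF i).
by congr is_derive; rewrite -/D; ring.
Qed.

Lemma tC_sum_sqr (F : 'I_d -> R -> 'rV[R]_d -> R) : (forall i, tC 1 (F i)) ->
  tC 1 (fun t x => \sum_(i < d) F i t x ^+ 2).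
Proof. by move=> tF; apply: tC_sum => i; have [] := tC1_sqr _ (tF i). Qed.

Lemma tC_slope_flux : tC 1 slope_flux.
Proof.
have T1 := tC_sum_sqr W tW1.
have T2 := tC_sum_sqr (fun i => D (W i)) (fun i => tCS _ _ (tDW i)).
have T3 := tC1M U _ (tCS _ _ (tCS _ _ tU)) tUM.
have T4 := tC_lin _ _ _ 2^-1 (- 2^-1) T1 T2.
apply: (eq_tC _ _ _ _ (tC_lin _ _ _ 1 1 T3 T4)) => t x.
by rewrite /slope_flux /half_density; set a := \sum_(i < d) _; set b := \sum_(i < d) _; field.
Qed.

Lemma plane_wave_slope_flux (t : R) : plane_wave theta (slope_flux t).
Proof.
have pD (F : R -> 'rV[R]_d -> R) : plane_wave theta (F t) -> plane_wave theta (D F t).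
  exact: plane_wave_Dth.
have pU := plane_wave_speed t; have pU2 := pD _ (pD _ pU).
move=> z z0; apply/funext => x; rewrite /translate /slope_flux /half_density.
have E1 : U t (x + z) = U t x by exact: (congr1 (fun g => g x) (pU z z0)).
have E2 : D (D U) t (x + z) = D (D U) t x by exact: (congr1 (fun g => g x) (pU2 z z0)).
have E3 : \sum_(i < d) W i t (x + z) ^+ 2 = \sum_(i < d) W i t x ^+ 2.
  by apply: eq_bigr => i _; congr (_ ^+ 2); exact: (congr1 (fun g => g x) (pW i t z z0)).
have E4 : \sum_(i < d) D (W i) t (x + z) ^+ 2 = \sum_(i < d) D (W i) t x ^+ 2.
  by apply: eq_bigr => i _; congr (_ ^+ 2); exact: (congr1 (fun g => g x) (pD _ (pW i t) z z0)).
exact: (f_equal2 +%R (f_equal2 *%R E1 (f_equal2 (fun a b => a - b) E1 E2))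
  (f_equal2 (fun a b => (a - b) / 2) E3 E4)).
Qed.

Lemma slope_flux_alg (th m dm da : 'I_d -> R) (v dv : R) : \sum_(i < d) th i * th i = 1 ->
  - \sum_(i < d) th i * (v * dm i + th i * (\sum_(j < d) m j * da j) + m i * dv) =
  - (v * (\sum_(i < d) th i * dm i) + (\sum_(i < d) th i * m i) * dv + \sum_(j < d) m j * da j).
Proof.
move=> th1; set S := \sum_(j < d) m j * da j.
have -> : \sum_(i < d) th i * (v * dm i + th i * S + m i * dv) =
  \sum_(i < d) (v * (th i * dm i) + th i * th i * S + th i * m i * dv).
  by apply: eq_bigr => i _; ring.
by rewrite !big_split/= -!mulr_sumr -!mulr_suml th1; ring.
Qed.

(** Contracted with [theta], the nonlinearity is [(U (U - U''))'] plus the sum of the [m_j u_j'],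
    and [(u_j - u_j'') u_j'] is the derivative of [(u_j^2 - u_j'^2) / 2]. So the equation for
    [U - U''] is a conservation law. *)
Lemma speedM_rate (t : R) (x : 'rV[R]_d) :
  - \sum_(i < d) theta 0 i * EP_nonlinearity (w t) i x = - D slope_flux t x.
Proof.
have K1 : (fun t x => U t x - D (D U) t x) = (fun t x => \sum_(i < d) theta 0 i * M i t x).
  by apply/funext => s; apply/funext => y; exact: speedM.
have DK : D (fun t x => U t x - D (D U) t x) t x = \sum_(i < d) theta 0 i * D (M i) t x.
  rewrite K1; exact: (congr1 (fun g => g t x) (Dth_lincomb theta (fun j => theta 0 j) M tM)).
have -> : D slope_flux t x = U t x * (\sum_(i < d) theta 0 i * D (M i) t x) +
    (\sum_(i < d) theta 0 i * M i t x) * D U t x +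
    \sum_(j < d) M j t x * D (W j) t x.
  apply: is_derive_val.
  have D1 := tC1_mulD theta U _ t x (tCS _ _ (tCS _ _ tU)) tUM.
  have D2 := is_derive_sum_sqr W t x tW1.
  have D3 := is_derive_sum_sqr (fun i => D (W i)) t x (fun i => tCS _ _ (tDW i)).
  have D4 := is_deriveD D1 (is_deriveZ 2^-1 (is_deriveB D2 D3)).
  have -> : slope_flux t = (fun x => U t x * (U t x - D (D U) t x)) +
    2^-1 \*: ((fun x => \sum_(i < d) W i t x ^+ 2) - (fun x => \sum_(i < d) D (W i) t x ^+ 2)).
    apply/funext => y; rewrite !fctE /slope_flux /half_density.
    by congr (_ + _); rewrite [LHS]mulrC.
  move: D4; congr is_derive; rewrite -DK speedM; congr (_ + _).
  rewrite /GRing.scale/= -sumrB mulr_sumr; apply: eq_bigr => i _.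
  by rewrite /M /waveM -/(W i) -/D; field.
apply: etrans (slope_flux_alg _ _ _ _ _ _ theta1); congr (- _); apply: eq_bigr => i _.
congr (_ * _); apply: (etrans (EP_nonlinearity_wave theta theta1 w sw pw i t x)).
by rewrite [D U t x](congr1 (fun g => g t x) (Dth_speed theta w sw)).
Qed.

Lemma udiffZ {X : Type} (c : R) (f : R -> X -> R) (t : R) (g : X -> R) : udiff f t g ->
  udiff (fun s x => c * f s x) t (fun x => c * g x).
Proof.
move=> fg e e0; have c1 : 0 < `|c| + 1 by have := normr_ge0 c; lra.
have [r r0 Hr] := fg _ (divr_gt0 e0 c1); exists r => // s /Hr sr x.
have -> : c * f s x - c * f t x - (s - t) * (c * g x) = c * (f s x - f t x - (s - t) * g x) by ring.
rewrite normrM; apply: (@le_trans _ _ ((`|c| + 1) * (e / (`|c| + 1) * `|s - t|))).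
  by apply: ler_pM => //; lra.
by rewrite mulrA [_ * (e / _)]mulrC divfK// gt_eqF.
Qed.

Lemma udiff_speedM (t : R) : 0 < t ->
  udiff (fun s x => U s x - D (D U) s x) t (fun x => - D slope_flux t x).
Proof.
move=> t0; have -> : (fun s x => U s x - D (D U) s x) = (fun s x => \sum_(i < d) theta 0 i * M i s x).
  by apply/funext => s; apply/funext => y; exact: speedM.
have -> : (fun x => - D slope_flux t x) =
    (fun x => \sum_(i < d) theta 0 i * - EP_nonlinearity (w t) i x).
  apply/funext => x; apply: etrans (esym (speedM_rate t x)) _; rewrite -sumrN.
  by apply: eq_bigr => i _; rewrite mulrN.
by apply: udiff_sum => i; apply: udiffZ; exact: udiff_waveM.
Qed.

Let q : R := expR (- L).
Let q1 : q < 1. Proof. by rewrite /q expR_lt1 oppr_lt0. Qed.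

(** Convolution of [- h'] with the derivative of the kernel, integrated by parts once more; the jump
    of that derivative at 0 produces the local term [h 0]. *)
Lemma exp_weighted_difference (h h1 : R -> R) : (forall s : R, is_derive s 1 h (h1 s)) ->
  continuous h1 -> (forall s, h (s + L) = h s) ->
  intL L (fun s => expR (- s) * - h1 s) - intL L (fun s => expR (- s) * - h1 (- s)) =
  2 * (1 - q) * h 0 - Ks L h.
Proof.
move=> dh ch ph; have hL : h L = h 0 by rewrite -[in RHS]ph add0r.
have hNL : h (- L) = h 0 by rewrite -[in LHS]ph addNr.
have B1 := exp_weighted_derivative L L0 _ _ dh ch hL.
have B2 := exp_weighted_derivativeN L L0 _ _ dh ch hNL.
have cE : continuous (fun s : R => expR (- s)).
  by move=> s; apply: (@continuous_comp _ _ _ -%R expR); [exact: oppr_continuous|exact: continuous_expR].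
have N (f : R -> R) : continuous f ->
    intL L (fun s => expR (- s) * - f s) = - intL L (fun s => expR (- s) * f s).
  move=> cf; rewrite -[RHS]mulN1r -intLZ; last exact: continuous_mul.
  by apply: eq_intL => s _; ring.
have N1 := N h1 ch; have N2 := N (fun s => h1 (- s)) (continuous_negarg _ ch).
by rewrite /= in N2; rewrite N1 N2 B1 B2 /Ks -/q; ring.
Qed.

(** The second identity of [Ks_green] writes [U'] as an integral of [U - U''] along the line, and
    [udiff_speedM] differentiates under it. [exp_weighted_difference] then trades the derivative of
    the flux for the flux itself. *)
Lemma is_derive_slope (t : R) (x : 'rV[R]_d) : 0 < t -> is_derive t 1 (fun s => D U s x)
  ((2 * (1 - q))^-1 * (2 * (1 - q) * slope_flux t x - Ks L (fun s => slope_flux t (x + s *: theta)))).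
Proof.
move=> t0; have q20 : 2 * (1 - q) != 0 by rewrite gt_eqF//; have := q1; lra.
have cE : continuous (fun s : R => expR (- s)).
  by move=> s; apply: (@continuous_comp _ _ _ -%R expR); [exact: oppr_continuous|exact: continuous_expR].
have E01 (s : R) : 0 <= s <= L -> 0 <= expR (- s) <= 1.
  by move=> /andP[s0 _]; rewrite expR_ge0 -expR0 ler_expR oppr_le0.
pose m (s : R) x := U s x - D (D U) s x.
have cF (f : 'rV[R]_d -> R) : ucb f -> continuous (fun r : R => f (x + r *: theta)).
  by move=> uf; apply: ucb_continuous; exact: ucb_line.
have um s : ucb (m s) by have [u _ _] := tC_tuc _ _ tUM; exact: (u s).
have uH : ucb (D slope_flux t).
  by have [u _ _] := tC_tuc _ _ (tC_Dth theta _ _ tC_slope_flux); exact: (u t).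
have uH' := ucbN _ uH.
have G s : D U s x = (2 * (1 - q))^-1 * (intL L (fun r => expR (- r) * m s (x + r *: theta)) -
    intL L (fun r => expR (- r) * m s (x + (- r) *: theta))).
  have [_ ->] := Ks_green L L0 (fun r : R => U s (x + r *: theta)) (fun r : R => D U s (x + r *: theta))
      (fun r : R => D (D U) s (x + r *: theta))
      (fun r => is_derive_tC_line _ U s x r tU) (fun r => is_derive_tC_line _ (D U) s x r tU1)
      (tC_continuous_line _ _ s x tU2) (fun r => line_periodic _ _ s x r tU (plane_wave_speed s))
      (fun r => line_periodic _ _ s x r tU1 (plane_wave_Dth theta _ s (plane_wave_speed s))).
  by rewrite scale0r addr0 mulrA mulVf// mul1r.
have A1 := is_derive_weighted_intL L _ (fun r : R => x + r *: theta) m t _ (ltW L0) cE E01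
  (fun s => cF _ (um s)) (cF _ uH') (udiff_speedM t t0).
have A2 := is_derive_weighted_intL L _ (fun r : R => x + (- r) *: theta) m t _ (ltW L0) cE E01
  (fun s => continuous_negarg _ (cF _ (um s))) (continuous_negarg _ (cF _ uH')) (udiff_speedM t t0).
have -> : (fun s => D U s x) = (2 * (1 - q))^-1 \*:
   ((fun s => intL L (fun r => expR (- r) * m s (x + r *: theta))) -
    (fun s => intL L (fun r => expR (- r) * m s (x + (- r) *: theta)))).
  by apply/funext => s; rewrite G.
have := is_deriveZ (2 * (1 - q))^-1 (is_deriveB A1 A2); congr is_derive.
rewrite /GRing.scale/=; congr (_ * _).
have := exp_weighted_difference (fun s : R => slope_flux t (x + s *: theta))
  (fun s : R => D slope_flux t (x + s *: theta))
  (fun s => is_derive_tC_line _ _ t x s tC_slope_flux) (cF _ uH)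
  (fun s => line_periodic _ _ t x s tC_slope_flux (plane_wave_slope_flux t)).
by rewrite scale0r addr0.
Qed.

(** Everything is restricted to the line through [x] in direction [theta], where [riccati_bound]
    applies with [y0] and [y1] the squared lengths of the velocity and of its derivative; by
    Cauchy-Schwarz they dominate the squares of [U] and [U']. *)
Lemma slope_at_minimum (t : R) (x : 'rV[R]_d) : 0 < t -> (forall y, D U t x <= D U t y) ->
  exists2 c : R, is_derive t 1 (fun s => D U s x) c &
    c <= - (D U t x ^+ 2) / 2 +
      19 / 20 * (L^-1 * intL L (fun s => energy_density theta w t (x + s *: theta))).
Proof.
move=> t0 xmin; eexists; first exact: is_derive_slope.
have q20 : 0 < 2 * (1 - q) by have := q1; lra.
pose c (s : R) : 'rV[R]_d := x + s *: theta.
pose y0 (s : R) := \sum_(i < d) W i t (c s) ^+ 2.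
pose y1 (s : R) := \sum_(i < d) D (W i) t (c s) ^+ 2.
have pD (F : R -> 'rV[R]_d -> R) : plane_wave theta (F t) -> plane_wave theta (D F t).
  exact: plane_wave_Dth.
have pU := plane_wave_speed t.
have cx : c 0 = x by rewrite /c scale0r addr0.
have du (s : R) : is_derive s 1 (fun s => U t (c s)) (D U t (c s)).
  by exact: (is_derive_tC_line _ U t x s tU).
have du1 (s : R) : is_derive s 1 (fun s => D U t (c s)) (D (D U) t (c s)).
  by exact: (is_derive_tC_line _ (D U) t x s tU1).
have cu2 : continuous (fun s => D (D U) t (c s)) by exact: (tC_continuous_line _ (D (D U)) t x tU2).
have pu (s : R) : U t (c (s + L)) = U t (c s) by exact: (line_periodic _ U t x s tU pU).
have pu1 (s : R) : D U t (c (s + L)) = D U t (c s) by exact: (line_periodic _ (D U) t x s tU1 (pD _ pU)).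
have dy (s : R) : is_derive s 1 y0 (\sum_(i < d) 2 * W i t (c s) * D (W i) t (c s)).
  have DL := is_derive_tC_line _ _ t x s (tC_sum_sqr W tW1).
  by move: DL; congr is_derive; apply: is_derive_val; exact: is_derive_sum_sqr.
have dyle (s : R) : `|\sum_(i < d) 2 * W i t (c s) * D (W i) t (c s)| <= y0 s + y1 s.
  rewrite /y0 /y1 -big_split/=; apply: le_trans (ler_norm_sum _ _ _) _; apply: ler_sum => i _.
  move: (W i t (c s)) (D (W i) t (c s)) => a b; rewrite ler_norml.
  have := sqr_ge0 (a - b); have := sqr_ge0 (a + b); rewrite sqrrB sqrrD !mulr2n; lra.
have py0 (s : R) : y0 (s + L) = y0 s.
  by apply: eq_bigr => i _; congr (_ ^+ 2); exact: (line_periodic _ (W i) t x s (tW i) (pW i t)).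
have py1 (s : R) : y1 (s + L) = y1 s.
  apply: eq_bigr => i _; congr (_ ^+ 2).
  exact: (line_periodic _ (D (W i)) t x s (tDW i) (pD _ (pW i t))).
have cy1 : continuous y1.
  exact: (tC_continuous_line _ _ t x (tC_sum_sqr (fun i => D (W i)) (fun i => tCS _ _ (tDW i)))).
have uy0 (s : R) : U t (c s) ^+ 2 <= y0 s by exact: sqr_dot_le.
have uy1 (s : R) : D U t (c s) ^+ 2 <= y1 s.
  have -> : D U t (c s) = \sum_(j < d) theta 0 j * D (W j) t (c s).
    exact: (congr1 (fun g => g t (c s)) (Dth_speed theta w sw)).
  exact: sqr_dot_le.
have u20 : D (D U) t (c 0) = 0.
  have z01 : (0 : R) \in `](-1), 1[ by rewrite in_itv/= ltrN10 ltr01.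
  have Dm : is_derive (0 : R) 1 (fun s => D U t (c s)) 0.
    by apply: (@derive1_at_min R _ (-1) 1) => // s _; rewrite cx; exact: xmin.
  by rewrite -[LHS](is_derive_val (du1 0)) (is_derive_val Dm).
have B := riccati_bound L _ _ _ _ _ _ L0 L1 du du1 cu2 pu pu1 dy dyle py0 cy1 py1 uy0 uy1
  (fun s => slope_flux t (c s)) u20 (fun s => erefl).
rewrite cx in B.
have qi : 0 <= (2 * (1 - q))^-1 by rewrite invr_ge0 ltW.
have q2n : 2 * (1 - q) != 0 by rewrite gt_eqF.
by apply: (le_trans (ler_wpM2l qi B)); rewrite (mulKf q2n).
Qed.

End SlopeAtMinimum.

(** * Means over the torus as means along a line *)

Section PlaneWaveMean.
Context {R : realType}.

(** Both sides are means over one full period, and such a mean is independent of the starting point: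
    for a primitive [Phi], the increment [Phi (s + |a|) - Phi s] has derivative zero. *)
Lemma intL_period (F : R -> R) (a c c' : R) : continuous F -> (forall s, F (s + a) = F s) ->
  a != 0 -> intL 1 (fun s => F (c + a * s)) = `|a|^-1 * intL `|a| (fun s => F (c' + s)).
Proof.
move=> cF pF a0; have pFa s : F (s + `|a|) = F s.
  case: (ger0P a) => _; first exact: pF.
  by rewrite -[LHS]pF subrK.
have na : 0 < `|a| by rewrite normr_gt0.
(* Covers the possible starting points [c], [c + a] and [c']; [Phi] must then be a primitive up to
   one period further. *)
pose B : R := `|c| + `|c'| + `|a|.
have [Phi dPhi] := antiderivative (B + `|a| + 1) F cF.
have dT (z s : R) : `|s + z| < B + `|a| + 1 -> is_derive s 1 (fun s => Phi (s + z)) (F (s + z)).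
  by move=> /dPhi; exact: is_derive_translate.
pose P (s : R) := Phi (s + `|a|) - Phi s.
have small (s z : R) : `|s| <= B -> `|z| <= `|a| -> `|s + z| < B + `|a| + 1.
  by move=> sB za; apply: (le_lt_trans (ler_normD _ _)); lra.
have dP (s : R) : `|s| <= B -> is_derive s 1 P 0.
  move=> sB; have za : `| `|a| | <= `|a| by rewrite normr_id.
  have sA : `|s| < B + `|a| + 1 by lra.
  have := is_derive_sub _ _ _ _ _ (dT `|a| s (small _ _ sB za)) (dPhi s sA).
  by rewrite pFa subrr.
have Pc (u v : R) : `|u| <= B -> `|v| <= B -> P u = P v.
  wlog uv : u v / u <= v.
    by move=> H uB vB; have [uv|/ltW uv] := leP u v; [exact: H|apply/esym; exact: H].
  move=> uB vB; have I (x : R) : u <= x <= v -> `|x| <= B.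
    by move: uB vB; rewrite !ler_norml; lra.
  apply: is_derive_cst_eq => // x xuv.
    by have D := dP x (I x xuv); exact: is_derive_continuous D.
  by apply: dP; apply: I; lra.
have cB : `|c| <= B by rewrite /B; have := normr_ge0 c'; lra.
have cB' : `|c'| <= B by rewrite /B; have := normr_ge0 c; lra.
have caB : `|c + a| <= B.
  by rewrite /B; apply: (le_trans (ler_normD _ _)); have := normr_ge0 c'; lra.
have small' (s : R) : 0 <= s <= 1 -> `|c + a * s| < B + `|a| + 1.
  move=> /andP[s0 s1]; apply: small => //; rewrite normrM (ger0_norm s0).
  by rewrite -[leRHS]mulr1 ler_wpM2l.
have cl (k z : R) : continuous (fun s => F (z + k * s)).
  move=> s; apply: (@continuous_comp _ _ _ (fun s => z + k * s) F); last exact: cF.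
  by apply: cvgD; [exact: cvg_cst|apply: cvgM; [exact: cvg_cst|exact: cvg_id]].
have d1 (s : R) : 0 <= s <= 1 -> is_derive s 1 (fun s => a^-1 * Phi (c + a * s)) (F (c + a * s)).
  move=> s01; have D1 := is_derive_affine c a s.
  have -> : (fun s => a^-1 * Phi (c + a * s)) = a^-1 \*: (Phi \o (fun s => c + s * a)).
    by apply/funext => r; rewrite /= (mulrC a r).
  have D2 : is_derive (c + s * a) 1 Phi (F (c + s * a)).
    by apply: dPhi; rewrite mulrC; exact: small'.
  by apply: is_derive_eq; rewrite /GRing.scale/= (mulrC s a) (mulrC _ a) mulKf.
have d2 (s : R) : 0 <= s <= `|a| -> is_derive s 1 (fun s => Phi (s + c')) (F (c' + 1 * s)).
  move=> /andP[s0 sa]; rewrite mul1r (addrC c'); apply: dT; rewrite addrC; apply: small => //.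
  by rewrite ger0_norm.
have -> : intL 1 (fun s => F (c + a * s)) = a^-1 * (Phi (c + a) - Phi c).
  by apply: (etrans (intL_FTC 1 _ _ ler01 (cl a c) d1)); rewrite mulr1 mulr0 addr0 mulrBr.
have -> : intL `|a| (fun s => F (c' + s)) = P c'.
  have -> : (fun s => F (c' + s)) = (fun s => F (c' + 1 * s)) by apply/funext => s; rewrite mul1r.
  by apply: (etrans (intL_FTC `|a| _ _ (ltW na) (cl 1 c') d2)); rewrite add0r (addrC _ c').
(* For negative [a] the window is run through backwards and starts at [c + a]. *)
have [an|ap] := ltP a 0.
  by rewrite (Pc _ _ cB' caB) /P (ltr0_norm an) addrK invrN mulNr -mulrN opprB.
by rewrite (Pc _ _ cB' cB) /P (ger0_norm ap).
Qed.

(* The index j found here is the last one with al_j != 0: integrating over y_j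
   first already produces the mean over a period. *)
Lemma torus_integral_ridge (n : nat) (al : 'rV[R]_n) (F : R -> R) : continuous F ->
  (forall j s, F (s + al 0 j) = F s) -> (exists j, al 0 j != 0) ->
  exists2 j, al 0 j != 0 & forall c c' : R, torus_integral (fun y => F (c + dot al y)) =
    `|al 0 j|^-1 * intL `|al 0 j| (fun s => F (c' + s)).
Proof.
move=> cF; elim: n al => [|n IH] al pF [j aj]; first by case: j aj.
change ('rV[R]_(1 + n)) in al; change 'I_(1 + n) in j.
pose be : 'rV[R]_n := rsubmx al; pose i0 : 'I_(1 + n) := lshift n (ord0 : 'I_1); pose a : R := al 0 i0.
have dotE (s : R) (y : 'rV[R]_n) : dot al (row_mx s%:M y) = a * s + dot be y.
  rewrite /dot big_split_ord/= big_ord1 row_mxEl mxE mulr1n; congr (_ + _).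
  by apply: eq_bigr => i _; rewrite row_mxEr /be mxE.
have pFb i s : F (s + be 0 i) = F s by rewrite /be mxE pF.
have TE c : torus_integral (fun y : 'rV[R]_n.+1 => F (c + dot al y)) =
    intL 1 (fun s => torus_integral (fun y : 'rV[R]_n => F ((c + a * s) + dot be y))).
  apply: eq_intL => s _; congr torus_integral; apply/funext => y.
  by rewrite dotE addrA.
have [[i bi]|/forallNP b0] := pselect (exists i, be 0 i != 0).
  have [k bk Hk] := IH be pFb (ex_intro _ i bi).
  exists (rshift 1 k) => [|c c']; first by move: bk; rewrite /be mxE.
  have bE : be 0 k = al 0 (rshift 1 k) by rewrite /be mxE.
  rewrite TE -bE -(mulr1 (_^-1 * _)) -intL_cst//.
  by apply: eq_intL => s _; rewrite (Hk _ c').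
have be0 i : be 0 i = 0 by apply/eqP/negPn/negP; exact: b0.
have a0 : a != 0.
  case: (split_ordP j) aj => k ->; first by rewrite (ord1 k).
  by have := be0 k; rewrite /be mxE => -> /eqP.
exists i0 => // c c'.
rewrite TE -(intL_period F a c c' cF (pF i0) a0); apply: eq_intL => s _.
rewrite -[RHS](@torus_integral_cst R n); congr torus_integral; apply/funext => y.
by rewrite /dot big1 ?addr0// => i _; rewrite be0 mul0r.
Qed.

(** [f] is a ridge function [F (theta . y)], and [F] has every [theta_j] as a period. The base point
    [x] is free, so that the line may later pass through the minimum of the slope. *)
Lemma torus_integral_plane_wave (d : nat) (theta : 'rV[R]_d) (f : 'rV[R]_d -> R) :
  dot theta theta = 1 -> ucb f -> per f -> plane_wave theta f ->
  exists2 j, theta 0 j != 0 & forall x, torus_integral f =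
    `|theta 0 j|^-1 * intL `|theta 0 j| (fun s => f (x + s *: theta)).
Proof.
move=> theta1 uf pf wf; pose F (s : R) := f (s *: theta).
have cF : continuous F.
  apply: ucb_continuous; have -> : F = (fun s : R => f (0 + s *: theta)).
    by apply/funext => s; rewrite add0r.
  exact: ucb_line.
have [j0 aj0] : exists j, theta 0 j != 0.
  apply/not_existsP => th0; move: theta1; rewrite /dot big1 => [/esym/eqP|j _].
    by rewrite oner_eq0.
  by have /negP/negPn/eqP -> := th0 j; rewrite mul0r.
have pF j (s : R) : F (s + theta 0 j) = F s.
  rewrite /F -(pf j (s *: theta)) [RHS](plane_waveE theta theta1 _ _ wf); congr (f (_ *: _)).
  have -> : s *: theta + delta_mx 0 j = s *: theta - (-1) *: delta_mx 0 j by rewrite scaleN1r opprK.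
  by rewrite dotB !dotZ dot_delta theta1 mulr1 mulN1r opprK.
have [j aj Hj] := torus_integral_ridge _ theta F cF pF (ex_intro _ j0 aj0).
exists j => // x.
have -> : f = (fun y => F (0 + dot theta y)).
  by apply/funext => y; rewrite add0r /F; exact: plane_waveE.
rewrite (Hj 0 (dot theta x)); congr (_ * intL _ _); apply/funext => s.
rewrite add0r; congr F; rewrite /dot.
have -> : \sum_(j < d) theta 0 j * (x + s *: theta) 0 j =
    \sum_(j < d) (theta 0 j * x 0 j + s * (theta 0 j * theta 0 j)).
  by apply: eq_bigr => i _; rewrite !mxE; ring.
by rewrite big_split/= -mulr_sumr -/(dot theta theta) theta1 mulr1.
Qed.

End PlaneWaveMean.

Section Rotation.
Context {R : realType} {d : nat}.

(** A vector orthogonal to row [i1] is a combination of the other rows of the orthogonal matrix, so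
    the derivative along it is a combination of the vanishing rotated derivatives, and [f] is
    constant on lines in that direction. *)
Lemma plane_wave_orthogonal (A : 'M[R]_d) (i1 : 'I_d) (f : 'rV[R]_d -> R) :
  A *m A^T = 1%:M ->
  (forall x v : 'rV[R]_d, is_derive x v f (\sum_(j < d) v 0 j * partial j f x)) ->
  (forall i, i != i1 -> forall x, rotated_partial A i f x = 0) -> plane_wave (row i1 A) f.
Proof.
move=> AA df f0 z z0; apply/funext => x; rewrite /translate.
have AtA : A^T *m A = 1%:M by exact: mulmx1C.
have D0 y : \sum_(j < d) z 0 j * partial j f y = 0.
  have -> : z = (z *m A^T) *m A by rewrite -mulmxA AtA mulmx1.
  under eq_bigr do rewrite mxE mulr_suml.
  rewrite exchange_big/= big1// => i _.
  have [->|ii1] := eqVneq i i1.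
    have -> : (z *m A^T) 0 i1 = 0.
      by rewrite -z0 mxE; apply: eq_bigr => j _; rewrite !mxE mulrC.
    by apply: big1 => j _; rewrite !mul0r.
  by under eq_bigr do rewrite -mulrA; rewrite -mulr_sumr [X in _ * X](f0 i ii1) mulr0.
have Dl (s : R) : is_derive s 1 (fun r : R => f (x + r *: z)) 0.
  have Dz := df (x + s *: z) z; rewrite D0 in Dz.
  by have := is_derive_line f x z s (@ex_derive _ _ _ _ _ _ _ Dz); rewrite (is_derive_val Dz).
by have := @is_derive_0_is_cst R (fun r : R => f (x + r *: z)) 1 0 Dl; rewrite scale1r scale0r addr0.
Qed.

(** A translate of the solution is a solution with the same initial value. Uniqueness covers
    nonnegative times, evenness in time the others. *)
Lemma smooth_EP_plane_wave (theta : 'rV[R]_d) (w : R -> 'rV[R]_d -> 'rV[R]_d) : smooth_EP w ->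
  (forall t, w t = w `|t|) -> plane_wave theta (w 0) -> forall t, plane_wave theta (w t).
Proof.
move=> sw wN w0 t z z0; rewrite wN; apply/funext.
have E0 : translate z (w 0) =1 w 0 by move=> y; exact: (congr1 (fun g => g y) (w0 z z0)).
have nt : 0 <= `|t| := normr_ge0 t.
exact: (smooth_EP_unique (fun t => translate z (w t)) w (smooth_EP_translate w z sw) sw E0 `|t| nt).
Qed.

Lemma plane_wave_energy_density (theta : 'rV[R]_d) (w : R -> 'rV[R]_d -> 'rV[R]_d) (t : R) :
  (forall t, plane_wave theta (w t)) -> plane_wave theta (energy_density theta w t).
Proof.
move=> pw z z0; apply/funext => x; rewrite /translate /energy_density.
have E1 : \sum_(i < d) wave w i t (x + z) ^+ 2 = \sum_(i < d) wave w i t x ^+ 2.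
  apply: eq_bigr => i _; congr (_ ^+ 2).
  exact: (congr1 (fun g => g x) (plane_wave_wave theta w pw i t z z0)).
have E2 : \sum_(i < d) Dth theta (wave w i) t (x + z) ^+ 2 =
    \sum_(i < d) Dth theta (wave w i) t x ^+ 2.
  apply: eq_bigr => i _; congr (_ ^+ 2).
  exact: (congr1 (fun g => g x) (plane_wave_Dth theta _ t (plane_wave_wave theta w pw i t) z z0)).
exact: (f_equal2 (fun a b => a + b) E1 E2).
Qed.

(** A solution of class [smooth_EP] lives for all times, whereas such an initial slope would be
    driven to minus infinity by [riccati_barrier], taken with [e0] the conserved energy. *)
Lemma plane_wave_slope_bound (theta : 'rV[R]_d) (w : R -> 'rV[R]_d -> 'rV[R]_d) (x : 'rV[R]_d) :
  dot theta theta = 1 -> smooth_EP w -> (forall t, plane_wave theta (w t)) ->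
  ~ Dth theta (speed theta w) 0 x < - (Num.sqrt 2 * H1_norm (w 0)).
Proof.
move=> theta1 sw pw; set e0 := torus_integral (energy_density theta w 0).
have H0 : 0 <= H1_norm (w 0) by exact: sqrtr_ge0.
have HE : H1_norm (w 0) ^+ 2 = e0 by exact: H1_norm_wave.
have e00 : 0 <= e0 by rewrite -HE sqr_ge0.
have -> : Num.sqrt 2 * H1_norm (w 0) = Num.sqrt (2 * e0).
  by rewrite -HE sqrtrM// sqrtr_sqr ger0_norm.
have tU := tC_speed theta w sw.
apply: (riccati_barrier (Dth theta (speed theta w))) => //.
  exact: tC_tuc (tC_Dth theta _ _ tU).
move=> t y t0 ymin.
have [uE pE _] := tuc_energy_density theta w sw.
have [j tj Ej] := torus_integral_plane_wave _ theta _ theta1 (uE t) (pE t)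
  (plane_wave_energy_density theta w t pw).
have [c Dc cle] := slope_at_minimum theta theta1 w sw pw j tj t y t0 ymin.
exists c => //; rewrite /e0 -(energy_const theta theta1 w sw pw t (ltW t0)) (Ej y).
exact: cle.
Qed.

End Rotation.

Local Close Scope classical_set_scope.

Theorem theorem4p1 (R : realType) (d : nat) (hd : (3 <= d)%N)
    (A : 'M[R]_d) (hA : A *m A^T = 1%:M)
    (k : R) (hk : d%:R / 2 + 3 < k)
    (u0 : 'rV[R]_d -> 'rV[R]_d) (hu0 : sobolev k u0)
    (Tstar : \bar R) (u : R -> 'rV[R]_d -> 'rV[R]_d)
    (hu : EP_maximal_solution k u0 Tstar u)
    (i1 : 'I_d) (hi1 : i1 = 0%N :> nat)
    (hsym : forall i : 'I_d, (i1 < i)%N -> forall (l : 'I_d) (x : 'rV[R]_d),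
      rotated_partial A i (component u0 l) x = 0)
    (hx0 : exists x0 : 'rV[R]_d,
      rotated_partial A i1 (rotated_component A u0 i1) x0
        < - (Num.sqrt 2 * H1_norm u0)) :
  blows_up_in_finite_time Tstar.
Proof.
have d0 : (0 < d)%N by exact: leq_trans hd.
(* By contradiction: an infinite lifespan makes [u] a solution on every [[0, T]]. *)
rewrite /blows_up_in_finite_time ltNge; apply/negP; rewrite leye_eq => /eqP TE.
have [_ sol _] := hu.
have solT (T : R) : 0 < T -> EP_solution k u0 T u by move=> T0; apply: sol => //; rewrite TE ltry.
pose w (t : R) := u `|t|.
have sw : smooth_EP w by exact: (EP_solution_smooth k u0 u d0 hk solT).
have w0 : w 0 = u0.
  by have [_ E _] := solT 1 ltr01; apply/funext => x; rewrite /w normr0 E.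
have wN t : w t = w `|t| by rewrite /w normr_id.
have dw t l (x v : 'rV[R]_d) :
    is_derive x v (component (w t) l) (\sum_(j < d) v 0 j * partial j (component (w t) l) x).
  by have [_ [D _]] := sw.1 l; exact: (D t x v).
pose theta := row i1 A.
have theta1 : dot theta theta = 1.
  transitivity ((A *m A^T) i1 i1); last by rewrite hA mxE eqxx.
  by rewrite mxE; apply: eq_bigr => j _; rewrite !mxE.
have pw0 l : plane_wave theta (component (w 0) l).
  apply: plane_wave_orthogonal => // i ii1 x.
  (* As [i1] is the index 0, every other index is larger, so [hsym] covers all rows but the
     first. *)
  by rewrite w0; apply: hsym; rewrite hi1 lt0n -hi1; exact: ii1.
have pw : forall t, plane_wave theta (w t).
  apply: smooth_EP_plane_wave => // z z0; apply/funext => x; apply/rowP => l.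
  exact: (congr1 (fun g => g x) (pw0 l z z0)).
have [x0 hx] := hx0; apply: (plane_wave_slope_bound theta w x0 theta1 sw pw).
rewrite w0; suff -> : Dth theta (speed theta w) 0 x0 =
    rotated_partial A i1 (rotated_component A u0 i1) x0 by [].
have tU : tC 1 (speed theta w) by apply: tCS; apply: tCS; exact: tC_speed.
rewrite (DthE theta 0 _ 0 x0 tU) /rotated_partial.
have -> : speed theta w 0 = rotated_component A u0 i1.
  apply/funext => x; rewrite /speed /rotated_component; apply: eq_bigr => j _.
  by rewrite /wave w0 mxE.
by apply: eq_bigr => j _; rewrite mxE.
Qed.
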